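(* Let $\mathcal{G}$ and $\mathcal{H}$ be Morita equivalent locally compact étale groupoids such that $\lVert\cdot\rVert_e=\lVert\cdot\rVert_r$ on $\mathbb{C}\mathcal{G}^x_x$ for all $x\in\mathcal{G}^{(0)}$. Then the groupoid $\mathcal{H}$ has the same property: $\lVert\cdot\rVert_e=\lVert\cdot\rVert_r$ on $\mathbb{C}\mathcal{H}^y_y$ for all $y\in\mathcal{H}^{(0)}$.
   Context: Locally compact étale groupoids (not necessarily Hausdorff): groupoids $\mathcal{G}$, with unit space $\mathcal{G}^{(0)}$, range $r(g)=gg^{-1}$ and source $s(g)=g^{-1}g$, endowed with a topology such that the groupoid operations are continuous, $\mathcal{G}^{(0)}$ is locally compact Hausdorff in the relative topology, and $r$ is a local homeomorphism. Put $\mathcal{G}_x=s^{-1}(x)$, $\mathcal{G}^x=r^{-1}(x)$, $\mathcal{G}^x_x=\mathcal{G}^x\cap\mathcal{G}_x$ (the isotropy group, a discrete group with identity $x$). Morita equivalence: $\mathcal{G}$ and $\mathcal{H}$ are Morita equivalent if there is a locally compact étale groupoid $\mathcal{T}$ with unit space equal to the topological disjoint union $\mathcal{T}^{(0)}=\mathcal{G}^{(0)}\sqcup\mathcal{H}^{(0)}$ such that the restrictions of $\mathcal{T}$ to $\mathcal{G}^{(0)}$ and to $\mathcal{H}^{(0)}$ (the elements with both range and source in the given set) are $\mathcal{G}$ and $\mathcal{H}$, respectively, and such that both $\mathcal{G}^{(0)}$ and $\mathcal{H}^{(0)}$ meet all $\mathcal{T}$-orbits. Algebras: $C_c(\mathcal{G})$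 is the linear span of the spaces $C_c(U)$ of continuous compactly supported functions on open Hausdorff sets $U\subset\mathcal{G}$, extended by zero to $\mathcal{G}$. It is a $*$-algebra with $(f_1*f_2)(g)=\sum_{h\in\mathcal{G}^{r(g)}}f_1(h)f_2(h^{-1}g)$ and $f^*(g)=\overline{f(g^{-1})}$. $C^*(\mathcal{G})$ is its completion in the norm $\sup_\rho\lVert\rho(f)\rVert$ over all representations by bounded operators on Hilbert spaces. $C^*_r(\mathcal{G})$ is its completion in the reduced norm $\lVert f\rVert_r=\sup_{y\in\mathcal{G}^{(0)}}\lVert\rho_y(f)\rVert$, where $\rho_y(f)\delta_g=\sum_{h\in\mathcal{G}_{r(g)}}f(h)\delta_{hg}$ on $\ell^2(\mathcal{G}_y)$. A representation of $C^*(\mathcal{G})$ factors through $C^*_r(\mathcal{G})$ if it vanishes on the kernel of the canonical surjection $C^*(\mathcal{G})\to C^*_r(\mathcal{G})$. Induction: let $\rho\colon C^*(\mathcal{G}^x_x)\to B(H)$ be a representation of the full group C$^*$-algebra with canonical unitaries $u_g$. Let $L$ be the Hilbert space of functions $\xi\colon\mathcal{G}_x\to H$ with $\xi(gh)=\rho(u_h^* )\xi(g)$ for $g\in\mathcal{G}_x$, $h\in\mathcal{G}^x_x$, and $\sum_{g\in\mathcal{G}_x/\mathcal{G}^x_x}\lVert\xi(g)\rVert^2<\infty$. Then $\operatorname{Ind}\rho\colon C^*(\mathcal{G})\to B(L)$ is given by $((\operatorname{Ind}\rho)(f)\xi)(g)=\sum_{h\in\mathcal{G}^{r(g)}}f(h)\xi(h^{-1}g)$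 for $f\in C_c(\mathcal{G})$. Norms on the group algebra $\mathbb{C}\mathcal{G}^x_x=C_c(\mathcal{G}^x_x)$: $\lVert h\rVert_e=\sup_\rho\lVert\rho(h)\rVert$, the supremum over all representations $\rho$ of $C^*(\mathcal{G}^x_x)$ such that $\operatorname{Ind}\rho$ factors through $C^*_r(\mathcal{G})$ (this is a C$^*$-norm); $\lVert\cdot\rVert_r$ on $\mathbb{C}\mathcal{G}^x_x$ is the norm of the reduced group C$^*$-algebra $C^*_r(\mathcal{G}^x_x)$. The same definitions apply to $\mathcal{H}$. *)

(* Defs.v *)
From mathcomp Require Import all_boot all_order all_algebra.
From mathcomp Require Import complex sesquilinear.
From mathcomp Require Import all_classical all_reals all_analysis.

Set Implicit Arguments.
Unset Strict Implicit.
Unset Printing Implicit Defensive.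
Import Order.TTheory GRing.Theory Num.Theory.
Import numFieldNormedType.Exports.
Local Open Scope classical_set_scope.
Local Open Scope ring_scope.

(* An algebraic groupoid on a topological space, axiomatized by a partial     *)
(* product and an inverse. [gmul g h] is meaningful only when                 *)
(* g^-1 g = h h^-1; its value is junk otherwise, and no axiom, continuity     *)
(* condition or isomorphism below constrains it there. The units are the      *)
(* elements g g^-1. No compatibility with the topology is assumed here.       *)
Record groupoid := Groupoid {
  arrow :> topologicalType;
  gmul : arrow -> arrow -> arrow;
  ginv : arrow -> arrow;
  ginvK : forall g, ginv (ginv g) = g;
  gmulA : forall g h k,
    gmul (ginv g) g = gmul h (ginv h) -> gmul (ginv h) h = gmul k (ginv k) ->
    [/\ gmul (ginv (gmul g h)) (gmul g h) = gmul k (ginv k),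
        gmul (ginv g) g = gmul (gmul h k) (ginv (gmul h k)) &
        gmul (gmul g h) k = gmul g (gmul h k)];
  gmulKV : forall g h,
    gmul (ginv g) g = gmul h (ginv h) -> gmul (ginv g) (gmul g h) = h;
  gmulVK : forall g h,
    gmul (ginv g) g = gmul h (ginv h) -> gmul (gmul g h) (ginv h) = g }.

Section groupoid_theory.
Variable G : groupoid.
Implicit Types g h : G.

Definition rg g : G := gmul g (ginv g).
Definition sc g : G := gmul (ginv g) g.
Definition composable g h : Prop := sc g = rg h.
Definition units : set G := [set x | exists g, x = rg g].
Definition fiber_s (x : G) : set G := [set g | sc g = x].
Definition fiber_r (x : G) : set G := [set g | rg g = x].

Lemma rg_unit g : units (rg g). Proof. by exists g. Qed.

Lemma rg_inv g : rg (ginv g) = sc g.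
Proof. by rewrite /rg /sc ginvK. Qed.

Lemma sc_inv g : sc (ginv g) = rg g.
Proof. by rewrite /rg /sc ginvK. Qed.

Lemma sc_mul g h : composable g h -> sc (gmul g h) = sc h.
Proof.
move=> gh; have hV : composable h (ginv h) by rewrite /composable rg_inv.
by have [+ _ _] := gmulA gh hV; rewrite -/(sc _) -/(rg _) rg_inv.
Qed.

Lemma rg_mul g h : composable g h -> rg (gmul g h) = rg g.
Proof.
move=> gh; have gV : composable (ginv g) g by rewrite /composable sc_inv.
by have [_ + _] := gmulA gV gh; rewrite -/(sc _) -/(rg _) sc_inv.
Qed.

End groupoid_theory.
Arguments units G : clear implicits.

(* The reduction of G to a set X of units, with the relative topology. For    *)
(* X = {x} it is the isotropy group at x.                                     *)
Section reduction.
Variables (G : groupoid) (X : set G).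

Definition red_arrows : set G := [set g | X (rg g) /\ X (sc g)].

Lemma red_arrows_mul (g h : G) : g \in red_arrows -> h \in red_arrows ->
  composable g h -> gmul g h \in red_arrows.
Proof.
rewrite !inE => -[Xg _] [_ Xh] gh.
by split; rewrite ?(rg_mul gh) ?(sc_mul gh).
Qed.

Lemma red_arrows_inv (g : red_arrows) : ginv (val g) \in red_arrows.
Proof.
by have := valP g; rewrite !inE => -[Xr Xs]; split; rewrite ?rg_inv ?sc_inv.
Qed.

Definition red_mul (g h : red_arrows) : red_arrows :=
  insubd g (gmul (val g) (val h)).
Definition red_inv (g : red_arrows) : red_arrows :=
  SigSub (red_arrows_inv g).

Lemma val_red_mul g h : composable (val g) (val h) ->
  val (red_mul g h) = gmul (val g) (val h).
Proof.
by move=> gh; rewrite val_insubd (red_arrows_mul (valP g) (valP h) gh).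
Qed.

Lemma val_red_inv g : val (red_inv g) = ginv (val g).
Proof. by []. Qed.

Lemma val_red_rg g : val (red_mul g (red_inv g)) = rg (val g).
Proof.
by rewrite val_red_mul val_red_inv // /composable rg_inv.
Qed.

Lemma val_red_sc g : val (red_mul (red_inv g) g) = sc (val g).
Proof.
by rewrite val_red_mul val_red_inv // /composable sc_inv.
Qed.

Lemma red_composable g h :
  red_mul (red_inv g) g = red_mul h (red_inv h) -> composable (val g) (val h).
Proof. by move=> /(congr1 val); rewrite val_red_rg val_red_sc. Qed.

Lemma red_invK g : red_inv (red_inv g) = g.
Proof. by apply: val_inj; rewrite !val_red_inv ginvK. Qed.

Lemma red_mulA g h k :
  red_mul (red_inv g) g = red_mul h (red_inv h) ->
  red_mul (red_inv h) h = red_mul k (red_inv k) ->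
  [/\ red_mul (red_inv (red_mul g h)) (red_mul g h) = red_mul k (red_inv k),
      red_mul (red_inv g) g = red_mul (red_mul h k) (red_inv (red_mul h k)) &
      red_mul (red_mul g h) k = red_mul g (red_mul h k)].
Proof.
move=> /red_composable gh /red_composable hk.
have [ghk1 ghk2 ghkE] := gmulA gh hk.
split; apply: val_inj; rewrite ?val_red_rg ?val_red_sc ?val_red_mul //.
Qed.

Lemma red_mulKV g h : red_mul (red_inv g) g = red_mul h (red_inv h) ->
  red_mul (red_inv g) (red_mul g h) = h.
Proof.
move=> /red_composable gh; apply: val_inj.
have c : composable (val (red_inv g)) (val (red_mul g h)).
  by rewrite /composable val_red_inv val_red_mul // sc_inv rg_mul.
by rewrite val_red_mul // val_red_inv val_red_mul // gmulKV.
Qed.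

Lemma red_mulVK g h : red_mul (red_inv g) g = red_mul h (red_inv h) ->
  red_mul (red_mul g h) (red_inv h) = g.
Proof.
move=> /red_composable gh; apply: val_inj.
have c : composable (val (red_mul g h)) (val (red_inv h)).
  by rewrite /composable val_red_inv val_red_mul // rg_inv sc_mul.
by rewrite val_red_mul // val_red_inv val_red_mul // gmulVK.
Qed.

Definition reduction : groupoid :=
  @Groupoid red_arrows red_mul red_inv red_invK red_mulA red_mulKV red_mulVK.

End reduction.

Definition isotropy (G : groupoid) (x : G) : groupoid := reduction [set x].

Definition incl_isotropy (G : groupoid) (x : G) (h : isotropy x) : G :=
  set_val (h : red_arrows [set x]).

Definition local_homeomorphism (X Y : topologicalType) (f : X -> Y) : Prop :=
  forall x, exists U : set X,
    [/\ open U, U x, open (f @` U), {within U, continuous f} &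
      exists k : Y -> X, {within f @` U, continuous k} /\
                         (forall z, U z -> k (f z) = z)].

Definition range_map (G : groupoid) (g : G) : units G :=
  SigSub (mem_set (rg_unit g)).

(* Only the unit space is required to be Hausdorff.                           *)
Definition lc_etale (G : groupoid) : Prop :=
  [/\ {within [set p : G * G | composable p.1 p.2],
        continuous (fun p : G * G => gmul p.1 p.2)},
      continuous (@ginv G),
      hausdorff_space (units G : topologicalType),
      locally_compact [set: (units G : topologicalType)] &
      local_homeomorphism (@range_map G)].

Definition groupoid_iso (G H : groupoid) : Prop :=
  exists (phi : G -> H) (psi : H -> G),
    [/\ cancel phi psi, cancel psi phi, continuous phi, continuous psi &
        forall g h, (composable g h <-> composable (phi g) (phi h)) /\
          (composable g h -> phi (gmul g h) = gmul (phi g) (phi h))].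

(* X and Y are the copies of the unit spaces of G and H inside that of T;     *)
(* being complementary and both open makes the disjoint union topological.    *)
Definition morita_equivalent (G H : groupoid) : Prop :=
  exists (T : groupoid) (X Y : set T),
    [/\ lc_etale T,
        [/\ X `|` Y = units T, X `&` Y = set0,
          open (set_val @^-1` X : set (units T)) &
          open (set_val @^-1` Y : set (units T))],
        groupoid_iso G (reduction X),
        groupoid_iso H (reduction Y) &
        forall z, units T z ->
          (exists t, rg t = z /\ X (sc t)) /\ (exists t, rg t = z /\ Y (sc t))].

Section functions.
Variables (R : realType) (G : groupoid).
Implicit Types f : G -> R[i].

Definition Cc_on (U : set G) : set (G -> R[i]) := [set f |
  {within U, continuous (f : G -> R[i]^o)} /\
  exists K : set G,
    [/\ compact K, K `<=` U & forall g, ~ K g -> f g = 0]].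

Definition Cc : set (G -> R[i]) := [set f |
  exists (n : nat) (c : 'I_n -> R[i]) (F : 'I_n -> G -> R[i]),
    (forall k, exists U : set G,
       [/\ open U, hausdorff_space (U : topologicalType) & Cc_on U (F k)]) /\
    f = \sum_(k < n) c k *: F k].

(* The \in-indexed sums are sums over the support, which is finite in all     *)
(* uses below when f, f1, f2 belong to Cc and G is etale.                     *)
Definition convol f1 f2 : G -> R[i] :=
  fun g => \sum_(h \in fiber_r (rg g)) f1 h * f2 (gmul (ginv h) g).

Definition invol f : G -> R[i] := fun g => Num.conj (f (ginv g)).

Definition delta (g : G) : G -> R[i] := fun k => (k == g)%:R.

End functions.

(* Norms are R[i]-valued in a normed module over R[i]; [rnorm] is the same    *)
(* number as an element of R.                                                 *)
Definition rnorm (R : realType) (V : normedZmodType R[i]) (v : V) : R :=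
  complex.Re `|v|.

Record hilbert (R : realType) := Hilbert {
  hcar :> completeNormedModType R[i];
  ip : {dot hcar for (@Num.conj R[i])};
  ip_norm : forall v : hcar, ip v v = `|v| ^+ 2 }.

(* The operator norm of T on the normed space D with norm N.                  *)
Definition op_norm (R : realType) (X : Type) (D : set X) (N : X -> \bar R)
    (T : X -> X) : \bar R :=
  ereal_sup [set N (T v) | v in [set v | D v /\ (N v <= 1)%E]].

Definition hnorm (R : realType) (V : hilbert R) (T : V -> V) : \bar R :=
  op_norm setT (fun v : V => (rnorm v)%:E) T.

(* A complex *-algebra given by representatives: the elements are those of    *)
(* [sa_dom] modulo [sa_eq].                                                   *)
Record star_alg (R : realType) := StarAlg {
  sa_car :> lmodType R[i];
  sa_dom : set sa_car;
  sa_eq : sa_car -> sa_car -> Prop;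
  sa_mul : sa_car -> sa_car -> sa_car;
  sa_star : sa_car -> sa_car }.

Record representation (R : realType) (A : star_alg R) (V : hilbert R)
    (pi : A -> V -> V) : Prop := Representation {
  rep_wd : forall a b, sa_dom a -> sa_dom b -> sa_eq a b -> pi a = pi b;
  rep_linear : forall a, sa_dom a -> linear (pi a);
  rep_bounded : forall a, sa_dom a -> (hnorm (pi a) < +oo)%E;
  repP : forall (c : R[i]) a b v, sa_dom a -> sa_dom b ->
    pi (c *: a + b) v = c *: pi a v + pi b v;
  repM : forall a b v, sa_dom a -> sa_dom b ->
    pi (sa_mul a b) v = pi a (pi b v);
  repS : forall a v w, sa_dom a ->
    ip V (pi a v) w = ip V v (pi (sa_star a) w) }.

Section algebras.
Variables (R : realType) (G : groupoid).
Implicit Types f : G -> R[i].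

Definition Cc_alg : star_alg R :=
  @StarAlg R (G -> R[i]) (@Cc R G) eq (@convol R G) (@invol R G).

Definition full_norm f : \bar R :=
  ereal_sup [set e | exists (V : hilbert R) (pi : Cc_alg -> V -> V),
    representation pi /\ e = hnorm (pi f)].

Definition null_seq (N : (G -> R[i]) -> \bar R) (u : nat -> G -> R[i]) : Prop :=
  N (u n) @[n --> \oo] --> 0%E.

Definition Cc_cauchy (N : (G -> R[i]) -> \bar R) : set (nat -> G -> R[i]) :=
  [set u | (forall n, Cc (u n)) /\
    forall e : R, 0 < e -> exists M : nat, forall m n : nat,
      (M <= m)%N -> (M <= n)%N -> (N (u m - u n)%R < e%:E)%E].

(* The completion C*(G), as Cauchy sequences modulo null sequences with       *)
(* termwise operations.                                                       *)
Definition Cstar : star_alg R :=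
  @StarAlg R (nat -> G -> R[i]) (Cc_cauchy full_norm)
    (fun u v : nat -> G -> R[i] => null_seq full_norm (u - v))
    (fun u v n => convol (u n) (v n)) (fun u n => invol (u n)).

Definition in_Cstar f : Cstar := fun=> f.

Definition l2norm (y : G) (xi : G -> R[i]) : \bar R :=
  sqrte (\esum_(g in fiber_s y) (rnorm (xi g) ^+ 2)%:E).

(* l^2(G_y), its elements being extended by 0 to G.                           *)
Definition l2 (y : G) : set (G -> R[i]) := [set xi |
  (forall g, ~ fiber_s y g -> xi g = 0) /\ (l2norm y xi < +oo)%E].

Definition reg_delta f (g : G) : G -> R[i] :=
  \sum_(h \in fiber_s (rg g)) f h *: delta R (gmul h g).

Definition reg (y : G) f (xi : G -> R[i]) : G -> R[i] :=
  fun k => \sum_(g \in fiber_s y) xi g * reg_delta f g k.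

Definition red_norm f : \bar R :=
  ereal_sup [set op_norm (l2 y) (l2norm y) (reg y f) | y in units G].

(* The kernel of C*(G) -> C*_r(G), the latter being the completion of C_c(G)  *)
(* in [red_norm]: the canonical map is the identity on representing           *)
(* sequences, since [red_norm] is dominated by [full_norm].                   *)
Definition ker_red : set Cstar :=
  [set u : Cstar | sa_dom u /\ null_seq red_norm u].

End algebras.

Section induction.
Variables (R : realType) (G : groupoid) (x : G) (V : hilbert R).
Variable rho : Cstar R (isotropy x) -> V -> V.
Implicit Types xi : G -> V.

Definition unitary_star (h : isotropy x) : Cstar R (isotropy x) :=
  sa_star (in_Cstar (delta R h)).

Definition cosets : set (set G) :=
  [set [set gmul g (incl_isotropy h) | h in [set: isotropy x]]
    | g in fiber_s x].

(* The norm of xi(g) is constant on each coset, so any representative does.   *)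
Definition ind_norm xi : \bar R :=
  sqrte (\esum_(c in cosets) (rnorm (xi (xget x c)) ^+ 2)%:E).

(* Functions on G_x, extended by 0 to G.                                      *)
Definition ind_space : set (G -> V) := [set xi |
  [/\ forall g, ~ fiber_s x g -> xi g = 0,
      forall g (h : isotropy x), fiber_s x g ->
        xi (gmul g (incl_isotropy h)) = rho (unitary_star h) (xi g) &
      (ind_norm xi < +oo)%E]].

Definition ind (f : G -> R[i]) xi : G -> V :=
  fun g => \sum_(h \in fiber_r (rg g)) f h *: xi (gmul (ginv h) g).

(* The value of Ind rho at the class of u is the limit, in operator norm, of  *)
(* the operators [ind (u n)]; hence it vanishes iff their norms tend to 0.    *)
Definition ind_vanishes (u : Cstar R G) : Prop :=
  op_norm ind_space ind_norm (ind (u n)) @[n --> \oo] --> 0%E.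

Definition ind_factors_through_reduced : Prop :=
  forall u, ker_red u -> ind_vanishes u.

End induction.

Definition exotic_norm (R : realType) (G : groupoid) (x : G)
    (f : isotropy x -> R[i]) : \bar R :=
  ereal_sup [set e |
    exists (V : hilbert R) (rho : Cstar R (isotropy x) -> V -> V),
      [/\ representation rho, ind_factors_through_reduced rho &
          e = hnorm (rho (in_Cstar f))]].

(* ||.||_e = ||.||_r on the group algebra of the isotropy group at each unit  *)
Definition exotic_eq_reduced (R : realType) (G : groupoid) : Prop :=
  forall x : G, units G x ->
  forall f : isotropy x -> R[i], Cc f -> exotic_norm f = red_norm f.

(* Main.v *)
Require Import Defs.
From mathcomp Require Import all_boot all_order all_algebra.
From mathcomp Require Import complex.
From mathcomp Require Import all_classical all_reals all_analysis.
From mathcomp Require Import ring lra.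

Set Implicit Arguments.
Unset Strict Implicit.
Unset Printing Implicit Defensive.
Import Order.TTheory GRing.Theory Num.Theory.
Import numFieldNormedType.Exports.
Local Open Scope classical_set_scope.
Local Open Scope ring_scope.

(** Let T be the linking groupoid, x and y units of G and H, and t an arrow of T
   from x to y; conjugation by t identifies the isotropy groups at x and y. The
   reduced norm depends only on the group, so it suffices to show that the
   identification matches the representations whose induction factors through
   the reduced algebra.

   Ind rho factors through C*_r(G) iff every f in C_c(G) with reduced norm at
   most c acts with norm at most c. Suppose this holds for rho over H, and let
   w = f^* f with |f|_r <= c. The space of Ind rho over G is spanned by vectors d
   supported on one coset g G^x_x, and |w^n d|^2 = <w^(2n) d, d>. For a bump
   function a at the arrow g t^-1 of T, this equals the coefficient of
   a^* w^(2n) a, restricted to H, at a vector supported on the isotropy group at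
   y. The reduced norm of a^* w^(2n) a is at most K c^(4n), so by hypothesis
   |w^n d|^2 <= C c^(4n). This growth carries over to all finitely supported
   vectors, and a symmetric operator with |w^n d|^2 <= C c^(4n) for all n
   satisfies |w d| <= c^2 |d|. *)

(** * Real polynomials on a bounded interval *)

(** A corner controls one diagonal coefficient of $w^{2n}$, not the operator [w] on sums of cosets.
    Taking powers makes this enough: the constant depends on the vector but not on the exponent, and
    log-convexity of $n \mapsto |w^n d|^2$ lets no constant in front of a geometric bound survive.
    The same effect absorbs the loss in passing from one coset to finitely many. The norm criterion
    for factoring is where $C^*(G)$ itself is handled. Its harder direction needs an element of the
    kernel of $C^*(G) \to C^*_r(G)$ made from [f]: the class of $f^*f\,(f^*f - c^2)_+$, in general
    outside $C_c(G)$. It is represented by polynomials in $f^*f$, whose convergence has to be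
    uniform over all representations. The operators act on finitely supported vectors, an incomplete
    space, so spectral theory is replaced by a positivity theorem for polynomials that are
    nonnegative on $[0, M]$. *)

Section polynomials.
Variable R : realType.
Implicit Types (p q s : {poly R}) (M t : R).

(** By continuity a negative value at [t] would persist at a nearby point of the interval, to the
    right of [t], or to the left if [t = b]. This lets a factor that vanishes at one point be
    cancelled from an inequality. *)
Lemma horner_ge0_closure p a b t : a < b -> a <= t <= b ->
  (forall x, a <= x <= b -> x != t -> 0 <= p.[x]) -> 0 <= p.[t].
Proof.
move=> ab /andP[at_ tb] p0; rewrite leNgt; apply/negP => pt.
have cp : {for t, continuous (horner p)} by exact: continuous_horner.
have : \forall x \near t, p.[x] < 0.
  by apply: (cvgr_lt _ cp); exact: pt.
move=> /nbhs_ballP[e /= e0 ballp].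
case: (ltP t b) => tb'.
  pose x := t + Num.min (e / 2) (b - t).
  have m0 : 0 < Num.min (e / 2) (b - t) by rewrite lt_min divr_gt0// subr_gt0.
  have px : p.[x] < 0.
    apply: ballp; rewrite /ball /= /x opprD addrA subrr add0r normrN gtr0_norm//.
    by rewrite gt_min; apply/orP; left; lra.
  have : 0 <= p.[x].
    apply: p0; last by rewrite /x -subr_eq0 addrAC subrr add0r gt_eqF.
    rewrite /x; apply/andP; split; first by lra.
    by rewrite -lerBrDl ge_min lexx orbT.
  by rewrite leNgt px.
have {tb' tb} tb : t = b by apply/le_anti; rewrite tb.
pose x := t - Num.min (e / 2) (b - a).
have m0 : 0 < Num.min (e / 2) (b - a) by rewrite lt_min divr_gt0// subr_gt0.
have px : p.[x] < 0.
  apply: ballp; rewrite /ball /= /x opprB addrC subrK gtr0_norm//.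
  by rewrite gt_min; apply/orP; left; lra.
have : 0 <= p.[x].
  apply: p0; last by rewrite /x -subr_eq0 addrAC subrr add0r oppr_eq0 gt_eqF.
  rewrite /x tb; apply/andP; split; last by lra.
  by rewrite lerBrDl -lerBrDr ge_min lexx orbT.
by rewrite leNgt px.
Qed.

(** The model is $p \mapsto \langle p(T) a, a \rangle$ for a symmetric operator with $0 \le T \le
    M$. Additivity stands in for linearity, since positive constants can be moved into the
    squares. *)
Definition moment_positive M (L : {poly R} -> R) : Prop :=
  [/\ {morph L : p q / p + q}, forall s, 0 <= L (s ^+ 2),
      forall s, 0 <= L ('X * s ^+ 2) &
      forall s, 0 <= L ((M%:P - 'X) * s ^+ 2)].

Section moment_positive.
Variables (M : R) (M0 : 0 < M).

(** The certificate is $M\,t(M - t) = t(M - t)^2 + (M - t)t^2$; the factor $1/M$ is hidden in the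
    rescaled polynomial [r]. *)
Lemma moment_positive_mid L s : moment_positive M L ->
  0 <= L ('X * (M%:P - 'X) * s ^+ 2).
Proof.
move=> [LD _ LX LM]; pose r := (Num.sqrt M)^-1 *: s.
have <- : 'X * ((M%:P - 'X) * r) ^+ 2 + (M%:P - 'X) * ('X * r) ^+ 2 =
    'X * (M%:P - 'X) * s ^+ 2.
  have -> : s ^+ 2 = M%:P * r ^+ 2.
    rewrite /r exprZn mul_polyC scalerA exprVn sqr_sqrtr ?ltW//.
    by rewrite mulfV ?gt_eqF// scale1r.
  ring.
by rewrite LD addr_ge0.
Qed.

Lemma moment_positiveX L : moment_positive M L ->
  moment_positive M (fun p => L ('X * p)).
Proof.
move=> Lp; have [LD L2 LX LM] := Lp; split=> [p q|s|s|s].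
- by rewrite mulrDr LD.
- exact: LX.
- by rewrite mulrA -expr2 -exprMn.
- by rewrite mulrA; exact: moment_positive_mid.
Qed.

Lemma moment_positiveM L : moment_positive M L ->
  moment_positive M (fun p => L ((M%:P - 'X) * p)).
Proof.
move=> Lp; have [LD L2 LX LM] := Lp; split=> [p q|s|s|s].
- by rewrite mulrDr LD.
- exact: LM.
- by rewrite mulrA (mulrC _ 'X); exact: moment_positive_mid.
- by rewrite mulrA -expr2 -exprMn.
Qed.

Lemma moment_positive_sqr L r : moment_positive M L ->
  moment_positive M (fun p => L (r ^+ 2 * p)).
Proof.
move=> [LD L2 LX LM]; split=> [p q|s|s|s].
- by rewrite mulrDr LD.
- by rewrite -exprMn.
- by rewrite mulrCA -exprMn.
- by rewrite mulrCA -exprMn.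
Qed.

(* Subtracting the minimum of q, which is a square, leaves a polynomial with a
   root in [0, M]; the root gives one of the factors 'X, M - 'X, ('X - a)^2. *)
Lemma moment_positive_ge0 L q : moment_positive M L ->
  (forall t, 0 <= t <= M -> 0 <= q.[t]) -> 0 <= L q.
Proof.
(* The functional is generalised together with the polynomial, because each factor split off from
   [q] is absorbed into [L]. *)
have [n] := ubnP (size q); elim: n => // n IHn in L q *.
rewrite ltnS => sq Lp q0; have [LD L2 LX LM] := Lp.
have cq : {within `[0, M], continuous (horner q)}.
  by apply: continuous_subspaceT => x; exact: continuous_horner.
have [a aM amin] := EVT_min (ltW M0) cq.
have {}aM : 0 <= a <= M by move: aM; rewrite in_itv.
have {}amin t : 0 <= t <= M -> q.[a] <= q.[t].
  by move=> tM; apply: amin; rewrite in_itv.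
have ma0 := q0 _ aM.
set m := q.[a] in amin ma0.
have -> : q = (q - m%:P) + (Num.sqrt m)%:P ^+ 2.
  by rewrite -rmorphXn /= sqr_sqrtr// subrK.
rewrite LD addr_ge0// {L2}.
have rq : root (q - m%:P) a by rewrite rootE !hornerE subrr.
have qm0 t : 0 <= t <= M -> 0 <= (q - m%:P).[t].
  by move=> tM; rewrite !hornerE subr_ge0 amin.
have : (size (q - m%:P)%R <= maxn n 1)%N.
  rewrite (leq_trans (size_polyD _ _))// geq_max size_polyN !leq_max.
  rewrite (leq_trans sq) ?size_polyC //=; case: eqP => //=; rewrite ?orbT//.
move: (q - m%:P) rq qm0 => {m ma0 amin cq q0 sq}q rq q0 sq.
have [->|qn0] := eqVneq q 0.
  have : L 0 + L 0 = L 0 by rewrite -LD addr0.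
  by move=> /eqP; rewrite -subr_eq0 addrK => /eqP ->.
case: n => [|n] in sq IHn *.
  have := rq; rewrite (size1_polyC sq) rootC => /eqP q00.
  by move: qn0; rewrite (size1_polyC sq) q00 eqxx.
rewrite (maxn_idPl _)// in sq.
have /factor_theorem[q1 qE] := rq.
have sX : size (q1 * ('X - a%:P)) = (size q1).+1.
  rewrite size_Mmonic ?monicXsubC// ?size_XsubC ?addn2//.
  by move: qn0; rewrite qE; apply: contra_neq => ->; rewrite mul0r.
have sq1 : (size q1 <= n)%N by rewrite -ltnS -sX -qE.
have [aE|a0] := eqVneq a 0.
  rewrite qE aE subr0 mulrC; apply: (IHn (fun p => L ('X * p))) => //.
    exact: moment_positiveX.
  move=> t tM; apply: (horner_ge0_closure M0 tM) => x /andP[x0 xM] _.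
  have [xE|xn0] := eqVneq x 0.
    rewrite xE; apply: (@horner_ge0_closure _ 0 M) => //; first by rewrite lexx ltW.
    move=> y /andP[y0 yM] yn0; have := q0 y; rewrite y0 yM => /(_ isT).
    by rewrite qE aE !hornerE ?subr0 pmulr_lge0// lt_neqAle eq_sym yn0.
  have := q0 x; rewrite x0 xM => /(_ isT).
  by rewrite qE aE !hornerE ?subr0 pmulr_lge0// lt_neqAle eq_sym xn0.
have [aE|aM'] := eqVneq a M.
  have -> : q = (M%:P - 'X) * (- q1) by rewrite qE aE; ring.
  apply: (IHn (fun p => L ((M%:P - 'X) * p))).
  - by rewrite size_polyN.
  - exact: moment_positiveM.
  move=> t tM; apply: (horner_ge0_closure M0 tM) => x xM0 _.
  apply: (@horner_ge0_closure _ 0 M) => //.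
  move=> y yM0 _; apply: (horner_ge0_closure M0 yM0) => z zM zy.
  have [zE|zn0] := eqVneq z M.
    rewrite zE; apply: (@horner_ge0_closure _ 0 M) => //; first by rewrite lexx ltW.
    move=> w /andP[w0 wM] wn0; have := q0 w; rewrite w0 wM => /(_ isT).
    rewrite qE aE !hornerE -mulrNN pmulr_lge0// opprB subr_gt0 lt_neqAle.
    by rewrite wn0.
  have := q0 z zM; rewrite qE aE !hornerE -mulrNN pmulr_lge0// opprB subr_gt0.
  by rewrite lt_neqAle zn0; case/andP: zM.
have {}a0 : 0 < a by rewrite lt_neqAle eq_sym a0; case/andP: aM.
have {}aM' : a < M by rewrite lt_neqAle aM'; case/andP: aM.
(* At an interior zero the cofactor is nonpositive on the left and nonnegative on the right, hence
   vanishes there: the root is double and a square splits off. *)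
have q1a : root q1 a.
  apply/rootP/le_anti/andP; split.
    rewrite -oppr_ge0 -hornerN.
    apply: (@horner_ge0_closure _ 0 a) => //; first by rewrite lexx ltW.
    move=> x /andP[x0 xa] xna.
    have : 0 <= q.[x] by apply: q0; rewrite x0 (le_trans xa)// ltW.
    rewrite qE !hornerE -mulrNN pmulr_lge0// opprB subr_gt0 lt_neqAle.
    by rewrite xna.
  apply: (@horner_ge0_closure _ a M) => //; first by rewrite lexx ltW.
  move=> x /andP[ax xM] xna.
  have : 0 <= q.[x] by apply: q0; rewrite xM (le_trans (ltW a0) ax).
  by rewrite qE !hornerE pmulr_lge0// subr_gt0 lt_neqAle eq_sym xna.
have /factor_theorem[q2 q1E] := q1a.
have q2E : q = ('X - a%:P) ^+ 2 * q2 by rewrite qE q1E; ring.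
rewrite q2E; apply: (IHn (fun p => L (('X - a%:P) ^+ 2 * p))).
- have q2n0 : q2 != 0.
    by move: qn0; rewrite q2E; apply: contra_neq => ->; rewrite mulr0.
  rewrite ltnS; apply: leq_trans sq1; rewrite q1E size_Mmonic ?monicXsubC// size_XsubC addn2.
  by rewrite /= leqnSn.
- exact: moment_positive_sqr.
move=> t tM; apply: (horner_ge0_closure M0 tM) => x xM0 xt.
have [xE|xna] := eqVneq x a.
  rewrite xE; apply: (@horner_ge0_closure _ 0 M) => // y yM yna.
  have := q0 y yM; rewrite q2E !hornerE pmulr_rge0//.
  by rewrite exprn_even_gt0//= subr_eq0.
have := q0 x xM0; rewrite q2E !hornerE pmulr_rge0//.
by rewrite exprn_even_gt0//= subr_eq0.
Qed.

End moment_positive.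

(** The classical recursion for $\sqrt{t^2}$ from the proof of the Stone-Weierstrass theorem, which
    increases to $|t|$ on $[-1, 1]$. *)
Fixpoint abs_poly n : {poly R} :=
  if n is k.+1 then abs_poly k + 2^-1 *: ('X^2 - abs_poly k ^+ 2) else 0.

(** The error satisfies $d_{n+1} = d_n (1 - (|t| + p_n)/2)$. The last bound is a division-free form
    of $d_n \le |t| / (1 + n|t|/2)$, which yields $d_n \le 2/n$ uniformly in [t]. *)
Lemma abs_poly_approx n t : `|t| <= 1 ->
  [/\ 0 <= (abs_poly n).[t], (abs_poly n).[t] <= `|t| &
      (`|t| - (abs_poly n).[t]) * (1 + n%:R * (`|t| / 2)) <= `|t|].
Proof.
move=> t1; elim: n => [|n [p0 pt pb]] /=.
  by rewrite hornerC subr0 mul0r addr0 mulr1 !lexx.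
set p := (abs_poly n).[t] in p0 pt pb *.
have -> : (abs_poly n + 2^-1 *: ('X^2 - abs_poly n ^+ 2)).[t] =
  p + 2^-1 * (t ^+ 2 - p ^+ 2) by rewrite !hornerE.
have -> : t ^+ 2 = `|t| ^+ 2 by rewrite real_normK ?num_real.
move: `|t| t1 pt pb (normr_ge0 t) => a a1 pa pb a0.
have n0 : 0 <= n%:R :> R by [].
have ap : 0 <= a - p by rewrite subr_ge0.
have ap' : 0 <= 1 - (a + p) / 2 by lra.
have n1E : n.+1%:R = n%:R + 1 :> R by rewrite natr1.
have E : a - (p + 2^-1 * (a ^+ 2 - p ^+ 2)) = (a - p) * (1 - (a + p) / 2).
  by field.
split.
- by nra.
- by rewrite -subr_ge0 E mulr_ge0.
have key : (1 - (a + p) / 2) * (1 + n.+1%:R * (a / 2)) <= 1 + n%:R * (a / 2).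
  rewrite n1E -subr_ge0.
  have -> : 1 + n%:R * (a / 2) - (1 - (a + p) / 2) * (1 + (n%:R + 1) * (a / 2)) =
    p / 2 + (a + p) * ((n%:R + 1) * a) / 4 by field.
  by rewrite addr_ge0// divr_ge0// !mulr_ge0// addr_ge0.
by rewrite E -mulrA; apply: le_trans pb; exact: ler_wpM2l.
Qed.

(** Uses $\max(0, s) = (s + |s|)/2$ with $s = t - c$. Division by [N] brings $s$ into $[-1, 1]$, and
    the resulting error is at most $(N/2)(2/n) = N/n$. *)
Lemma pos_part_poly (M c e : R) : 0 <= M -> 0 <= c -> 0 < e ->
  exists q, forall t, 0 <= t <= M -> `|q.[t] - Num.max 0 (t - c)| <= e.
Proof.
move=> M0 c0 e0; pose N := M + c + 1.
have N0 : 0 < N by rewrite /N; lra.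
have [n n0] : exists n, N / e < n%:R.
  by exists (Num.truncn (N / e)).+1; exact: truncnS_gt.
exists (2^-1 *: ('X - c%:P) + (N / 2) *: (abs_poly n \Po (N^-1 *: ('X - c%:P)))).
move=> t /andP[t0 tM]; pose x := N^-1 * (t - c).
have -> : (2^-1 *: ('X - c%:P) +
    (N / 2) *: (abs_poly n \Po (N^-1 *: ('X - c%:P)))).[t] =
    2^-1 * (t - c) + N / 2 * (abs_poly n).[x].
  by rewrite !hornerD !hornerZ horner_comp hornerZ hornerXsubC.
have tE : t - c = N * x by rewrite /x mulrA mulfV ?mul1r// gt_eqF.
have x1 : `|x| <= 1.
  rewrite /x normrM gtr0_norm ?invr_gt0// mulrC ler_pdivrMr// mul1r ler_norml.
  by rewrite /N; apply/andP; split; lra.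
have [p0 px pb] := abs_poly_approx n x1; rewrite tE.
have -> : Num.max 0 (N * x) = 2^-1 * (N * x) + N / 2 * `|x|.
  have [x0|/ltW x0] := leP 0 x.
    by rewrite (ger0_norm x0) max_r; [lra | rewrite mulr_ge0// ltW].
  by rewrite (ler0_norm x0) max_l; [lra | rewrite pmulr_rle0].
have -> : 2^-1 * (N * x) + N / 2 * (abs_poly n).[x] -
    (2^-1 * (N * x) + N / 2 * `|x|) = - (N / 2 * (`|x| - (abs_poly n).[x])).
  by ring.
rewrite normrN normrM gtr0_norm ?divr_gt0// ger0_norm ?subr_ge0//.
set d := `|x| - _ in pb *.
have d0 : 0 <= d by rewrite subr_ge0.
have : d * n%:R <= 2.
  have [xE|xn0] := eqVneq `|x| 0.
    have -> : d = 0 by apply/le_anti; rewrite d0 andbT /d xE sub0r oppr_le0.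
    by rewrite mul0r.
  have x0 : 0 < `|x| by rewrite lt_neqAle eq_sym xn0 normr_ge0.
  rewrite -(ler_pM2r (divr_gt0 x0 (ltr0Sn _ 1))).
  apply: le_trans (_ : `|x| <= _); last by lra.
  by apply: le_trans pb; rewrite -mulrA mulrDr mulr1 lerDr.
move=> dn; move: n0; rewrite ltr_pdivrMr// => n0.
have nr0 : 0 < n%:R :> R.
  rewrite lt_neqAle ler0n andbT; apply: contraTneq n0 => <-.
  by rewrite mul0r -leNgt ltW.
rewrite -(ler_pM2r nr0) (mulrC e); apply: le_trans (_ : N <= _); last exact: ltW.
by rewrite -mulrA; nra.
Qed.

End polynomials.

(** * Semi-inner products *)

(** The form lives on a subset [D] of an ambient module because the main instances are finitely
    supported functions inside [G -> V]. Estimates proved there are extended to square-summable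
    functions afterwards. *)
Record semi_inner (R : realType) (E : lmodType R[i]) (D : set E)
    (s : E -> E -> R[i]) : Prop := SemiInner {
  si_dom0 : D 0;
  si_dom : forall c a b, D a -> D b -> D (c *: a + b);
  si_linear : forall c a b d, D a -> D b -> D d ->
    s (c *: a + b) d = c * s a d + s b d;
  si_conj : forall a b, D a -> D b -> s b a = Num.conj (s a b);
  si_ge0 : forall a, D a -> 0 <= s a a }.

Lemma ReD (R : realType) (z w : R[i]) :
  complex.Re (z + w) = complex.Re z + complex.Re w.
Proof. exact: raddfD. Qed.

Lemma Re_ZM (R : realType) (c : R) (z : R[i]) :
  complex.Re (c%:C%C * z) = c * complex.Re z.
Proof. by case: z => a b /=; rewrite mul0r subr0. Qed.

Lemma Re_conj (R : realType) (z : R[i]) :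
  complex.Re (Num.conj z) = complex.Re z.
Proof. by case: z. Qed.

Lemma conj_real (R : realType) (x : R) : Num.conj (x%:C%C) = x%:C%C :> R[i].
Proof. exact: conjc_real. Qed.

Lemma Re_ge0 (R : realType) (z : R[i]) : 0 <= z -> 0 <= complex.Re z.
Proof. by case: z => a b; rewrite lecE /= => /andP[]. Qed.

Lemma ReK_ge0 (R : realType) (z : R[i]) : 0 <= z -> (complex.Re z)%:C%C = z.
Proof. by case: z => a b; rewrite lecE /= => /andP[/eqP -> _]. Qed.

Section semi_inner.
Variables (R : realType) (E : lmodType R[i]) (D : set E) (s : E -> E -> R[i]).
Hypothesis sP : semi_inner D s.
Implicit Types a b d : E.

Definition sqn a : R := complex.Re (s a a).

Lemma si_domD a b : D a -> D b -> D (a + b).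
Proof. by move=> Da Db; rewrite -[a]scale1r; exact: (si_dom sP). Qed.

Lemma si_domZ c a : D a -> D (c *: a).
Proof. by move=> Da; rewrite -[_ *: _]addr0; apply: (si_dom sP) => //; exact: si_dom0 sP. Qed.

Lemma si_domB a b : D a -> D b -> D (a - b).
Proof. by move=> Da Db; rewrite addrC -scaleN1r; exact: (si_dom sP). Qed.

Lemma si_dom_sum (I : Type) (r : seq I) (P : pred I) (F : I -> E) :
  (forall i, P i -> D (F i)) -> D (\sum_(i <- r | P i) F i).
Proof. by move=> DF; elim/big_ind: _ => //; [exact: si_dom0 sP|exact: si_domD]. Qed.

Lemma siDl a b d : D a -> D b -> D d -> s (a + b) d = s a d + s b d.
Proof. by move=> Da Db Dd; rewrite -[a]scale1r (si_linear sP)// mul1r scale1r. Qed.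

Lemma si0l d : D d -> s 0 d = 0.
Proof.
move=> Dd; have D0 := si_dom0 sP; have := siDl D0 D0 Dd.
by rewrite addr0 => /eqP; rewrite eq_sym -subr_eq0 addrK => /eqP.
Qed.

Lemma siZl c a d : D a -> D d -> s (c *: a) d = c * s a d.
Proof.
move=> Da Dd; have D0 := si_dom0 sP.
by rewrite -[c *: a]addr0 (si_linear sP)// si0l// addr0.
Qed.

Lemma siDr a b d : D a -> D b -> D d -> s d (a + b) = s d a + s d b.
Proof.
move=> Da Db Dd.
rewrite (si_conj sP (si_domD Da Db) Dd) siDl// rmorphD /=.
by rewrite -!(si_conj sP).
Qed.

Lemma siZr c a d : D a -> D d -> s d (c *: a) = Num.conj c * s d a.
Proof.
move=> Da Dd; rewrite (si_conj sP (si_domZ c Da) Dd) siZl// rmorphM /=.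
by rewrite -(si_conj sP).
Qed.

Lemma si0r d : D d -> s d 0 = 0.
Proof.
by move=> Dd; rewrite (si_conj sP (si_dom0 sP) Dd) si0l// rmorph0.
Qed.

Lemma si_suml (I : Type) (r : seq I) (P : pred I) (F : I -> E) d : D d ->
  (forall i, P i -> D (F i)) ->
  s (\sum_(i <- r | P i) F i) d = \sum_(i <- r | P i) s (F i) d.
Proof.
move=> Dd DF; elim: r => [|i r IHr]; first by rewrite !big_nil si0l.
rewrite !big_cons; case: ifP => // Pi.
by rewrite siDl ?IHr//; [exact: DF|exact: si_dom_sum].
Qed.

Lemma si_sumr (I : Type) (r : seq I) (P : pred I) (F : I -> E) d : D d ->
  (forall i, P i -> D (F i)) ->
  s d (\sum_(i <- r | P i) F i) = \sum_(i <- r | P i) s d (F i).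
Proof.
move=> Dd DF; rewrite (si_conj sP (si_dom_sum _ DF) Dd) si_suml// rmorph_sum /=.
by apply: eq_bigr => i Pi; rewrite -(si_conj sP)//; exact: DF.
Qed.

Lemma sqn_ge0 a : D a -> 0 <= sqn a.
Proof. by move=> Da; exact: Re_ge0 (si_ge0 sP Da). Qed.

Lemma sqn0 : sqn 0 = 0.
Proof. by rewrite /sqn si0l//; exact: si_dom0 sP. Qed.

Lemma sqnE a : D a -> s a a = (sqn a)%:C%C.
Proof. by move=> Da; rewrite /sqn ReK_ge0// (si_ge0 sP). Qed.

Lemma sqnD (t : R) a b : D a -> D b ->
  sqn (t%:C%C *: a + b) = t ^+ 2 * sqn a + 2 * t * complex.Re (s a b) + sqn b.
Proof.
move=> Da Db; have Dta := si_domZ t%:C%C Da.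
rewrite /sqn siDl ?siDr ?siZl ?siZr//; try exact: si_domD.
rewrite conj_real !ReD !Re_ZM (si_conj sP Da Db) Re_conj.
by ring.
Qed.

Lemma sqnZ (t : R[i]) a : D a -> sqn (t *: a) = rnorm t ^+ 2 * sqn a.
Proof.
move=> Da; rewrite /sqn siZl ?siZr//; last exact: si_domZ.
have -> : rnorm t ^+ 2 = complex.Re (t * Num.conj t).
  rewrite -normCK /rnorm normc_def /=; set x := Num.sqrt _.
  by rewrite mulr0 subr0 expr2.
rewrite mulrA (sqnE Da); case: (t * _) => x y /=.
by rewrite !mulr0 subr0.
Qed.

Lemma cauchy_schwarz_Re a b : D a -> D b ->
  complex.Re (s a b) ^+ 2 <= sqn a * sqn b.
Proof.
move=> Da Db; set x := complex.Re _.
have pos (t : R) : 0 <= t ^+ 2 * sqn a + 2 * t * x + sqn b.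
  by rewrite -sqnD//; apply: sqn_ge0; exact: (si_dom sP).
have a0 := sqn_ge0 Da; have b0 := sqn_ge0 Db.
have [qa|qa] := eqVneq (sqn a) 0.
  rewrite qa mul0r; have [->|x0] := eqVneq x 0; first by rewrite expr0n.
  (* When [sqn a = 0] the quadratic is affine in the parameter, and this parameter gives it the
     value $-1$. *)
  have := pos (- (sqn b + 1) / (2 * x)); rewrite qa mulr0 add0r.
  have -> : 2 * (- (sqn b + 1) / (2 * x)) * x = - (sqn b + 1) by field.
  by rewrite opprD addrAC addNr add0r ler0N1.
have := pos (- x / sqn a); rewrite -(pmulr_rge0 _ (_ : 0 < sqn a)); last first.
  by rewrite lt_neqAle eq_sym qa.
have -> : sqn a * ((- x / sqn a) ^+ 2 * sqn a + 2 * (- x / sqn a) * x + sqn b) =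
  sqn a * sqn b - x ^+ 2 by field.
by rewrite subr_ge0.
Qed.

(** Iterates $|a + b|^2 \le 2|a|^2 + 2|b|^2$. The crude power of 2 is harmless, as it only enters
    constants whose size does not matter. *)
Lemma sqn_sum (I : Type) (r : seq I) (F : I -> E) :
  (forall i, D (F i)) ->
  sqn (\sum_(i <- r) F i) <= 2 ^+ (size r) * \sum_(i <- r) sqn (F i).
Proof.
move=> DF; elim: r => [|i r IHr]; first by rewrite !big_nil sqn0 mulr0.
rewrite !big_cons /= exprS.
have DS := si_dom_sum r (fun j (_ : true) => DF j).
have le2 : sqn (F i + \sum_(j <- r) F j) <=
    2 * sqn (F i) + 2 * sqn (\sum_(j <- r) F j).
  have := sqn_ge0 (si_domB (DF i) DS).
  rewrite (_ : F i - _ = (- 1)%:C%C *: (\sum_(j <- r) F j) + F i); last first.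
    by rewrite rmorphN1 scaleN1r addrC.
  have -> : F i + \sum_(j <- r) F j = 1%:C%C *: (\sum_(j <- r) F j) + F i.
    by rewrite scale1r addrC.
  by rewrite !sqnD//; lra.
apply: (le_trans le2); rewrite -mulrDr -mulrA ler_pM2l//.
rewrite mulrDr lerD//.
by rewrite ler_peMl ?sqn_ge0// exprn_ege1// ler1n.
Qed.

Section operator.
Variable T : E -> E.
Hypotheses (TD : forall a, D a -> D (T a))
  (Tlin : forall c a b, D a -> D b -> T (c *: a + b) = c *: T a + T b)
  (Tsym : forall a b, D a -> D b -> s (T a) b = s a (T b)).

Lemma iter_dom n a : D a -> D (iter n T a).
Proof. by move=> Da; elim: n => //= n; exact: TD. Qed.

(** Symmetry moves one [T] across: $|T^{n+1}a|^2 = \langle T^n a, T^{n+2} a \rangle$, and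
    Cauchy-Schwarz applies. *)
Lemma sqn_iter_logconvex n a : D a ->
  sqn (iter n.+1 T a) ^+ 2 <= sqn (iter n T a) * sqn (iter n.+2 T a).
Proof.
move=> Da; have Dn k := iter_dom k Da.
have -> : sqn (iter n.+1 T a) = complex.Re (s (iter n T a) (iter n.+2 T a)).
  by rewrite /sqn /= Tsym//; exact: (Dn n.+1).
exact: cauchy_schwarz_Re.
Qed.

(** By log-convexity the ratios of consecutive terms do not decrease. If the first ratio [r]
    exceeded [c], the sequence would grow at least like $r^n$, which no bound $C c^n$ allows. *)
Lemma bounded_by_growth (C c : R) a : D a -> 0 <= c ->
  (forall n, sqn (iter n T a) <= C * c ^+ n) -> sqn (T a) <= c * sqn a.
Proof.
move=> Da c0 bnd; rewrite leNgt; apply/negP => lt1.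
pose m n := sqn (iter n T a).
have m0 n : 0 <= m n by exact: sqn_ge0 (iter_dom n Da).
have mlc n : m n.+1 ^+ 2 <= m n * m n.+2 by exact: sqn_iter_logconvex.
have m1 : 0 < m 1%N by apply: le_lt_trans lt1; rewrite mulr_ge0// (m0 0%N).
have m00 : 0 < m 0%N.
  rewrite lt_neqAle eq_sym m0 andbT; apply: contraTneq (mlc 0%N) => ->.
  by rewrite mul0r -ltNge exprn_gt0.
pose r := m 1%N / m 0%N.
have cr : c < r by rewrite /r ltr_pdivlMr.
have r0 : 0 < r by exact: le_lt_trans cr.
have step n : 0 < m n /\ r * m n <= m n.+1.
  elim: n => [|n [mn rmn]]; first by rewrite /r divfK ?gt_eqF.
  have mn1 : 0 < m n.+1 by apply: lt_le_trans rmn; rewrite mulr_gt0.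
  split=> //; rewrite -(ler_pM2l mn); apply: le_trans (mlc n).
  by rewrite expr2 mulrA (mulrC (m n)) ler_pM2r.
have geo n : m 0%N * r ^+ n <= m n.
  elim: n => [|n IHn]; first by rewrite expr0 mulr1.
  apply: le_trans (step n).2; rewrite exprS mulrCA ler_pM2l//.
have [cE|c1] := eqVneq c 0.
  have := bnd 1%N; rewrite cE expr1 mulr0 => /(lt_le_trans m1).
  by rewrite ltxx.
have {c0 c1}c0 : 0 < c by rewrite lt_neqAle eq_sym c1.
pose x := r / c - 1.
have x0 : 0 < x by rewrite subr_gt0 ltr_pdivlMr// mul1r.
have rcE : r / c = 1 + x by rewrite /x addrC subrK.
(* Bernoulli's inequality: $(r/c)^n$ grows at least linearly, so it passes any constant. *)
have bern n : 1 + n%:R * x <= (r / c) ^+ n.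
  rewrite rcE; elim: n => [|n IHn]; first by rewrite mul0r addr0.
  rewrite exprS; apply: le_trans (_ : (1 + x) * (1 + n%:R * x) <= _).
    rewrite -subr_ge0 -natr1.
    have -> : (1 + x) * (1 + n%:R * x) - (1 + (n%:R + 1) * x) = n%:R * x ^+ 2.
      by ring.
    by rewrite mulr_ge0// sqr_ge0.
  by apply: ler_wpM2l => //; rewrite addr_ge0// ltW.
have bC n : m 0%N * (1 + n%:R * x) <= C.
  apply: le_trans (_ : m 0%N * (r / c) ^+ n <= _); first by rewrite ler_pM2l.
  rewrite -(ler_pM2r (exprn_gt0 n c0)) -mulrA -exprMn divfK ?gt_eqF//.
  exact: le_trans (geo n) (bnd n).
have := bC (Num.truncn (C / (m 0%N * x))).+1; rewrite leNgt => /negP; apply.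
rewrite mulrDr mulr1; apply: ltr_wpDl; first exact: ltW.
rewrite mulrCA -ltr_pdivrMr ?mulr_gt0//.
exact: truncnS_gt.
Qed.

Definition opoly (p : {poly R}) a : E :=
  \sum_(i < size p) (p`_i)%:C%C *: iter i T a.

Lemma opoly_widen n (p : {poly R}) a : (size p <= n)%N ->
  opoly p a = \sum_(i < n) (p`_i)%:C%C *: iter i T a.
Proof.
move=> pn; rewrite /opoly (big_ord_widen n (fun i => (p`_i)%:C%C *: iter i T a))//.
rewrite big_mkcond; apply: eq_bigr => i _; case: ltnP => // pi.
by rewrite nth_default// scale0r.
Qed.

Lemma opoly_dom p a : D a -> D (opoly p a).
Proof.
by move=> Da; apply: si_dom_sum => i _; apply: si_domZ; exact: iter_dom.
Qed.

Lemma opoly_lin c (p q : {poly R}) a : opoly (c *: p + q) a = c%:C%C *: opoly p a + opoly q a.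
Proof.
pose n := maxn (size (c *: p + q)) (maxn (size p) (size q)).
rewrite !(opoly_widen (n := n)) ?leq_max ?leqnn ?orbT// scaler_sumr -big_split.
by apply: eq_bigr => i _ /=; rewrite coefD coefZ rmorphD rmorphM /= scalerDl scalerA.
Qed.

Lemma T_sum (I : Type) (r : seq I) (P : pred I) (F : I -> E) :
  (forall i, P i -> D (F i)) ->
  T (\sum_(i <- r | P i) F i) = \sum_(i <- r | P i) T (F i).
Proof.
have D0 := si_dom0 sP; have T0 : T 0 = 0.
  have := Tlin (-1) D0 D0; rewrite scaler0 addr0 => ->.
  by rewrite scaleN1r addNr.
move=> DF; elim: r => [|i r IHr]; first by rewrite !big_nil.
rewrite !big_cons; case: ifP => // Pi; rewrite -IHr -[F i]scale1r Tlin ?scale1r//.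
  exact: DF.
exact: si_dom_sum.
Qed.

Lemma opolyX p a : D a -> opoly ('X * p) a = T (opoly p a).
Proof.
move=> Da; rewrite (opoly_widen (n := (size p).+1)); last first.
  by rewrite (leq_trans (size_polyMleq _ _))// size_polyX.
rewrite big_ord_recl coefXM eqxx scale0r add0r /opoly T_sum; last first.
  by move=> i _; apply: si_domZ; exact: iter_dom.
apply: eq_bigr => i _; rewrite lift0 coefXM /=.
have D0 := si_dom0 sP; rewrite -[(p`_i)%:C%C *: iter i T a]addr0 Tlin//; last exact: iter_dom.
have -> : T 0 = 0.
  have := Tlin (-1) D0 D0; rewrite scaler0 addr0 => ->.
  by rewrite scaleN1r addNr.
by rewrite addr0.
Qed.

Lemma opolyC c a : opoly c%:P a = c%:C%C *: a.
Proof.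
rewrite (opoly_widen (n := 1)) ?size_polyC; last by case: (c != 0).
by rewrite big_ord_recl big_ord0 coefC addr0.
Qed.

Lemma opoly0 a : opoly 0 a = 0.
Proof. by rewrite -polyC0 opolyC scale0r. Qed.

Lemma opolyM (p q : {poly R}) a : D a -> opoly (p * q) a = opoly p (opoly q a).
Proof.
move=> Da; elim/poly_ind: p => [|p c IHp]; first by rewrite mul0r !opoly0.
have -> : (p * 'X + c%:P) * q = c *: q + 'X * (p * q).
  by rewrite -mul_polyC; ring.
rewrite opoly_lin opolyX// IHp.
have -> : p * 'X + c%:P = c *: 1 + 'X * p by rewrite -mul_polyC; ring.
rewrite [RHS]opoly_lin (opolyX p (opoly_dom q Da)); congr (_ *: _ + _).
by rewrite -[1]/(1%:P) opolyC scale1r.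
Qed.

Lemma opoly_sym p a b : D a -> D b -> s (opoly p a) b = s a (opoly p b).
Proof.
move=> Da Db; rewrite /opoly si_suml// ?si_sumr//; last 2 first.
- by move=> i _; apply: si_domZ; exact: iter_dom.
- by move=> i _; apply: si_domZ; exact: iter_dom.
apply: eq_bigr => i _; rewrite siZl ?siZr ?conj_real//; try exact: iter_dom.
congr (_ * _); elim: (i : nat) (a) (b) Da Db => //= n IHn a' b' Da Db.
by rewrite (Tsym (iter_dom n Da) Db) (IHn _ _ Da (TD Db)) -iterSr.
Qed.

Section calculus.
Variable M : R.
Hypotheses (M0 : 0 < M)
  (Tge0 : forall a, D a -> 0 <= complex.Re (s (T a) a))
  (TleM : forall a, D a -> complex.Re (s (T a) a) <= M * sqn a).

(** This takes the place of the spectral theorem. The functional $p \mapsto \mathrm{Re}\langle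
    p(T)a, a\rangle$ is [moment_positive]: a square moves one factor to the other side, leaving the
    form, [Tge0] or [TleM] at the vector $r(T)a$. *)
Lemma opoly_ge0 p a : D a -> (forall t, 0 <= t <= M -> 0 <= p.[t]) ->
  0 <= complex.Re (s (opoly p a) a).
Proof.
move=> Da p0; apply: (@moment_positive_ge0 _ _ M0 (fun p => complex.Re (s (opoly p a) a))) => //.
split=> [q r|r|r|r] /=.
- rewrite -[q]scale1r opoly_lin siDl// ?ReD ?siZl ?Re_ZM ?mul1r ?scale1r//;
  rewrite ?scale1r; exact: opoly_dom.
- have Dr := opoly_dom r Da; rewrite expr2 opolyM// (opoly_sym r Dr Da).
  exact: (sqn_ge0 Dr).
- have Dr := opoly_dom r Da; have DTr := TD Dr.
  rewrite expr2 mulrCA opolyM// opolyX// (opoly_sym r DTr Da).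
  exact: Tge0.
- have Dr := opoly_dom r Da; have DTr := TD Dr.
  have DMr := opoly_dom ((M%:P - 'X) * r) Da.
  rewrite expr2 mulrCA opolyM// (opoly_sym r DMr Da).
  have -> : (M%:P - 'X) * r = M *: r + (-1) *: ('X * r).
    by rewrite -mul_polyC scaleN1r; ring.
  rewrite opoly_lin -[(-1) *: ('X * r)]addr0 opoly_lin opoly0 addr0 opolyX//.
  rewrite siDl ?siZl//; try exact: si_domZ.
  by rewrite ReD !Re_ZM mulN1r subr_ge0; exact: TleM.
Qed.

(** Positivity applied to $e^2 - p^2$, with $\langle p(T)^2 a, a\rangle = |p(T)a|^2$. *)
Lemma opoly_le p (e : R) a : D a ->
  (forall t, 0 <= t <= M -> `|p.[t]| <= e) ->
  sqn (opoly p a) <= e ^+ 2 * sqn a.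
Proof.
move=> Da pe.
have : 0 <= complex.Re (s (opoly ((-1) *: (p * p) + (e ^+ 2)%:P) a) a).
  apply: opoly_ge0 => // t tM; rewrite hornerD hornerZ hornerM hornerC mulN1r addrC.
  rewrite subr_ge0 -expr2.
  rewrite -[p.[t] ^+ 2]real_normK ?num_real//.
  by rewrite ler_pXn2r ?nnegrE ?(le_trans _ (pe t tM)) ?pe.
have Dp := opoly_dom p Da.
have Dpp := opoly_dom p Dp.
rewrite opoly_lin opolyC opolyM// siDl ?siZl// ?ReD ?Re_ZM//; try exact: si_domZ.
by rewrite mulN1r addrC subr_ge0 opoly_sym//.
Qed.

End calculus.

End operator.

End semi_inner.

(** * Rules of calculation in a groupoid *)

Section groupoid_algebra.
Variable G : groupoid.
Implicit Types g h k x : G.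
Local Notation "g ** h" := (gmul g h) (at level 40, left associativity).

Lemma composable_inv_l g h : rg g = rg h -> composable (ginv g) h.
Proof. by rewrite /composable sc_inv. Qed.

Lemma composable_inv_r g h : sc g = sc h -> composable g (ginv h).
Proof. by rewrite /composable rg_inv. Qed.

Lemma gmul_assoc g h k : composable g h -> composable h k ->
  g ** h ** k = g ** (h ** k).
Proof. by move=> gh hk; have [] := gmulA gh hk. Qed.

Lemma rgK g : rg g ** g = g.
Proof.
have c : composable g (ginv g) by exact: composable_inv_r.
by have := gmulVK c; rewrite ginvK.
Qed.

Lemma scK g : g ** sc g = g.
Proof.
have c : composable (ginv g) g by exact: composable_inv_l.
by have := gmulKV c; rewrite ginvK.
Qed.

Lemma rg_rg g : rg (rg g) = rg g.
Proof. by rewrite {2}/rg rg_mul//; exact: composable_inv_r. Qed.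

Lemma sc_rg g : sc (rg g) = rg g.
Proof. by rewrite {1}/rg sc_mul ?sc_inv//; exact: composable_inv_r. Qed.

Lemma sc_unit g : units G (sc g).
Proof. by rewrite -rg_inv; exact: rg_unit. Qed.

Lemma unit_rg x : units G x -> rg x = x.
Proof. by move=> [g ->]; rewrite rg_rg. Qed.

Lemma unit_sc x : units G x -> sc x = x.
Proof. by move=> [g ->]; rewrite sc_rg. Qed.

Lemma unit_inv x : units G x -> ginv x = x.
Proof.
move=> ux; have := rgK (ginv x); rewrite rg_inv (unit_sc ux) => E.
have c : composable x (ginv x) by exact: composable_inv_r.
by rewrite -E -[RHS](unit_rg ux).
Qed.

Lemma gmulKl g h : composable g h -> ginv g ** (g ** h) = h.
Proof. exact: gmulKV. Qed.

Lemma gmulKr g h : composable g h -> g ** h ** ginv h = g.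
Proof. exact: gmulVK. Qed.

Lemma gmulVl g h : rg g = rg h -> g ** (ginv g ** h) = h.
Proof.
by move=> gh; have := gmulKV (composable_inv_l gh); rewrite ginvK.
Qed.

Lemma gmulVr g h : sc h = sc g -> h ** ginv g ** g = h.
Proof.
by move=> gh; have := gmulVK (composable_inv_r gh); rewrite ginvK.
Qed.

Lemma gmulI g h k : composable g h -> composable g k -> g ** h = g ** k -> h = k.
Proof. by move=> gh gk e; rewrite -(gmulKl gh) e gmulKl. Qed.

Lemma gmulIr g h k : composable g k -> composable h k -> g ** k = h ** k -> g = h.
Proof. by move=> gh gk e; rewrite -(gmulKr gh) e gmulKr. Qed.

Lemma ginv_mul g h : composable g h -> ginv (g ** h) = ginv h ** ginv g.
Proof.
move=> gh; have gV : composable (ginv h) (ginv g) by rewrite /composable sc_inv rg_inv.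
have c : composable (g ** h) (ginv h ** ginv g).
  by rewrite /composable sc_mul// rg_mul// rg_inv.
have E : (g ** h) ** (ginv h ** ginv g) = rg g.
  rewrite -gmul_assoc ?gmulKr//.
  by rewrite /composable sc_mul// rg_inv.
have := gmulKl c; rewrite E -(rg_mul gh) => <-.
by rewrite -sc_inv scK.
Qed.

Lemma ginv_rg g : ginv (rg g) = rg g.
Proof. by rewrite unit_inv//; exact: rg_unit. Qed.

Lemma sc_mulV g h : sc g = sc h -> sc (g ** ginv h) = rg h.
Proof. by move=> gh; rewrite sc_mul ?sc_inv//; exact: composable_inv_r. Qed.

Lemma rg_mulV g h : sc g = sc h -> rg (g ** ginv h) = rg g.
Proof. by move=> gh; rewrite rg_mul//; exact: composable_inv_r. Qed.

Lemma sc_Vmul g h : rg g = rg h -> sc (ginv g ** h) = sc h.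
Proof. by move=> gh; rewrite sc_mul//; exact: composable_inv_l. Qed.

Lemma rg_Vmul g h : rg g = rg h -> rg (ginv g ** h) = sc g.
Proof. by move=> gh; rewrite rg_mul ?rg_inv//; exact: composable_inv_l. Qed.

Lemma ginv_mulV g h : sc g = sc h -> ginv (g ** ginv h) = h ** ginv g.
Proof. by move=> gh; rewrite ginv_mul ?ginvK//; exact: composable_inv_r. Qed.

Lemma ginv_Vmul g h : rg g = rg h -> ginv (ginv g ** h) = ginv h ** g.
Proof. by move=> gh; rewrite ginv_mul ?ginvK//; exact: composable_inv_l. Qed.

End groupoid_algebra.

(** * Topology of etale groupoids *)

(** If no finite family covered [K], the points missed by finite families would generate a proper
    filter on [K]. It would cluster at some [p], although one of its sets misses the neighbourhood
    [f p]. *)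
Lemma compact_finite_subcover (T : topologicalType) (K : set T)
    (f : T -> set T) : compact K -> (forall x, K x -> nbhs x (f x)) ->
  exists2 s : seq T, (forall x, x \in s -> K x) &
    forall y, K y -> exists2 x, x \in s & f x y.
Proof.
move=> cK fK; apply: contrapT => nocov.
pose B (s : seq T) : set T := [set y | K y /\ forall x, x \in s -> ~ f x y].
pose I : set (seq T) := [set s : seq T | forall x, x \in s -> K x].
have FF : ProperFilter (filter_from I B).
  apply: filter_from_proper.
    apply: filter_from_filter; first by exists [::].
    move=> s t Is It; exists (s ++ t).
      by move=> x; rewrite mem_cat => /orP[/Is|/It].
    move=> y [Ky st]; split; split=> // x xs; apply: st.
      by rewrite mem_cat xs.
    by rewrite mem_cat xs orbT.
  move=> s Is; apply: contrapT => Bs; apply: nocov; exists s => // y Ky.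
  apply: contrapT => nx; apply: Bs; exists y; split=> // x xs fxy.
  by apply: nx; exists x.
have FK : filter_from I B K by exists [::] => // y [].
have [p [Kp clp]] := cK _ FF FK.
have [y []] : B [:: p] `&` f p !=set0.
  apply: clp (fK p Kp); exists [:: p] => // x.
  by rewrite inE => /eqP ->.
by move=> [_ /(_ p)]; rewrite inE eqxx => /(_ isT).
Qed.

(** A compact set need not be closed in a non-Hausdorff space, but it is relatively closed in a
    separated set [U]: otherwise the neighbourhoods of [p] trace a proper filter on [K], and its
    cluster point in [K] cannot be separated from [p]. *)
Lemma compact_sep_nbhs (T : topologicalType) (U K : set T) p :
  (forall p q, U p -> U q -> cluster (nbhs p) q -> p = q) ->
  compact K -> K `<=` U -> U p -> ~ K p -> nbhs p (~` K).
Proof.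
move=> sepU cK KU Up nKp; apply: contrapT => nn; apply: nKp.
have PF : ProperFilter (within K (nbhs p)).
  split; last exact: within_filter.
  by move=> KN; apply: nn; exact: KN.
have [q [Kq clq]] : (K `&` cluster (within K (nbhs p))) !=set0.
  by apply: cK; apply: filterS (@filterT _ (nbhs p) _) => x.
rewrite (sepU p q)//; first exact: KU.
move=> A B Ap Bq.
by apply: clq Bq; rewrite withinE; exists A => //; apply: filterS Ap => x [].
Qed.

Lemma hausdorff_openP (T : topologicalType) (U : set T) : open U ->
  hausdorff_space (U : topologicalType) <->
  (forall p q, U p -> U q -> cluster (nbhs p) q -> p = q).
Proof.
move=> oU; split=> [hU p q Up Uq clpq|sepU p q clpq].
  pose p' : U := SigSub (mem_set Up); pose q' : U := SigSub (mem_set Uq).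
  suff : p' = q' by move=> /(congr1 val).
  apply: hU => A B; rewrite !nbhsE => -[_ [[A' oA' <-] A'p] sA].
  move=> [_ [[B' oB' <-] B'q] sB].
  have pA : nbhs p (A' `&` U) by apply: filterI; apply: open_nbhs_nbhs; split.
  have qB : nbhs q B' by apply: open_nbhs_nbhs; split.
  have [x [[A'x Ux] B'x]] := clpq _ _ pA qB.
  by exists (SigSub (mem_set Ux) : U); split; [apply: sA|apply: sB].
apply: val_inj; apply: sepU; try by apply: set_mem; exact: valP.
move=> A B Ap Bq.
have [x [Ax Bx]] : (val @^-1` A : set U) `&` val @^-1` B !=set0.
  by apply: clpq; exact: (@initial_continuous U T set_val).
by exists (val x).
Qed.

(** Complete regularity gives [f] vanishing at [x] and equal to 1 off a small [W], but no compact
    support. The truncation $\max(0, 1 - 2f)$ vanishes off $\{f \le 1/2\}$, a closed set that lies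
    in [W] and hence in a compact set. *)
Lemma lch_bump (R : realType) (X : topologicalType) (x : X) (O : set X) :
  locally_compact [set: X] -> hausdorff_space X -> nbhs x O ->
  exists (b : X -> R) (K : set X), [/\ continuous b,
    forall y, 0 <= b y <= 1, b x = 1, compact K /\ K `<=` O &
    forall y, ~ K y -> b y = 0].
Proof.
move=> lcX hX xO.
have [V xV [cV clV]] := lcX x I.
have {}xV : nbhs x V by move: xV; rewrite /within /=; apply: filterS => y; exact.
have [W [[oW Wx] WO]] : exists W, open_nbhs x W /\ W `<=` O `&` V.
  by have : nbhs x (O `&` V) by [apply: filterI]; rewrite nbhsE => -[W ? ?]; exists W.
have clW : closed (~` W) by exact: open_closedC.
have := @locally_compact_completely_regular X R lcX hX x _ clW.
move=> /(_ (fun nW => nW Wx)) us.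
have [f [cf f01 fx fW]] := (@uniform_separatorP X R _ _).1 us.
have {}f01 y : 0 <= f y <= 1.
  by have /f01 /= : range f (f y) by [exists y]; rewrite in_itv.
pose b y : R := Num.max 0 (1 - 2 * f y).
exists b, (f @^-1` [set t | t <= 2^-1]).
have KW : f @^-1` [set t | t <= 2^-1] `<=` W.
  move=> y /= fy; apply: contrapT => nWy.
  have : f y = 1 by apply: fW; exists y.
  by move=> E; move: fy; rewrite E; lra.
split.
- move=> y; apply: (@continuous_max R X) => //; first exact: cst_continuous.
  apply: cvgB; first exact: cvg_cst.
  by apply: cvgM; [exact: cvg_cst|exact: cf].
- move=> y; rewrite /b; case/andP: (f01 y) => f0 f1.
  by rewrite le_max lexx /= ge_max ler01 /=; lra.
- rewrite /b; have -> : f x = 0 by apply: fx; exists x.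
  by rewrite mulr0 subr0 max_r.
- split; last by move=> y /KW/WO[].
  apply: (subclosed_compact _ cV); last by move=> y /KW/WO[].
  by apply: closed_comp; [move=> y _; exact: cf|exact: closed_le].
- move=> y /= /negP; rewrite -ltNge => fy; rewrite /b max_l//; lra.
Qed.

Section etale_topology.
Variable G : groupoid.
Hypothesis GE : lc_etale G.
Implicit Types (g h x y : G) (U W : set G).

Lemma ginv_cvg g : @ginv G @ g --> ginv g.
Proof. by case: GE => _ + _ _ _; exact. Qed.

(** The product is continuous only within the composable pairs, hence the eventual composability
    among the hypotheses. *)
Lemma gmul_cvg (T : Type) (F : set_system T) {FF : Filter F} (a b : T -> G)
    g h : composable g h -> (\forall z \near F, composable (a z) (b z)) ->
  a @ F --> g -> b @ F --> h -> (fun z => gmul (a z) (b z)) @ F --> gmul g h.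
Proof.
move=> gh cab ag bh W Wgh; case: GE => /subspace_continuousP mc _ _ _ _.
have := mc (g, h) gh W Wgh; rewrite /= nbhs_simpl /= => Ngh.
have abW : F [set z | composable (a z) (b z) -> W (gmul (a z) (b z))] :=
  @cvg_pair _ _ _ F (nbhs g) (nbhs h) FF (nbhs_filter g) (nbhs_filter h)
  a b ag bh _ Ngh.
have : F [set z | W (gmul (a z) (b z))].
  by apply: filterS2 cab abW => z cz; exact.
by [].
Qed.

Lemma rg_cvg g : @rg G @ g --> rg g.
Proof.
apply: gmul_cvg; [exact: composable_inv_r| |exact: cvg_id|exact: ginv_cvg].
by apply: nearW => h; exact: composable_inv_r.
Qed.

Lemma sc_cvg g : @sc G @ g --> sc g.
Proof.
apply: gmul_cvg; [exact: composable_inv_l| |exact: ginv_cvg|exact: cvg_id].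
by apply: nearW => h; exact: composable_inv_l.
Qed.

(** The local homeomorphism takes values in the subtype of units; here its content is restated
    inside [G]. Openness of [rg] is still relative to the units, since openness of the unit space is
    itself deduced from this lemma. *)
Lemma rg_locally_open g : exists U, [/\ open U, U g,
  forall a b, U a -> U b -> rg a = rg b -> a = b &
  forall h W, U h -> nbhs h W -> exists2 N, nbhs (rg h) N &
    forall x, N x -> units G x -> exists2 k, W k & rg k = x].
Proof.
case: GE => _ _ _ _ /(_ g)[U [oU Ug oI _ [k [ck kK]]]]; exists U; split=> //.
  move=> a b Ua Ub ab; rewrite -(kK a Ua) -(kK b Ub); congr k.
  exact: val_inj.
move=> h W Uh hW; pose y := range_map h.
have : nbhs y [set z | W (k z) /\ (@range_map G @` U) z].
  have Iy : (@range_map G @` U) y by exists h.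
  have oIy : nbhs y (@range_map G @` U) by apply: open_nbhs_nbhs; split.
  have kyW : nbhs (k y) W by rewrite kK.
  have /subspace_continuousP/(_ y Iy W kyW) := ck.
  rewrite /= nbhs_simpl /= => kW.
  by apply: filterS2 oIy kW => z Iz kWz; split=> //; exact: (kWz Iz).
move=> yW; have [_ [[N oN <-] Ny] sN] : exists2 B : set (units G),
  open_nbhs y B & B `<=` [set z | W (k z) /\ (@range_map G @` U) z].
  by have := yW; rewrite nbhsE.
exists N; first by apply: open_nbhs_nbhs.
move=> x Nx ux; have [Wk [a Ua aE]] := sN (SigSub (mem_set ux) : units G) Nx.
exists a; first by rewrite -(kK a Ua) aE.
by have := congr1 val aE.
Unshelve. all: by end_near. Qed.

(** Near a unit [x], both [g] and [rg g] lie in a set on which [rg] is injective, and they have the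
    same range; so [g = rg g]. *)
Lemma units_open : open (units G).
Proof.
rewrite openE => x ux; have [U [oU Ux Uinj _]] := rg_locally_open x.
rewrite /interior /=; near=> g; exists g; apply: Uinj.
- by near: g; exact: open_nbhs_nbhs.
- near: g; have := @rg_cvg x; rewrite (unit_rg ux) => /(_ U); apply.
  exact: open_nbhs_nbhs.
by rewrite rg_rg.
Unshelve. all: by end_near. Qed.

Lemma rg_image_nbhs g W : nbhs g W -> nbhs (rg g) (@rg G @` W).
Proof.
move=> gW; have [U [oU Ug _ Uo]] := rg_locally_open g.
have [N gN sN] := Uo g W Ug gW.
near=> x; have [|//|k Wk <-] := sN x; [by near: x| |by exists k].
by near: x; apply: open_nbhs_nbhs; split; [exact: units_open|exact: rg_unit].
Unshelve. all: by end_near. Qed.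

Lemma units_sep x y : units G x -> units G y -> cluster (nbhs x) y -> x = y.
Proof.
by case: GE => _ _ /(hausdorff_openP units_open).1 + _ _; apply.
Qed.

Lemma sep_injective U (T : topologicalType) (f : G -> T) (V : set T) :
  (forall p q, V p -> V q -> cluster (nbhs p) q -> p = q) ->
  (forall p, U p -> V (f p) /\ f @ p --> f p) ->
  (forall p q, U p -> U q -> f p = f q -> p = q) ->
  forall p q, U p -> U q -> cluster (nbhs p) q -> p = q.
Proof.
move=> sepV fU finj p q Up Uq clpq; apply: finj => //.
have [Vp fp] := fU p Up; have [Vq fq] := fU q Uq.
apply: sepV => // A B /fp Ap /fq Bq.
have [z [Az Bz]] := clpq _ _ Ap Bq.
by exists (f z).
Qed.

Definition bisection U : Prop := [/\ open U,
  forall a b, U a -> U b -> rg a = rg b -> a = b &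
  forall a b, U a -> U b -> sc a = sc b -> a = b].

(** On a bisection [rg] is continuous and injective into the Hausdorff unit space; bisections are
    thus Hausdorff although [G] may fail to be. *)
Lemma bisection_sep U : bisection U ->
  forall p q, U p -> U q -> cluster (nbhs p) q -> p = q.
Proof.
move=> [_ ir _]; apply: (sep_injective (V := units G)) ir.
  exact: units_sep.
by move=> p _; split; [exact: rg_unit|exact: rg_cvg].
Qed.

Lemma ginv_open U : open U -> open (@ginv G @^-1` U).
Proof. by apply: open_comp => g _; exact: ginv_cvg. Qed.

Lemma bisection_inv U : bisection U -> bisection (@ginv G @^-1` U).
Proof.
move=> [oU ir isc]; split; first exact: ginv_open.
- by move=> a b Ua Ub ab; rewrite -[a]ginvK -[b]ginvK; congr ginv; apply: isc; rewrite ?sc_inv.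
- by move=> a b Ua Ub ab; rewrite -[a]ginvK -[b]ginvK; congr ginv; apply: ir; rewrite ?rg_inv.
Qed.

Lemma bisection_nbhs g W : nbhs g W ->
  exists U, [/\ bisection U, U g & U `<=` W].
Proof.
rewrite nbhsE => -[W' [oW' W'g] sW].
have [U [oU Ug ir _]] := rg_locally_open g.
have [V [oV Vg ir' _]] := rg_locally_open (ginv g).
exists (W' `&` U `&` (@ginv G @^-1` V)); split.
- split; first by apply: openI; [exact: openI|exact: ginv_open].
  + by move=> a b [[_ Ua] _] [[_ Ub] _]; exact: ir.
  + move=> a b [_ Va] [_ Vb] ab; rewrite -[a]ginvK -[b]ginvK; congr ginv.
    by apply: ir'; rewrite ?rg_inv.
- by [].
- by move=> a [[/sW]].
Qed.

(** The local section of [rg] with values in [U]; off the range of [U] it takes the junk value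
    [x]. *)
Definition rsec U x : G := xget x [set u | U u /\ rg u = x].

Lemma rsecE U u : bisection U -> U u -> rsec U (rg u) = u.
Proof.
move=> [_ ir _] Uu; apply: xget_subset1 => // a b [Ua ra] [Ub rb].
by apply: ir => //; rewrite ra rb.
Qed.

Lemma rsec_near U u W : bisection U -> U u -> nbhs u W ->
  \forall x \near rg u, [/\ W (rsec U x), U (rsec U x) & rg (rsec U x) = x].
Proof.
move=> bU Uu uW; have [oU _ _] := bU.
have : nbhs u (W `&` U) by apply: filterI => //; exact: open_nbhs_nbhs.
by move=> /rg_image_nbhs; apply: filterS => x [v [Wv Uv] <-]; rewrite rsecE.
Qed.

Lemma rsec_cvg U u : bisection U -> U u -> rsec U @ rg u --> u.
Proof. by move=> bU Uu W /(rsec_near bU Uu); apply: filterS => x []. Qed.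

End etale_topology.

Lemma rnormR (R : realType) (x : R) : rnorm (x%:C%C : R[i]) = `|x|.
Proof. by rewrite /rnorm normc_def /= expr0n /= addr0 sqrtr_sqr. Qed.

(** * Continuous functions with compact support *)

Section complex_cvg.
Variables (R : realType) (T : Type) (F : set_system T).
Context {FF : Filter F}.
Implicit Types (f : T -> R[i]) (l : R[i]) (r : T -> R).

Lemma cvgC_distP f l :
  ((f : T -> R[i]^o) @ F --> (l : R[i]^o)) <->
  (forall e : R, 0 < e -> \forall z \near F, rnorm (l - f z) < e).
Proof.
split=> [fl e e0|fl].
  have e0C : (0 : R[i]) < e%:C%C by rewrite ltcR.
  have /cvgrPdist_lt/(_ _ e0C) := fl; apply: filterS => z.
  by rewrite /rnorm; case: `|_| => a b /=; rewrite ltcE /= => /andP[].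
apply/cvgrPdist_lt => e e0; have /fl : 0 < complex.Re e.
  by move: e0; case: (e) => a b; rewrite ltcE /= => /andP[].
apply: filterS => z; rewrite /rnorm => lt1.
rewrite ltcE lt1 andbT; have := ger0_Im (ltW e0) => ->.
by have := ger0_Im (normr_ge0 (l - f z)) => ->.
Qed.

Lemma real_complex_cvg r (a : R) : r @ F --> a ->
  ((fun z => (r z)%:C%C : R[i]^o) @ F --> (a%:C%C : R[i]^o)).
Proof.
move=> ra; apply/cvgC_distP => e e0; have /cvgrPdist_lt/(_ _ e0) := ra.
by apply: filterS => z; rewrite -rmorphB rnormR.
Qed.

Lemma rnorm_cvg f l : ((f : T -> R[i]^o) @ F --> (l : R[i]^o)) ->
  (fun z => rnorm (f z)) @ F --> rnorm l.
Proof.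
move=> /cvgC_distP fl; apply/cvgrPdist_lt => e /fl; apply: filterS => z.
apply: le_lt_trans; rewrite /rnorm -raddfB /=.
rewrite -lecR; apply: le_trans (_ : `|(`|l| - `|f z|)| <= _).
  apply: le_trans (normc_ge_Re _).
  by [].
apply: le_trans (ler_dist_dist _ _) _.
by rewrite [leLHS](_ : _ = (complex.Re `|l - f z|)%:C%C)// ReK_ge0.
Qed.

Lemma conj_cvg f l : ((f : T -> R[i]^o) @ F --> (l : R[i]^o)) ->
  ((fun z => Num.conj (f z) : R[i]^o) @ F --> (Num.conj l : R[i]^o)).
Proof.
move=> /cvgC_distP fl; apply/cvgC_distP => e /fl; apply: filterS => z.
by rewrite -rmorphB /= /rnorm norm_conjC.
Qed.

End complex_cvg.

Section Cc_functions.
Variables (R : realType) (G : groupoid).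
Hypothesis GE : lc_etale G.
Implicit Types (g h p x : G) (U V W K : set G) (f : G -> R[i]).

Definition cont_at f p : Prop := (f : G -> R[i]^o) @ p --> (f p : R[i]^o).
Definition sep U : Prop := forall p q, U p -> U q -> cluster (nbhs p) q -> p = q.

Lemma cont_at_near f f' p : (\forall h \near p, f h = f' h) -> cont_at f' p ->
  cont_at f p.
Proof.
move=> e cf'; rewrite /cont_at (nbhs_singleton e); apply: cvg_trans cf'.
by apply: near_eq_cvg; apply: filterS e => h ->.
Qed.

Lemma Cc_onP U f : open U -> Cc_on U f <->
  (forall p, U p -> cont_at f p) /\
  exists K, [/\ compact K, K `<=` U & forall g, ~ K g -> f g = 0].
Proof.
move=> oU; rewrite /Cc_on /= continuous_open_subspace//.
split=> -[cf KK]; split=> // p; first by move=> Up; apply: cf; rewrite inE.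
by rewrite inE; exact: cf.
Qed.

Lemma Cc_on_out U f g : Cc_on U f -> ~ U g -> f g = 0.
Proof. by move=> [_ [K [_ KU K0]]] nUg; apply: K0 => /KU. Qed.

Lemma Cc_on_near0 U f p : sep U -> Cc_on U f -> U p -> forall K,
  compact K -> K `<=` U -> (forall g, ~ K g -> f g = 0) -> ~ K p ->
  \forall h \near p, f h = 0.
Proof.
move=> sepU _ Up K cK KU K0 nKp.
by apply: filterS (compact_sep_nbhs sepU cK KU Up nKp) => h; exact: K0.
Qed.

(** At a point of [V] outside [U], the extension by zero vanishes nearby because the compact support
    is relatively closed in the separated set [V]. Without separation of [V] it could be
    discontinuous there. *)
Lemma Cc_onW U V f : open U -> open V -> sep V -> U `<=` V -> Cc_on U f ->
  Cc_on V f.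
Proof.
move=> oU oV sepV UV /(Cc_onP _ oU)[cf [K [cK KU K0]]]; apply/(Cc_onP _ oV).
have KV : K `<=` V by exact: subset_trans KU UV.
split; last by exists K.
move=> p Vp; have [Up|nUp] := pselect (U p); first exact: cf.
have nKp : ~ K p by move=> /KU.
apply: (@cont_at_near _ (fun=> 0)); last exact: cvg_cst.
by apply: filterS (compact_sep_nbhs sepV cK KV Vp nKp) => h; exact: K0.
Qed.

Lemma Cc_on_mul U f f' : open U -> Cc_on U f -> (forall p, U p -> cont_at f' p) ->
  Cc_on U (fun h => f h * f' h).
Proof.
move=> oU /(Cc_onP _ oU)[cf [K [cK KU K0]]] cf'; apply/(Cc_onP _ oU).
split; last by exists K; split=> // g /K0 ->; rewrite mul0r.
by move=> p Up; apply: cvgM; [exact: cf|exact: cf'].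
Qed.

Lemma Cc_of_on U f : open U -> sep U -> Cc_on U f -> Cc f.
Proof.
move=> oU sepU fU; exists 1%N, (fun=> 1), (fun=> f); split.
  by move=> _; exists U; split=> //; apply/(hausdorff_openP oU).
by rewrite big_ord1 scale1r.
Qed.

Lemma Cc_bisection U f : bisection U -> Cc_on U f -> Cc f.
Proof.
by move=> bU; have [oU _ _] := bU; apply: Cc_of_on => //; exact: bisection_sep.
Qed.

Lemma Cc0 : Cc (0 : G -> R[i]).
Proof. by exists 0%N, (fun=> 0), (fun=> 0); split=> [[]//|]; rewrite big_ord0. Qed.

Lemma Cc_lin c f f' : Cc f -> Cc f' -> Cc (c *: f + f').
Proof.
move=> [n [a [F [HF ->]]]] [n' [a' [F' [HF' ->]]]].
exists (n + n')%N,
  (fun k => match fintype.split k with inl i => c * a i | inr j => a' j end),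
  (fun k => match fintype.split k with inl i => F i | inr j => F' j end); split.
  by move=> k; case: fintype.split.
rewrite big_split_ord /=; congr (_ + _).
  rewrite scaler_sumr; apply: eq_bigr => i _.
  by rewrite (unsplitK (inl i : 'I_n + 'I_n')) scalerA.
by apply: eq_bigr => i _; rewrite (unsplitK (inr i : 'I_n + 'I_n')).
Qed.

Lemma Cc_add f f' : Cc f -> Cc f' -> Cc (f + f').
Proof. by move=> Cf Cf'; rewrite -[f]scale1r; exact: Cc_lin. Qed.

Lemma Cc_scale c f : Cc f -> Cc (c *: f).
Proof. by move=> Cf; rewrite -[_ *: _]addr0; apply: Cc_lin => //; exact: Cc0. Qed.

Lemma Cc_sum (I : Type) (r : seq I) (P : pred I) (F : I -> G -> R[i]) :
  (forall i, P i -> Cc (F i)) -> Cc (\sum_(i <- r | P i) F i).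
Proof. by move=> CF; elim/big_ind: _ => //; [exact: Cc0|exact: Cc_add]. Qed.

(** The bump is taken on the locally compact Hausdorff unit space and pulled back along [rg] to a
    bisection; [rsec U] carries the compact support back. *)
Lemma bump_exists g W : nbhs g W -> exists U (b : G -> R[i]),
  [/\ bisection U, U g, U `<=` W, Cc_on U b & b g = 1 /\ forall h, 0 <= b h].
Proof.
move=> gW; have [U [bU Ug UW]] := bisection_nbhs GE gW.
have [oU _ _] := bU.
have rU : nbhs (rg g) (@rg G @` U).
  by apply: rg_image_nbhs => //; exact: open_nbhs_nbhs.
pose X : topologicalType := units G; pose x : X := range_map g.
have xO : nbhs x (val @^-1` (@rg G @` U)).
  exact: (@initial_continuous X G set_val x).
have [_ _ hX lX _] := GE.
have [b [K [cb b01 bx [cK KO] K0]]] := lch_bump R lX hX xO.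
have cr p : (@range_map G : G -> X) @ p --> (range_map p : X).
  move=> N; rewrite nbhsE => -[_ [[A oA <-] Ap] sA].
  have pA : nbhs (rg p) A by exact: open_nbhs_nbhs.
  have pA' : nbhs p (@rg G @^-1` A) := rg_cvg GE pA.
  have : nbhs p [set h | N (range_map h)].
    by apply: filterS pA' => h Ah; exact: sA.
  exact.
pose f h : R[i] := if pselect (U h) then (b (range_map h))%:C%C else 0.
exists U, f; split=> //; last first.
  split; first by rewrite /f; case: pselect => //= ?; rewrite (_ : range_map g = x)// bx.
  move=> h; rewrite /f; case: pselect => //= ?; rewrite lecR.
  by case/andP: (b01 (range_map h)).
apply/(Cc_onP _ oU); split.
  move=> p Up; apply: (@cont_at_near _ (fun h => (b (range_map h))%:C%C)).
    have : nbhs p U by exact: open_nbhs_nbhs.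
    by apply: filterS => h Uh; rewrite /f; case: pselect.
  apply: real_complex_cvg; apply: cvg_comp; first exact: cr.
  exact: cb.
exists ((rsec U \o val) @` K); split.
- apply: continuous_compact cK; apply/subspace_continuousP => y Ky.
  apply: cvg_trans (_ : (rsec U \o val) @ y --> _).
    by apply: cvg_app; exact: cvg_within.
  have [u Uu uy] := KO y Ky.
  have -> : from_subspace K (rsec U \o val) y = u by rewrite /from_subspace /= -uy rsecE.
  apply: cvg_comp; first exact: (@initial_continuous X G set_val).
  by rewrite (_ : set_val y = val y)// -uy; exact: rsec_cvg.
- by move=> _ [y /KO [u Uu uy] <-] /=; rewrite -uy rsecE.
- move=> h nKh; rewrite /f; case: pselect => // Uh.
  rewrite K0// => Kh; apply: nKh; exists (range_map h) => //=.
  exact: rsecE.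
Qed.

(** A partition of unity: finitely many nonnegative bumps have a sum [Psi] without zeros on the
    support set [K], and [f] is multiplied by the quotients of the bumps by [Psi]. *)
Lemma Cc_on_decomp U f : open U -> sep U -> Cc_on U f ->
  exists (s : seq G) (F : G -> G -> R[i]),
    (forall x, x \in s -> exists2 V, bisection V & Cc_on V (F x)) /\
    f = \sum_(x <- s) F x.
Proof.
move=> oU sepU fU; have [cf [K [cK KU K0]]] := (Cc_onP _ oU).1 fU.
have /choice[B HB] : forall p, exists Vb : set G * (G -> R[i]), U p ->
    [/\ bisection Vb.1, Vb.1 p, Vb.1 `<=` U, Cc_on Vb.1 Vb.2 &
      Vb.2 p = 1 /\ forall h, 0 <= Vb.2 h].
  move=> p; have [Up|nUp] := pselect (U p); last by exists (set0, 0).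
  have pU : nbhs p U by exact: open_nbhs_nbhs.
  by have [V [b ?]] := bump_exists pU; exists (V, b).
have [||s sK sP] := @compact_finite_subcover G K (fun p => [set h | (B p).2 h != 0]).
- exact: cK.
- move=> p /KU Up; have [bV Vp VU bb [b1 b0]] := HB p Up.
  have [oV _ _] := bV; have [cb _] := (Cc_onP _ oV).1 bb.
  have /cvgC_distP/(_ 1 ltr01) := cb p Vp.
  apply: filterS => h; apply: contraTneq => ->.
  by rewrite subr0 b1 /rnorm normr1 /= ltxx.
pose Psi h := \sum_(x <- s) (B x).2 h.
have Psi0 h : K h -> Psi h != 0.
  move=> /sP[x xs bx]; have sub1 y : y \in s -> 0 <= (B y).2 h.
    by move=> /sK/KU/HB[_ _ _ _ []].
  rewrite /Psi; apply: lt0r_neq0; rewrite (big_rem x)//=.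
  apply: ltr_wpDr; last by rewrite lt_neqAle eq_sym bx sub1.
  by rewrite big_seq sumr_ge0// => y /mem_rem/sub1.
have cPsi p : U p -> cont_at Psi p.
  move=> Up; rewrite /Psi.
  have : forall x, x \in s -> cont_at (B x).2 p.
    move=> x /sK/KU/HB[bV _ VU bb _]; have [oV _ _] := bV.
    exact: ((Cc_onP _ oU).1 (Cc_onW oV oU sepU VU bb)).1.
  elim: (s) => [_|x r IHr Hs].
    rewrite (_ : (fun h => _) = fun=> 0); first exact: cvg_cst.
    by apply/funext => h; rewrite big_nil.
  rewrite (_ : (fun h => _) = fun h => (B x).2 h + \sum_(y <- r) (B y).2 h).
    apply: cvgD; first by apply: Hs; rewrite inE eqxx.
    by apply: IHr => y yr; apply: Hs; rewrite inE yr orbT.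
  by apply/funext => h; rewrite big_cons.
exists s, (fun x h => f h * ((B x).2 h / Psi h)); split; last first.
  apply/funext => h; rewrite fct_sumE -mulr_sumr -mulr_suml.
  have [/Psi0 Ph|/K0 ->] := pselect (K h); last by rewrite mul0r.
  by rewrite divff// mulr1.
move=> x /sK/KU/HB[bV _ VU bb _]; exists (B x).1 => //; have [oV _ _] := bV.
apply/(Cc_onP _ oV); split; last first.
  have [_ [K' [cK' KV K0']]] := (Cc_onP _ oV).1 bb.
  by exists K'; split=> // g /K0' ->; rewrite mul0r mulr0.
(* Off [K] the denominator [Psi] may vanish, but there [f] is zero in a whole neighbourhood. *)
move=> p Vp; have Up := VU p Vp; have [Kp|nKp] := pselect (K p).
  apply: cvgM; first exact: cf.
  apply: cvgM; first exact: ((Cc_onP _ oV).1 bb).1.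
  by apply: cvgV; [exact: Psi0|exact: cPsi].
apply: (@cont_at_near _ (fun=> 0)); last exact: cvg_cst.
by apply: filterS (Cc_on_near0 sepU fU Up cK KU K0 nKp) => h ->; rewrite mul0r.
Qed.

(** Reduces statements on $C_c(G)$ to functions living on one bisection, for which convolution sums
    have at most one nonzero term. *)
Lemma Cc_ind (P : (G -> R[i]) -> Prop) : P 0 ->
  (forall c f f', Cc f -> Cc f' -> P f -> P f' -> P (c *: f + f')) ->
  (forall U f, bisection U -> Cc_on U f -> P f) -> forall f, Cc f -> P f.
Proof.
move=> P0 Plin Pbis f [n [c [F [HF ->]]]].
have key (I : eqType) (r : seq I) (a : I -> R[i]) (H : I -> G -> R[i]) :
    (forall i, i \in r -> Cc (H i) /\ P (H i)) ->
    Cc (\sum_(i <- r) a i *: H i) /\ P (\sum_(i <- r) a i *: H i).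
  elim: r => [|i r IHr] HH; first by rewrite big_nil; split=> //; exact: Cc0.
  have [CH PH] := HH i (mem_head _ _).
  have [|Cr Pr] := IHr; first by move=> j jr; apply: HH; rewrite inE jr orbT.
  by rewrite big_cons; split; [exact: Cc_lin|exact: Plin].
apply: (key _ _ c F _).2 => k _; have [U [oU hU fU]] := HF k.
have sepU : sep U by apply/(hausdorff_openP oU).
split; first exact: Cc_of_on fU.
have [s [H [HH ->]]] := Cc_on_decomp oU sepU fU.
have -> : \sum_(x <- s) H x = \sum_(x <- s) 1 *: H x.
  by apply: eq_bigr => x _; rewrite scale1r.
apply: (key _ _ (fun=> 1) H _).2 => x /HH[V bV HV].
by split; [exact: Cc_bisection HV|exact: Pbis HV].
Qed.

End Cc_functions.

(** * Convolution and its action on vector-valued functions *)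

Section fiberwise_finite.
Variables (R : realType) (G : groupoid).
Implicit Types (f : G -> R[i]) (g h k x : G).

Definition supp_r f x : set G := [set g | rg g = x /\ f g != 0].
Definition supp_s f x : set G := [set g | sc g = x /\ f g != 0].
(** A sum indexed by [\in] defaults to [0] when its support is infinite; this condition keeps the
    default value out of the identities below. *)
Definition fiber_finite f : Prop :=
  forall x, finite_set (supp_r f x) /\ finite_set (supp_s f x).

Section gind.
Variable V : lmodType R[i].
Implicit Types xi : G -> V.

(** One formula for three objects: the convolution product when [V] is [R[i]^o], the regular
    representations, and the induced representations. *)
Definition gind f xi : G -> V :=
  fun g => \sum_(h \in fiber_r (rg g)) f h *: xi (gmul (ginv h) g).

Lemma gind_widen f xi g (S : set G) : supp_r f (rg g) `<=` S ->
  S `<=` fiber_r (rg g) ->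
  gind f xi g = \sum_(h \in S) f h *: xi (gmul (ginv h) g).
Proof.
move=> fS Sg; apply/esym/fsbig_widen => // h [/= hg nSh].
have [->|fh] := eqVneq (f h) 0; first by rewrite scale0r.
by case: nSh; apply: fS.
Qed.

Lemma gind_linf c f f' xi : fiber_finite f -> fiber_finite f' ->
  gind (c *: f + f') xi = c *: gind f xi + gind f' xi.
Proof.
move=> Ff Ff'; apply/funext => g.
pose S := supp_r f (rg g) `|` supp_r f' (rg g).
have fS : finite_set S by rewrite finite_setU; split; [case: (Ff (rg g))|case: (Ff' (rg g))].
have Sg : S `<=` fiber_r (rg g) by move=> h [[]|[]].
rewrite -[RHS]/(c *: gind f xi g + gind f' xi g) !(@gind_widen _ _ _ S)//; last first.
- move=> h [rh]; rewrite -[(_ + _) h]/(c * f h + f' h) => nz.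
  have [fh|fh] := eqVneq (f h) 0; last by left.
  by right; split=> //; move: nz; rewrite fh mulr0 add0r.
- exact: subsetUl.
- exact: subsetUr.
rewrite !fsbig_finite// scaler_sumr -big_split; apply: eq_bigr => h _ /=.
by rewrite -[(_ + _) h]/(c * f h + f' h) scalerDl scalerA.
Qed.

Lemma gind_lin f c xi eta : fiber_finite f ->
  gind f (c *: xi + eta) = c *: gind f xi + gind f eta.
Proof.
move=> Ff; apply/funext => g; rewrite -[RHS]/(c *: gind f xi g + gind f eta g).
rewrite !(@gind_widen _ _ _ (supp_r f (rg g)))//; try by move=> h [].
rewrite !fsbig_finite//; try by case: (Ff (rg g)).
rewrite scaler_sumr -big_split; apply: eq_bigr => h _ /=.
rewrite -[(_ + _) (gmul _ _)]/(c *: xi _ + eta _).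
by rewrite scalerDr !scalerA mulrC.
Qed.

(** In the given fibre the support of the convolution lies in the finite set [B] of products of
    supports, so the two sums can be exchanged; then $h = kl$ reindexes the inner one. For [V] equal
    to [R[i]^o] this is associativity of convolution. *)
Lemma gind_mul f f' xi : fiber_finite f -> fiber_finite f' ->
  gind (convol f f') xi = gind f (gind f' xi).
Proof.
move=> Ff Ff'; apply/funext => g.
pose A := supp_r f (rg g).
have fA : finite_set A by case: (Ff (rg g)).
have Ag : A `<=` fiber_r (rg g) by move=> h [].
pose B := \bigcup_(k in A) (gmul k @` supp_r f' (sc k)).
have fB : finite_set B.
  apply: bigcup_finite => // k Ak; apply: finite_image.
  by case: (Ff' (sc k)).
have Bg : B `<=` fiber_r (rg g).
  move=> _ [k [kg fk] [l [lk fl] <-]]; by rewrite /fiber_r /= rg_mul.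
have cE h : fiber_r (rg g) h ->
    convol f f' h = \sum_(k \in A) f k * f' (gmul (ginv k) h).
  move=> hg; rewrite /convol hg; apply/esym/fsbig_widen => // k [/= kg nA].
  have [->|fk] := eqVneq (f k) 0; first by rewrite mul0r.
  by case: nA.
rewrite (@gind_widen _ _ _ B)//; last first.
  move=> h [hg]; rewrite cE// => /eqP cn0; apply: contrapT => nB; apply: cn0.
  apply: fsbig1 => k [kg fk]; apply/eqP; rewrite mulf_eq0 (negbTE fk) /=.
  apply/negPn/negP => nz; apply: nB; exists k => //.
  have kh : rg k = rg h by rewrite kg hg.
  by exists (gmul (ginv k) h); [split=> //; rewrite rg_Vmul|rewrite gmulVl].
rewrite (@gind_widen _ _ _ A)//.
transitivity (\sum_(h \in B) \sum_(k \in A)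
    (f k * f' (gmul (ginv k) h)) *: xi (gmul (ginv h) g)).
  apply: eq_fsbigr => h; rewrite inE => /Bg hg.
  by rewrite cE// !fsbig_finite// scaler_suml.
rewrite exchange_fsbig//; apply: eq_fsbigr => k; rewrite inE => -[kg fk].
transitivity (f k *: \sum_(h \in B) f' (gmul (ginv k) h) *: xi (gmul (ginv h) g)).
  rewrite !fsbig_finite// scaler_sumr; apply: eq_bigr => h _.
  by rewrite scalerA.
congr (_ *: _); rewrite (fsbig_widen _ (fiber_r (rg g)))//; last first.
  move=> h [hg nB] /=; have [->|nz] := eqVneq (f' (gmul (ginv k) h)) 0.
    by rewrite scale0r.
  case: nB; exists k => //; have kh : rg k = rg h by rewrite kg hg.
  by exists (gmul (ginv k) h); [split=> //; rewrite rg_Vmul|rewrite gmulVl].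
have kg' : rg (gmul (ginv k) g) = sc k by rewrite rg_Vmul.
rewrite /gind kg'.
rewrite (reindex_fsbig (gmul k) (fiber_r (sc k)) (fiber_r (rg g))); last first.
  split.
  - by move=> l lk; rewrite /fiber_r /= rg_mul.
  - move=> l m; rewrite !inE => lk mk; apply: gmulI => //.
  - move=> h hg; have kh : rg k = rg h by rewrite kg hg.
    exists (gmul (ginv k) h); last by rewrite gmulVl.
    by rewrite /fiber_r /= rg_Vmul.
apply: eq_fsbigr => l; rewrite inE => lk.
have kl : composable k l by [].
rewrite gmulKl// ginv_mul// gmul_assoc//.
  by rewrite /composable sc_inv rg_inv.
exact: composable_inv_l.
Qed.

Lemma gind_single f xi g u : fiber_r (rg g) u ->
  (forall h, rg h = rg g -> h <> u -> f h = 0) ->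
  gind f xi g = f u *: xi (gmul (ginv u) g).
Proof.
move=> ug f0; rewrite (@gind_widen _ _ _ [set u]) ?fsbig_set1//.
  move=> h [hg] /eqP fh; apply: contrapT => hu; apply: fh; exact: f0.
by move=> _ ->.
Qed.

Lemma gind_none f xi g : (forall h, rg h = rg g -> f h = 0) -> gind f xi g = 0.
Proof. by move=> f0; apply: fsbig1 => h /f0 ->; rewrite scale0r. Qed.

End gind.

Lemma convolE f f' : convol f f' = gind f (f' : G -> R[i]^o).
Proof. by []. Qed.

End fiberwise_finite.

(** * The *-algebra of compactly supported functions *)

Section Cc_algebra.
Variables (R : realType) (G : groupoid).
Hypothesis GE : lc_etale G.
Implicit Types (f : G -> R[i]) (g h x : G) (U : set G).

Lemma supp_bisection U f : bisection U -> Cc_on U f -> fiber_finite f.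
Proof.
move=> [_ ir is_] fU x; split.
- have [[u [ux fu]]|nu] := pselect (exists u, supp_r f x u); last first.
    by rewrite (_ : supp_r f x = set0)// -subset0 => u xu; apply: nu; exists u.
  apply: sub_finite_set (finite_set1 u) => h [hx fh] /=; apply: ir.
  + by apply: contrapT => /(Cc_on_out fU)/eqP; rewrite (negbTE fh).
  + by apply: contrapT => /(Cc_on_out fU)/eqP; rewrite (negbTE fu).
  + by rewrite hx.
- have [[u [ux fu]]|nu] := pselect (exists u, supp_s f x u); last first.
    by rewrite (_ : supp_s f x = set0)// -subset0 => u xu; apply: nu; exists u.
  apply: sub_finite_set (finite_set1 u) => h [hx fh] /=; apply: is_.
  + by apply: contrapT => /(Cc_on_out fU)/eqP; rewrite (negbTE fh).
  + by apply: contrapT => /(Cc_on_out fU)/eqP; rewrite (negbTE fu).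
  + by rewrite hx.
Qed.

Lemma Cc_fiber_finite f : Cc f -> fiber_finite f.
Proof.
move: f; apply: (Cc_ind GE); last exact: supp_bisection.
  by move=> x; split; apply: sub_finite_set (finite_set0 _) => g [_]; rewrite eqxx.
move=> c f f' _ _ Ff Ff' x; split.
- apply: (@sub_finite_set _ _ (supp_r f x `|` supp_r f' x)).
    move=> g [gx]; rewrite -[(_ + _) g]/(c * f g + f' g) => nz.
    have [fg|fg] := eqVneq (f g) 0; last by left.
    by right; split=> //; move: nz; rewrite fg mulr0 add0r.
  by rewrite finite_setU; split; [case: (Ff x)|case: (Ff' x)].
- apply: (@sub_finite_set _ _ (supp_s f x `|` supp_s f' x)).
    move=> g [gx]; rewrite -[(_ + _) g]/(c * f g + f' g) => nz.
    have [fg|fg] := eqVneq (f g) 0; last by left.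
    by right; split=> //; move: nz; rewrite fg mulr0 add0r.
  by rewrite finite_setU; split; [case: (Ff x)|case: (Ff' x)].
Qed.

Lemma invol_lin c f f' : invol (c *: f + f') = Num.conj c *: invol f + invol f'.
Proof. by apply/funext => g; rewrite /invol /= rmorphD rmorphM. Qed.

Lemma involK f : invol (invol f) = f.
Proof. by apply/funext => g; rewrite /invol ginvK conjCK. Qed.

Lemma invol_Cc_on U f : open U -> Cc_on U f -> Cc_on (@ginv G @^-1` U) (invol f).
Proof.
move=> oU /(Cc_onP _ oU)[cf [K [cK KU K0]]].
apply/(Cc_onP _ (ginv_open GE oU)); split.
  move=> p Up; apply: conj_cvg.
  apply: (@cvg_comp _ _ _ (@ginv G) (f : G -> R[i]^o)); last exact: (cf _ Up).
  exact: ginv_cvg.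
exists (@ginv G @` K); split.
- apply: continuous_compact cK; apply: continuous_subspaceT => p.
  exact: ginv_cvg.
- by move=> _ [g Kg <-]; rewrite /= ginvK; exact: KU.
- move=> g nK; rewrite /invol K0 ?rmorph0// => Kg; apply: nK.
  by exists (ginv g) => //; rewrite ginvK.
Qed.

Lemma invol_Cc f : Cc f -> Cc (invol f).
Proof.
move: f; apply: (Cc_ind GE).
- rewrite (_ : invol 0 = 0); first exact: Cc0.
  by apply/funext => g; rewrite /invol rmorph0.
- by move=> c f f' _ _ Cf Cf'; rewrite invol_lin; exact: Cc_lin.
- move=> U f bU fU; have [oU _ _] := bU.
  by apply: (Cc_bisection GE (bisection_inv GE bU)); exact: invol_Cc_on.
Qed.

(** This is the preimage of the diagonal of the Hausdorff unit space under source and range. It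
    keeps the composable part of a product of two compact sets compact. *)
Lemma composable_closed : closed [set p : G * G | composable p.1 p.2].
Proof.
move=> [g h] clgh; apply: (units_sep GE); [exact: sc_unit|exact: rg_unit|].
move=> A B /(sc_cvg GE) sA /(rg_cvg GE) rB.
have : nbhs (g, h) [set p : G * G | A (sc p.1) /\ B (rg p.2)].
  by exists (@sc G @^-1` A, @rg G @^-1` B) => //= -[a b] [].
move=> /clgh[[a b] /= [ab [Aa Bb]]].
by exists (sc a); split=> //; rewrite ab.
Qed.

Definition set_gmul (U1 U2 : set G) : set G :=
  [set g | exists u1 u2, [/\ U1 u1, U2 u2, composable u1 u2 & g = gmul u1 u2]].

Section product.
Variables (U1 U2 : set G) (B1 : bisection U1) (B2 : bisection U2).

Let v1 g := rsec U1 (rg g).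
Let v2 g := gmul (ginv (v1 g)) g.

(** An element of a product of bisections factors uniquely: its range determines the first factor,
    and division gives the second. Both factors vary continuously because the local section
    [rsec U1] does. *)
Lemma product_near u1 u2 : U1 u1 -> U2 u2 -> composable u1 u2 ->
  [/\ v1 @ gmul u1 u2 --> u1, v2 @ gmul u1 u2 --> u2 &
    \forall g \near gmul u1 u2,
      [/\ U1 (v1 g), U2 (v2 g), rg (v1 g) = rg g, composable (v1 g) (v2 g) &
          g = gmul (v1 g) (v2 g)]].
Proof.
move=> Uu1 Uu2 u12.
have rE : rg (gmul u1 u2) = rg u1 by rewrite rg_mul.
have v1E : v1 (gmul u1 u2) = u1 by rewrite /v1 rE rsecE.
have c1 : v1 @ gmul u1 u2 --> u1.
  apply: (@cvg_comp _ _ _ (@rg G) (rsec U1)); first exact: (rg_cvg GE).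
  by rewrite rE; exact: rsec_cvg.
have n1 : \forall g \near gmul u1 u2, U1 (v1 g) /\ rg (v1 g) = rg g.
  have : nbhs (rg (gmul u1 u2)) [set x | U1 (rsec U1 x) /\ rg (rsec U1 x) = x].
    have uT : nbhs u1 [set: G] by exact: filterT.
    by rewrite rE; apply: filterS (rsec_near GE B1 Uu1 uT) => x [].
  by move=> /(rg_cvg GE).
have c2 : v2 @ gmul u1 u2 --> u2.
  rewrite -[X in _ --> X](gmulKl u12); apply: (gmul_cvg GE).
  - by apply: composable_inv_l; rewrite rE.
  - by apply: filterS n1 => g [_ r1]; exact: composable_inv_l.
  - apply: (@cvg_comp _ _ _ v1 (@ginv G)); first exact: c1.
    exact: (ginv_cvg GE).
  - exact: cvg_id.
split=> //; have [oU2 _ _] := B2.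
have n2 : \forall g \near gmul u1 u2, U2 (v2 g).
  by apply: c2; exact: open_nbhs_nbhs.
apply: filterS2 n1 n2 => g [U1g rg1] U2g; split=> //.
  by rewrite /composable /v2 rg_Vmul.
by rewrite /v2 gmulVl.
Qed.

Lemma bisection_mul : bisection (set_gmul U1 U2).
Proof.
have [_ ir1 is1] := B1; have [_ ir2 is2] := B2; split.
- rewrite openE => _ [u1 [u2 [Uu1 Uu2 u12 ->]]].
  have [_ _] := product_near Uu1 Uu2 u12.
  by apply: filterS => g [? ? _ ? ?]; exists (v1 g), (v2 g).
- move=> _ _ [u1 [u2 [Uu1 Uu2 u12 ->]]] [w1 [w2 [Uw1 Uw2 w12 ->]]].
  rewrite !rg_mul// => /(ir1 _ _ Uu1 Uw1) e1; move: u12; rewrite e1 => u12.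
  by rewrite (ir2 u2 w2)// -u12.
- move=> _ _ [u1 [u2 [Uu1 Uu2 u12 ->]]] [w1 [w2 [Uw1 Uw2 w12 ->]]].
  rewrite !sc_mul// => /(is2 _ _ Uu2 Uw2) e2; move: u12; rewrite e2 => u12.
  by rewrite (is1 u1 w1)// u12.
Qed.

(** The convolution sum has the single term $f_1(v_1) f_2(v_2)$, and its support lies in the image
    of the composable pairs of $K_1 \times K_2$. *)
Lemma convol_Cc_on f1 f2 : Cc_on U1 f1 -> Cc_on U2 f2 ->
  Cc_on (set_gmul U1 U2) (convol f1 f2).
Proof.
have [oU1 ir1 is1] := B1; have [oU2 ir2 is2] := B2.
have [oD _ _] := bisection_mul.
move=> fU1 fU2.
have [cf1 [K1 [cK1 KU1 K10]]] := (Cc_onP _ oU1).1 fU1.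
have [cf2 [K2 [cK2 KU2 K20]]] := (Cc_onP _ oU2).1 fU2.
have cE g u : U1 u -> rg u = rg g ->
    convol f1 f2 g = f1 u * f2 (gmul (ginv u) g).
  move=> Uu ug; apply: (@gind_single _ _ R[i]^o) => // h hg hu.
  apply: (Cc_on_out fU1) => Uh; apply: hu; apply: ir1 => //.
  by rewrite hg.
apply/(Cc_onP _ oD); split.
  move=> _ [u1 [u2 [Uu1 Uu2 u12 ->]]].
  have [c1 c2 n12] := product_near Uu1 Uu2 u12.
  have cn : \forall g \near gmul u1 u2,
      convol f1 f2 g = f1 (v1 g) * f2 (v2 g).
    by apply: filterS n12 => g [U1g _ r1 _ _]; exact: cE.
  apply: cont_at_near cn _; rewrite /cont_at.
  have -> : v1 (gmul u1 u2) = u1 by rewrite /v1 rg_mul// rsecE.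
  have -> : v2 (gmul u1 u2) = u2 by rewrite /v2 /v1 rg_mul// rsecE// gmulKl.
  apply: cvgM.
    by apply: (@cvg_comp _ _ _ v1 (f1 : G -> R[i]^o)); [exact: c1|exact: cf1].
  by apply: (@cvg_comp _ _ _ v2 (f2 : G -> R[i]^o)); [exact: c2|exact: cf2].
pose K := (K1 `*` K2) `&` [set p : G * G | composable p.1 p.2].
exists ((fun p : G * G => gmul p.1 p.2) @` K); split.
- apply: continuous_compact.
    apply: (@continuous_subspaceW _ _ _ [set p : G * G | composable p.1 p.2]).
      by move=> p [].
    by case: GE.
  apply: compact_closedI; first exact: compact_setX.
  exact: composable_closed.
- move=> _ [[a b] [[/= /KU1 ? /KU2 ?] ab] <-].
  by exists a, b.
- move=> g nK; have [[u [K1u ug]]|nu] := pselect (exists u, K1 u /\ rg u = rg g).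
    rewrite (cE _ u)//; last exact: KU1.
    rewrite K20 ?mulr0// => K2v; apply: nK; exists (u, gmul (ginv u) g).
      by split=> //=; rewrite /composable rg_Vmul.
    by rewrite /= gmulVl.
  apply: (@gind_none _ _ R[i]^o) => h hg; apply: K10 => K1h; apply: nu.
  by exists h.
Qed.

End product.

Lemma convol_Cc f1 f2 : Cc f1 -> Cc f2 -> Cc (convol f1 f2).
Proof.
move=> Cf1 Cf2; move: f1 Cf1; apply: (Cc_ind GE).
- rewrite (_ : convol _ _ = 0); first exact: Cc0.
  by apply/funext => g; apply: (@gind_none _ _ R[i]^o).
- move=> c f f' Cf Cf' C1 C2.
  rewrite convolE gind_linf; try exact: Cc_fiber_finite.
  exact: Cc_lin.
move=> U1 f1 B1 fU1; have Ff1 := supp_bisection B1 fU1.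
move: f2 Cf2; apply: (Cc_ind GE).
- rewrite (_ : convol _ _ = 0); first exact: Cc0.
  by apply/funext => g; apply: fsbig1 => h _; rewrite mulr0.
- move=> c f f' Cf Cf' C1 C2; rewrite convolE gind_lin//.
  exact: Cc_lin.
move=> U2 f2 B2 fU2; apply: (Cc_bisection GE (bisection_mul B1 B2)).
exact: convol_Cc_on.
Qed.

End Cc_algebra.

(* A *-action of C_c(G) on a semi-inner product space, with no boundedness assumed. *)
Record prerep (R : realType) (G : groupoid) (E : lmodType R[i]) (D : set E)
    (s : E -> E -> R[i]) (pi : (G -> R[i]) -> E -> E) : Prop := Prerep {
  pr_si : semi_inner D s;
  pr_dom : forall f a, Cc f -> D a -> D (pi f a);
  pr_linf : forall c f f' a, Cc f -> Cc f' -> D a ->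
    pi (c *: f + f') a = c *: pi f a + pi f' a;
  pr_lin : forall f c a b, Cc f -> D a -> D b ->
    pi f (c *: a + b) = c *: pi f a + pi f b;
  pr_mul : forall f f' a, Cc f -> Cc f' -> D a ->
    pi (convol f f') a = pi f (pi f' a);
  pr_adj : forall f a b, Cc f -> D a -> D b ->
    s (pi f a) b = s a (pi (invol f) b) }.

(** * Automatic boundedness and polynomial calculus *)

Section prerep_theory.
Variables (R : realType) (G : groupoid).
Hypothesis GE : lc_etale G.
Implicit Types (f : G -> R[i]) (g h x : G) (U : set G).

Section one_prerep.
Variables (E : lmodType R[i]) (D : set E) (s : E -> E -> R[i]).
Variable pi : (G -> R[i]) -> E -> E.
Hypothesis P : prerep D s pi.
Let sP := pr_si P.

Lemma prerep0 a : D a -> pi 0 a = 0.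
Proof.
move=> Da; have C0 := @Cc0 R G; have := pr_linf P (-1) C0 C0 Da.
by rewrite scaler0 addr0 => ->; rewrite scaleN1r addNr.
Qed.

Lemma prerep_adjV f a b : Cc f -> D a -> D b ->
  s (pi (invol f) a) b = s a (pi f b).
Proof. by move=> Cf Da Db; rewrite (pr_adj P)// ?involK//; exact: invol_Cc. Qed.

Lemma prerep_sqn f a : Cc f -> D a ->
  s (pi (convol (invol f) f) a) a = (sqn s (pi f a))%:C%C.
Proof.
move=> Cf Da; have Cf' := invol_Cc GE Cf; have Df := pr_dom P Cf Da.
by rewrite (pr_mul P)// prerep_adjV// (sqnE sP).
Qed.

Lemma prerep_starsq_sym f a b : Cc f -> D a -> D b ->
  s (pi (convol (invol f) f) a) b = s a (pi (convol (invol f) f) b).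
Proof.
move=> Cf Da Db; have Cf' := invol_Cc GE Cf.
have Dfa := pr_dom P Cf Da; have Dfb := pr_dom P Cf Db.
by rewrite !(pr_mul P)// prerep_adjV// -(pr_adj P).
Qed.

End one_prerep.

(** For a bisection, $U^{-1}U$ consists of units and each unit is the source of at most one element
    of [U]. So $f^* f'$ is a function on units, given by a pointwise product. *)
Lemma convol_invol_bisection U f f' g : bisection U ->
  (forall h, ~ U h -> f h = 0) -> (forall h, ~ U h -> f' h = 0) ->
  (forall u, U u -> sc u = g -> convol (invol f) f' g = Num.conj (f u) * f' u) /\
  ((forall u, U u -> sc u <> g) -> convol (invol f) f' g = 0).
Proof.
move=> [oU ir is_] f0 f'0; split.
  move=> u Uu ug; have gu : units G g by rewrite -ug; exact: sc_unit.
  rewrite convolE (@gind_single _ _ _ _ _ _ (ginv u)).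
  - rewrite /invol ginvK; congr (_ * _); congr f'.
    by rewrite -ug scK.
  - by rewrite /fiber_r /= rg_inv ug (unit_rg gu).
  - move=> h hg hu; rewrite /invol f0 ?rmorph0// => Uh; apply: hu.
    rewrite -[h]ginvK; congr ginv; apply: is_ => //.
    by rewrite sc_inv hg (unit_rg gu).
move=> nu; apply: fsbig1 => h hg.
have [Uh|/f0 fh] := pselect (U (ginv h)); last by rewrite /invol fh rmorph0 mul0r.
have [Uhg|/f'0 ->] := pselect (U (gmul (ginv h) g)); last by rewrite mulr0.
have := ir _ _ Uh Uhg; rewrite rg_inv rg_Vmul// => /(_ erefl) e.
case: (nu _ Uh); rewrite sc_inv.
have : gmul h (ginv h) = gmul h (gmul (ginv h) g) by rewrite -e.
by rewrite gmulVl.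
Qed.

Lemma convol_units f f' g : (forall h, ~ units G h -> f h = 0) ->
  (forall h, ~ units G h -> f' h = 0) ->
  (units G g -> convol f f' g = f g * f' g) /\
  (~ units G g -> convol f f' g = 0).
Proof.
move=> f0 f'0; have E : forall k, rg k = rg g ->
    convol f f' k = f (rg k) * f' k.
  move=> k kg; rewrite convolE (@gind_single _ _ _ _ _ _ (rg k)).
  - by rewrite ginv_rg rgK.
  - by rewrite /fiber_r /= rg_rg.
  - move=> h hk hn; apply: f0 => uh; apply: hn.
    by rewrite -hk (unit_rg uh).
split; first by move=> ug; rewrite E// (unit_rg ug).
by move=> nug; rewrite E// (f'0 _ nug) mulr0.
Qed.

Lemma Cc_on_bounded U f : bisection U -> Cc_on U f ->
  exists2 m, 0 <= m & forall g, rnorm (f g) ^+ 2 <= m.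
Proof.
move=> bU fU; have [oU _ _] := bU.
have [cf [K [cK KU K0]]] := (Cc_onP _ oU).1 fU.
have [||s sK sP] := @compact_finite_subcover G K
  (fun p => [set h | rnorm (f h) < rnorm (f p) + 1]).
- exact: cK.
- move=> p /KU Up; have /rnorm_cvg/cvgrPdist_lt/(_ 1 ltr01) := cf p Up.
  by apply: filterS => h; rewrite /= ltr_norml => /andP[]; lra.
have n0 (z : R[i]) : 0 <= rnorm z by exact: Re_ge0.
exists (\sum_(x <- s) (rnorm (f x) + 1) ^+ 2) => [|g].
  by apply: sumr_ge0 => x _; rewrite sqr_ge0.
have [Kg|/K0 ->] := pselect (K g); last first.
  rewrite /rnorm normr0 /= expr0n /=; apply: sumr_ge0 => x _.
  by rewrite sqr_ge0.
have [x xs lt1] := sP g Kg.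
apply: le_trans (_ : (rnorm (f x) + 1) ^+ 2 <= _).
  by rewrite ler_pXn2r ?nnegrE ?addr_ge0// ltW.
rewrite (big_rem x)//= lerDl; apply: sumr_ge0 => y _.
by rewrite sqr_ge0.
Qed.

Lemma rnormM (z w : R[i]) : rnorm (z * w) = rnorm z * rnorm w.
Proof. by rewrite /rnorm normrM -{1}[`|z|]ReK_ge0// Re_ZM. Qed.

Lemma conj_mul_rnorm (z : R[i]) : Num.conj z * z = (rnorm z ^+ 2)%:C%C.
Proof.
rewrite mulrC -normCK rmorphXn /= /rnorm ReK_ge0//.
Qed.

(* With z = f sqrt(m - |f|^2) one has z^* z = m f^* f - (f^* f)^2 because these
   functions are supported on the units. *)
Lemma bisection_starsq U f m : bisection U -> Cc_on U f ->
  (forall g, rnorm (f g) ^+ 2 <= m) ->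
  exists2 z, Cc z & convol (invol z) z =
    m%:C%C *: convol (invol f) f -
    convol (convol (invol f) f) (convol (invol f) f).
Proof.
move=> bU fU fm; have [oU _ _] := bU.
pose z g := f g * (Num.sqrt (m - rnorm (f g) ^+ 2))%:C%C.
have zU : Cc_on U z.
  apply: Cc_on_mul => // p Up; apply: real_complex_cvg.
  have cr : (fun g => rnorm (f g)) @ p --> rnorm (f p).
    by apply: rnorm_cvg; exact: ((Cc_onP _ oU).1 fU).1.
  have cm : (fun g => m - rnorm (f g) ^+ 2) @ p --> m - rnorm (f p) ^+ 2.
    by apply: cvgB; [exact: cvg_cst|exact: (cvgM cr cr)].
  by apply: (cvg_comp _ _ cm); exact: sqrt_continuous.
exists z; first exact: (Cc_bisection GE bU).
have f0 h : ~ U h -> f h = 0 by exact: Cc_on_out fU.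
have z0 h : ~ U h -> z h = 0 by exact: Cc_on_out zU.
set H := convol (invol f) f.
have H0 h : ~ units G h -> H h = 0.
  move=> nh; apply: (convol_invol_bisection h bU f0 f0).2 => u Uu uh.
  by apply: nh; rewrite -uh; exact: sc_unit.
apply/funext => g; rewrite -[RHS]/(m%:C%C * H g - convol H H g).
have [ug|nug] := pselect (units G g); last first.
  rewrite ((convol_units g H0 H0).2 nug) H0// mulr0 subr0.
  apply: (convol_invol_bisection g bU z0 z0).2 => u Uu uh.
  by apply: nug; rewrite -uh; exact: sc_unit.
rewrite ((convol_units g H0 H0).1 ug).
have [[u Uu us]|nu] := pselect (exists2 u, U u & sc u = g); last first.
  rewrite /H !(convol_invol_bisection g bU _ _).2//; try by
    move=> u Uu us; apply: nu; exists u.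
  by rewrite !mulr0 subr0.
rewrite /H ((convol_invol_bisection g bU z0 z0).1 u)//.
rewrite ((convol_invol_bisection g bU f0 f0).1 u)//.
rewrite !conj_mul_rnorm -!rmorphM -rmorphB /=; congr (_%:C)%C.
rewrite /z rnormM rnormR ger0_norm ?sqrtr_ge0// exprMn sqr_sqrtr ?subr_ge0//.
by ring.
Qed.

(** The point is that [M] serves all actions at once. On a bisection $H = f^*f$ satisfies $mH - H^2
    = z^*z$, so $|Ha|^2 \le m|fa|^2$; together with $|fa|^4 \le |Ha|^2 |a|^2$ this gives the bound
    [m]. *)
Lemma prerep_bounded f : Cc f -> exists2 M : R, 0 <= M &
  forall (E : lmodType R[i]) (D : set E) s (pi : (G -> R[i]) -> E -> E),
  prerep D s pi -> forall a, D a -> sqn s (pi f a) <= M * sqn s a.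
Proof.
move: f; apply: (Cc_ind GE).
- exists 0 => // E D s pi P a Da.
  by rewrite (prerep0 P)// (sqn0 (pr_si P)) mul0r.
- move=> c f f' Cf Cf' [M M0 HM] [M' M'0 HM'].
  exists (2 ^+ 2 * (rnorm c ^+ 2 * M + M')).
    by rewrite mulr_ge0// addr_ge0// mulr_ge0// sqr_ge0.
  move=> E D s pi P a Da; rewrite (pr_linf P)//.
  have Df := pr_dom P Cf Da; have Df' := pr_dom P Cf' Da; have sP := pr_si P.
  have := @sqn_sum _ _ _ _ sP bool [:: true; false]
    (fun b => if b then c *: pi f a else pi f' a).
  rewrite !big_cons !big_nil !addr0 /= => H.
  apply: le_trans (H _) _; first by case=> //; exact: (si_domZ sP).
  rewrite -mulrA ler_pM2l// mulrDl; apply: lerD; last exact: (HM' _ _ _ _ P).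
  by rewrite (sqnZ sP)// -mulrA ler_wpM2l ?sqr_ge0//; exact: (HM _ _ _ _ P).
move=> U f bU fU; have Cf := Cc_bisection GE bU fU.
have [m m0 fm] := Cc_on_bounded bU fU.
have [z Cz zE] := bisection_starsq bU fU fm.
exists m => // E D s pi P a Da; have sP := pr_si P.
have Cf' := invol_Cc GE Cf; pose H := convol (invol f) f.
have CH : Cc H by exact: convol_Cc.
have CHH : Cc (convol H H) by exact: convol_Cc.
have DH := pr_dom P CH Da; have Df := pr_dom P Cf Da.
have HH : sqn s (pi H a) <= m * sqn s (pi f a).
  have -> : sqn s (pi H a) = m * sqn s (pi f a) - sqn s (pi z a).
    have -> : sqn s (pi H a) = complex.Re (s (pi (convol H H) a) a).
      rewrite /sqn (pr_mul P CH CH Da) {2}/H.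
      by rewrite (prerep_starsq_sym P Cf DH Da).
    have -> : convol H H = m%:C%C *: H + (-1) *: convol (invol z) z.
      by rewrite zE -/H scaleN1r opprB addrC subrK.
    have Cz' : Cc (convol (invol z) z) by apply: convol_Cc => //; exact: invol_Cc.
    have Dz := pr_dom P Cz' Da.
    rewrite (pr_linf P)//; last exact: Cc_scale.
    rewrite -[(-1) *: convol _ _]addr0 (pr_linf P)//; last exact: Cc0.
    rewrite (prerep0 P)// addr0 (siDl sP)//; last 2 first.
    - exact: (si_domZ sP).
    - exact: (si_domZ sP).
    rewrite !(siZl sP)// !(prerep_sqn P)//.
    by rewrite mulN1r ReD Re_ZM raddfN.
  by rewrite gerBl; exact: (sqn_ge0 sP (pr_dom P Cz Da)).
have f2 : sqn s (pi f a) ^+ 2 <= sqn s (pi H a) * sqn s a.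
  have -> : sqn s (pi f a) = complex.Re (s (pi H a) a).
    by rewrite (prerep_sqn P).
  exact: (cauchy_schwarz_Re sP).
have a0 := sqn_ge0 sP Da; have f0 := sqn_ge0 sP Df.
have [->|fn0] := eqVneq (sqn s (pi f a)) 0; first exact: mulr_ge0.
have fp : 0 < sqn s (pi f a) by rewrite lt_neqAle eq_sym fn0.
rewrite -(ler_pM2l fp) -expr2; apply: (le_trans f2).
by rewrite mulrA (mulrC (sqn s (pi f a))) ler_wpM2r.
Qed.

(** The element $B\,p(B)$ with $B = f^*f$. The extra factor keeps it in $C_c(G)$, which may have no
    unit, and is the reason why the estimates below concern $t\,p(t)$. *)
Definition bpoly f (p : {poly R}) : G -> R[i] :=
  let B := convol (invol f) f in opoly (convol B) p B.

Lemma opoly_convol_Cc f f' (p : {poly R}) : Cc f -> Cc f' ->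
  Cc (opoly (convol f) p f').
Proof.
move=> Cf Cf'; apply: Cc_sum => i _; apply: Cc_scale.
by elim: (i : nat) => //= n IHn; exact: convol_Cc.
Qed.

Lemma starsq_Cc f : Cc f -> Cc (convol (invol f) f).
Proof. by move=> Cf; apply: convol_Cc => //; exact: invol_Cc. Qed.

Lemma bpoly_Cc f p : Cc f -> Cc (bpoly f p).
Proof. by move=> Cf; apply: opoly_convol_Cc; exact: starsq_Cc. Qed.

Lemma bpolyB f p q : bpoly f p - bpoly f q = bpoly f (p - q).
Proof.
rewrite /bpoly /= (_ : p - q = (-1) *: q + p) ?scaleN1r 1?addrC//.
by rewrite -scaleN1r opoly_lin rmorphN1 scaleN1r addrC.
Qed.

Section calculus.
Variables (E : lmodType R[i]) (D : set E) (s : E -> E -> R[i]).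
Variable pi : (G -> R[i]) -> E -> E.
Hypothesis P : prerep D s pi.
Let sP := pr_si P.

Lemma prerep_suml (I : Type) (r : seq I) (F : I -> G -> R[i]) a :
  (forall i, Cc (F i)) -> D a ->
  pi (\sum_(i <- r) F i) a = \sum_(i <- r) pi (F i) a.
Proof.
move=> CF Da; elim: r => [|i r IHr]; first by rewrite !big_nil (prerep0 P).
rewrite !big_cons -[F i]scale1r (pr_linf P)// ?scale1r ?IHr//.
exact: Cc_sum.
Qed.

Lemma prerep_bpoly f p a : Cc f -> D a ->
  pi (bpoly f p) a = opoly (pi (convol (invol f) f)) ('X * p) a.
Proof.
move=> Cf Da; have CB := starsq_Cc Cf; set B := convol (invol f) f.
have DB b : D b -> D (pi B b) by exact: (pr_dom P).
have linB c b b' : D b -> D b' -> pi B (c *: b + b') = c *: pi B b + pi B b'.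
  by move=> Db Db'; exact: (pr_lin P).
rewrite mulrC (opolyM sP DB linB)// -['X]mulr1 (opolyX sP DB linB)//.
rewrite -polyC1 opolyC scale1r.
have Cit n : Cc (iter n (convol B) B) by elim: n => //= n IHn; exact: convol_Cc.
rewrite /bpoly /opoly prerep_suml//; last by move=> i; exact: Cc_scale.
apply: eq_bigr => i _; rewrite -[X in pi X]addr0 (pr_linf P)//; last exact: Cc0.
rewrite (prerep0 P)// addr0; congr (_ *: _).
by elim: (i : nat) => //= n IHn; rewrite (pr_mul P)// IHn.
Qed.

Variables (f : G -> R[i]) (M : R).
Hypotheses (Cf : Cc f) (M0 : 0 < M)
  (fM : forall a, D a -> sqn s (pi f a) <= M * sqn s a).

Let B := convol (invol f) f.
Let CB : Cc B := starsq_Cc Cf.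
Let DB b : D b -> D (pi B b). Proof. exact: (pr_dom P). Qed.
Let linB c b b' : D b -> D b' -> pi B (c *: b + b') = c *: pi B b + pi B b'.
Proof. by move=> Db Db'; exact: (pr_lin P). Qed.
Let symB b b' : D b -> D b' -> s (pi B b) b' = s b (pi B b').
Proof. exact: (prerep_starsq_sym P). Qed.
Let ReB b : D b -> complex.Re (s (pi B b) b) = sqn s (pi f b).
Proof. by move=> Db; rewrite (prerep_sqn P). Qed.
Let B0 b : D b -> 0 <= complex.Re (s (pi B b) b).
Proof. by move=> Db; rewrite ReB//; apply: (sqn_ge0 sP); exact: (pr_dom P). Qed.
Let BM b : D b -> complex.Re (s (pi B b) b) <= M * sqn s b.
Proof. by move=> Db; rewrite ReB//; exact: fM. Qed.

Lemma bpoly_le p (e : R) a : D a ->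
  (forall t, 0 <= t <= M -> `|t * p.[t]| <= e) ->
  sqn s (pi (bpoly f p) a) <= e ^+ 2 * sqn s a.
Proof.
move=> Da pe; rewrite prerep_bpoly//.
apply: (opoly_le sP DB linB symB M0 B0 BM) => // t tM.
by rewrite hornerM hornerX; exact: pe.
Qed.

(** Positivity of $t\,p(t) - t(t - c) + e$ on $[0, M]$, evaluated at $B$, with $\langle B^2a,
    a\rangle = |Ba|^2$ and $\langle Ba, a\rangle = |fa|^2$. It turns smallness of $B\,p(B)$ into an
    upper bound on [f]. *)
Lemma bpoly_ge p (c e : R) a : D a ->
  (forall t, 0 <= t <= M -> t * (t - c) - e <= t * p.[t]) ->
  sqn s (pi B a) - c * sqn s (pi f a) - e * sqn s a <=
  complex.Re (s (pi (bpoly f p) a) a).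
Proof.
move=> Da pe; rewrite prerep_bpoly//.
pose q : {poly R} := 1 *: ('X * 'X) + ((- c) *: 'X + (- e)%:P).
have := @opoly_ge0 _ _ _ _ sP _ DB linB symB M M0 B0 BM
  ((-1) *: q + 'X * p) a Da.
have X1 b : D b -> opoly (pi B) 'X b = pi B b.
  move=> Db; rewrite -['X]mulr1 (opolyX sP DB linB)//.
  by rewrite -[1]/(1%:P) opolyC scale1r.
have D1 := DB Da; have D2 := DB D1.
have D3 := si_domZ sP (- e)%:C%C Da.
have D4 := si_dom sP (- c)%:C%C D1 D3.
have D5 := si_dom sP 1%:C%C D2 D4.
have D6 := opoly_dom sP DB ('X * p) Da.
have -> : opoly (pi B) ((-1) *: q + 'X * p) a =
    (-1)%:C%C *: (1%:C%C *: pi B (pi B a) +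
    ((- c)%:C%C *: pi B a + (- e)%:C%C *: a)) + opoly (pi B) ('X * p) a.
  rewrite opoly_lin; congr (_ *: _ + _); rewrite /q opoly_lin.
  rewrite (opolyM sP DB linB 'X 'X Da) X1 ?X1//; congr (_ + _).
  by rewrite opoly_lin X1//; congr (_ + _); exact: opolyC.
rewrite !(si_linear sP)// (siZl sP)// !ReD !Re_ZM (symB D1 Da) -/(sqn s (pi B a)).
rewrite !ReD !Re_ZM ReB// -/(sqn s a) mul1r.
move=> H; have {}H : 0 <= -1 * (sqn s (pi B a) + (- c * sqn s (pi f a) + - e * sqn s a))
    + complex.Re (s (opoly (pi B) ('X * p) a) a).
  apply: H => t tM; rewrite !(hornerD, hornerZ, hornerM, hornerX, hornerC).
  by have := pe t tM; lra.
by rewrite -/B; lra.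
Qed.

End calculus.

End prerep_theory.

(** * Induced modules *)

Section induced_module.
Variables (R : realType) (G : groupoid) (x : G) (V : lmodType R[i]).
Variables (b : V -> V -> R[i]) (Gam S : set G) (u : G -> V -> V).
Implicit Types (g h k l : G) (v w : V) (xi eta : G -> V) (f : G -> R[i]).

(* [Gam] is a subgroup of the isotropy group at [x] acting on [V] through [u],
   and [S] is a set of representatives of G_x / Gam. The isotropy group itself
   gives induced representations, and the trivial subgroup gives the regular
   ones. The action [u] need not be unital. *)
Record ind_data : Prop := IndData {
  id_si : semi_inner setT b;
  id_iso : forall c, Gam c -> rg c = x /\ sc c = x;
  id_1 : Gam x;
  id_mul : forall c d, Gam c -> Gam d -> Gam (gmul c d);
  id_inv : forall c, Gam c -> Gam (ginv c);
  id_lin : forall c t v w, Gam c -> u c (t *: v + w) = t *: u c v + u c w;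
  id_act : forall c d v, Gam c -> Gam d -> u (gmul c d) v = u c (u d v);
  id_adj : forall c v w, Gam c -> b (u c v) w = b v (u (ginv c) w);
  id_sub : S `<=` fiber_s x;
  id_cover : forall k, sc k = x ->
    exists2 g, S g & rg g = rg k /\ Gam (gmul (ginv g) k);
  id_uniq : forall g k, S g -> S k -> rg g = rg k -> Gam (gmul (ginv g) k) -> g = k }.

Definition equivariant xi : Prop :=
  (forall g, sc g <> x -> xi g = 0) /\
  forall g c, sc g = x -> Gam c -> xi (gmul g c) = u (ginv c) (xi g).

Definition ind_dom : set (G -> V) := [set xi | equivariant xi /\
  finite_set (S `&` [set g | xi g != 0])].

Definition ind_form xi eta : R[i] := \sum_(g \in S) b (xi g) (eta g).

(** Membership of [k] in the coset of [g] modulo [Gam]. *)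
Definition orb g k : Prop := [/\ sc k = x, rg k = rg g & Gam (gmul (ginv k) g)].

(** The equivariant analogue of $\delta_g \otimes v$. Its value at [g] is [u x v], which may differ
    from [v] when the action is not unital. *)
Definition dl g v : G -> V :=
  fun k => if pselect (orb g k) then u (gmul (ginv k) g) v else 0.

Hypothesis ID : ind_data.
Let bP := id_si ID.

Lemma gam_rg c : Gam c -> rg c = x. Proof. by move=> /(id_iso ID)[]. Qed.
Lemma gam_sc c : Gam c -> sc c = x. Proof. by move=> /(id_iso ID)[]. Qed.

Lemma u0 c : Gam c -> u c 0 = 0.
Proof.
by move=> Gc; have := id_lin ID (-1) 0 0 Gc; rewrite !scaleN1r oppr0 addr0 addNr.
Qed.

Lemma u_sum c (I : Type) (r : seq I) (t : I -> R[i]) (F : I -> V) : Gam c ->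
  u c (\sum_(i <- r) t i *: F i) = \sum_(i <- r) t i *: u c (F i).
Proof.
move=> Gc; elim: r => [|i r IHr]; first by rewrite !big_nil u0.
by rewrite !big_cons (id_lin ID)// IHr.
Qed.

Lemma orbE g k : orb g k -> k = gmul g (ginv (gmul (ginv k) g)) /\
  g = gmul k (gmul (ginv k) g).
Proof.
move=> [kx kg Gc]; rewrite ginv_Vmul// !gmulVl//.
Qed.

Lemma orb_sc g k : orb g k -> sc g = x.
Proof. by move=> [kx kg /gam_sc]; rewrite sc_Vmul. Qed.

Lemma orb_sym g k : orb g k -> orb k g.
Proof.
move=> o; have gx := orb_sc o; have [kx kg Gc] := o; split=> //.
by rewrite -ginv_Vmul//; exact: (id_inv ID).
Qed.

Lemma orb_trans g k l : orb g k -> orb k l -> orb g l.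
Proof.
move=> [kx kg Gc] [lx lk Gd]; split=> //; first by rewrite lk.
have -> : gmul (ginv l) g = gmul (gmul (ginv l) k) (gmul (ginv k) g).
  rewrite gmul_assoc ?gmulVl//; first exact: composable_inv_l.
  by rewrite /composable rg_Vmul.
exact: (id_mul ID).
Qed.

Lemma orb_mul g c : sc g = x -> Gam c -> orb g (gmul g c).
Proof.
move=> gx Gc; have gc : composable g c by rewrite /composable gx gam_rg.
split; first by rewrite sc_mul// gam_sc.
  by rewrite rg_mul.
rewrite ginv_mul// gmul_assoc; first last.
- exact: composable_inv_l.
- by rewrite /composable sc_inv rg_inv.
rewrite -/(sc g) gx -{1}(gam_rg Gc) -sc_inv scK.
exact: (id_inv ID).
Qed.

Lemma S_orb_inj g k l : S k -> S l -> orb g k -> orb g l -> k = l.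
Proof.
move=> Sk Sl ok ol; have [_ kl Gc] := orb_trans (orb_sym ol) ok.
exact: (id_uniq ID).
Qed.

Lemma S_orb_ex g : sc g = x -> exists2 k, S k & orb g k.
Proof.
move=> gx; have [k Sk [kg Gc]] := id_cover ID gx; exists k => //.
by split=> //; exact: (id_sub ID).
Qed.

Definition orb_rep g : G := xget x [set k | S k /\ orb g k].

Lemma orb_repP g : sc g = x -> S (orb_rep g) /\ orb g (orb_rep g).
Proof.
move=> gx; have [k Sk ok] := S_orb_ex gx.
by apply: (@xgetPex _ x [set k | S k /\ orb g k]); exists k.
Qed.

Lemma orb_rep_eq g k : S k -> orb g k -> orb_rep g = k.
Proof.
move=> Sk ok; have [Sr or] := orb_repP (orb_sc ok); exact: S_orb_inj or ok.
Qed.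

Lemma orb_rep_S g : S g -> orb_rep g = g.
Proof.
move=> Sg; apply: orb_rep_eq => //; have gx := id_sub ID Sg; split=> //.
by rewrite -/(sc g) gx; exact: (id_1 ID).
Qed.

Lemma equiv_orb xi g k : equivariant xi -> orb g k ->
  xi k = u (gmul (ginv k) g) (xi g).
Proof.
move=> [_ xiG] o; have [kE _] := orbE o; have gx := orb_sc o.
have [_ _ Gc] := o; rewrite {1}kE xiG ?ginvK//.
exact: (id_inv ID).
Qed.

Lemma ind_dom_lin c xi eta : ind_dom xi -> ind_dom eta -> ind_dom (c *: xi + eta).
Proof.
move=> [[xi0 xiG] xif] [[eta0 etaG] etaf].
have E g : (c *: xi + eta) g = c *: xi g + eta g by [].
split; [split=> [g gx|g d gx Gd]|].
- by rewrite E xi0// eta0// scaler0 addr0.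
- by rewrite !E xiG// etaG// (id_lin ID)//; exact: (id_inv ID).
- apply: (@sub_finite_set _ _ ((S `&` [set g | xi g != 0]) `|`
      (S `&` [set g | eta g != 0]))); last by rewrite finite_setU.
  move=> g [Sg]; rewrite /= E => nz; have [z|] := eqVneq (xi g) 0; last by left.
  by right; split=> //=; move: nz; rewrite z scaler0 add0r.
Qed.

Lemma ind_dom0 : ind_dom 0.
Proof.
split; first by split=> // g c gx Gc; rewrite [RHS]u0//; exact: (id_inv ID).
by apply: sub_finite_set (finite_set0 _) => g [_] /=; rewrite eqxx.
Qed.

Lemma ind_form_widen xi eta (A : set G) : A `<=` S ->
  (forall g, S g -> xi g != 0 -> A g) ->
  ind_form xi eta = \sum_(g \in A) b (xi g) (eta g).
Proof.
move=> AS xiA; apply/esym/fsbig_widen => // g [Sg nA].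
have [z|/(xiA _ Sg)//] := eqVneq (xi g) 0.
by rewrite /= z (si0l bP).
Qed.

Lemma ind_form_si : semi_inner ind_dom ind_form.
Proof.
split.
- exact: ind_dom0.
- exact: ind_dom_lin.
- move=> c xi eta zeta [_ xif] [_ etaf] _.
  pose A := (S `&` [set g | xi g != 0]) `|` (S `&` [set g | eta g != 0]).
  have Af : finite_set A by rewrite finite_setU.
  have AS : A `<=` S by move=> g [[]|[]].
  rewrite !(@ind_form_widen _ _ A)//; last first.
  + move=> g Sg; rewrite -[(_ + _) g]/(c *: xi g + eta g) => nz.
    have [z|z] := eqVneq (xi g) 0; last by left.
    by right; split=> //=; move: nz; rewrite z scaler0 add0r.
  + by move=> g Sg nz; left.
  + by move=> g Sg nz; right.
  rewrite !fsbig_finite// mulr_sumr -big_split; apply: eq_bigr => g _ /=.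
  by rewrite (si_linear bP).
- move=> xi eta [_ xif] [_ etaf].
  pose A := (S `&` [set g | xi g != 0]) `|` (S `&` [set g | eta g != 0]).
  have Af : finite_set A by rewrite finite_setU.
  have AS : A `<=` S by move=> g [[]|[]].
  rewrite !(@ind_form_widen _ _ A)//; last first.
  + by move=> g Sg nz; right.
  + by move=> g Sg nz; left.
  rewrite !fsbig_finite// rmorph_sum; apply: eq_bigr => g _ /=.
  by rewrite (si_conj bP).
- move=> xi _; apply: fsumr_ge0 => g _; exact: (si_ge0 bP).
Qed.

Lemma dlE g v k : orb g k -> dl g v k = u (gmul (ginv k) g) v.
Proof. by rewrite /dl; case: pselect. Qed.

Lemma dl_out g v k : ~ orb g k -> dl g v k = 0.
Proof. by rewrite /dl; case: pselect. Qed.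

Lemma dl_equiv g v : equivariant (dl g v).
Proof.
split=> [k kx|k c kx Gc]; first by apply: dl_out => -[].
have o1 := orb_mul kx Gc.
have [ok|nok] := pselect (orb g k); last first.
  rewrite !dl_out ?u0//; first exact: (id_inv ID).
  by move=> o2; apply: nok; exact: orb_trans o2 (orb_sym o1).
rewrite !dlE//; last exact: orb_trans ok o1.
have [_ kg Gd] := ok.
rewrite -(id_act ID)//; last exact: (id_inv ID).
have kc : composable k c by rewrite /composable kx gam_rg.
rewrite ginv_mul// gmul_assoc//; last exact: composable_inv_l.
by rewrite /composable sc_inv rg_inv.
Qed.

Lemma dl_dom g v : ind_dom (dl g v).
Proof.
split; first exact: dl_equiv.
apply: sub_finite_set (finite_set1 (orb_rep g)) => k [Sk] /=.
have [ok _|nok] := pselect (orb g k); first by rewrite (orb_rep_eq Sk ok).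
by rewrite dl_out// eqxx.
Qed.

(** A reproducing property. Only the representative of the coset of [l] contributes, and moving [u]
    across the form turns the value of [xi] there into its value at [l]. *)
Lemma ind_form_dl xi l w : equivariant xi -> sc l = x ->
  ind_form xi (dl l w) = b (xi l) w.
Proof.
move=> xiE lx; have [Sr o] := orb_repP lx.
rewrite /ind_form -(fsbig_widen [set orb_rep l]).
- have [_ _ Gc] := o.
  rewrite fsbig_set1 dlE// (equiv_orb xiE (orb_sym o)) (id_adj ID).
    by rewrite ginv_Vmul//; case: o.
  by case: (orb_sym o).
- by move=> _ ->.
- move=> g [Sg] /= gr; rewrite dl_out ?(si0r bP)// => o'.
  by apply: gr; rewrite (orb_rep_eq Sg o').
Qed.

Lemma ind_dom_dl xi : ind_dom xi -> exists2 s : seq G,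
  (forall g, g \in s -> S g) & xi = \sum_(g <- s) dl g (xi g).
Proof.
move=> [xiE /finite_seqP[t tE]]; pose s := undup t.
have sP g : g \in s <-> S g /\ xi g != 0.
  rewrite mem_undup; split=> [gt|Sg].
    by have : [set` t] g by []; rewrite -tE.
  by have : (S `&` [set g | xi g != 0]) g by []; rewrite tE.
exists s => [g /sP[]//|]; apply/funext => k; rewrite fct_sumE.
have [kx|kx] := pselect (sc k = x); last first.
  by rewrite xiE.1// big1// => g _; rewrite dl_out// => -[].
have [Sr ok] := orb_repP kx.
have E g : g \in s -> g != orb_rep k -> dl g (xi g) k = 0.
  move=> /sP[Sg _] gr; rewrite dl_out// => o'.
  by move: gr; rewrite (orb_rep_eq Sg (orb_sym o')) eqxx.
have xkE : xi k = dl (orb_rep k) (xi (orb_rep k)) k.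
  by rewrite dlE ?(equiv_orb xiE (orb_sym ok))//; exact: orb_sym.
have [rin|rnin] := boolP (orb_rep k \in s).
  rewrite (big_rem (orb_rep k))//= -xkE big_seq big1 ?addr0// => g gin.
  apply: E; first exact: mem_rem gin.
  apply: contraTneq gin => ->.
  by rewrite mem_rem_uniq ?undup_uniq// inE eqxx.
rewrite big_seq big1.
  rewrite xkE dlE; last exact: orb_sym.
  have -> : xi (orb_rep k) = 0.
    by apply/eqP/negPn/negP => nz; move/negP: rnin; apply; apply/sP.
  by rewrite u0//; case: (orb_sym ok).
move=> g gin; apply: E => //; apply: contraNneq rnin => <-; exact: gin.
Qed.

Lemma gind_dl_reindex g l : sc g = x -> sc l = x ->
  set_bij Gam [set h | rg h = rg l /\ orb g (gmul (ginv h) l)]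
    (fun c => gmul (gmul l c) (ginv g)).
Proof.
move=> gx lx.
have lc c : Gam c -> composable l c by move=> Gc; rewrite /composable lx gam_rg.
have lcg c : Gam c -> sc (gmul l c) = sc g.
  by move=> Gc; rewrite (sc_mul (lc _ Gc)) gam_sc.
split.
- move=> c Gc; split; first by rewrite rg_mulV ?rg_mul//; [exact: lc|exact: lcg].
  rewrite ginv_mulV; last exact: lcg.
  have -> : gmul (gmul g (ginv (gmul l c))) l = gmul g (ginv c).
    rewrite ginv_mul; last exact: lc.
    have c1 : composable g (ginv c) by rewrite /composable gx rg_inv gam_sc.
    rewrite -gmul_assoc//; last by rewrite /composable sc_inv rg_inv gam_rg.
    by rewrite gmulVr// sc_mul// sc_inv gam_rg.
  by apply: orb_mul => //; exact: (id_inv ID).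
- move=> c d; rewrite !inE => Gc Gd; move=> /gmulIr.
  move=> /(_ (composable_inv_r (lcg _ Gc)) (composable_inv_r (lcg _ Gd))).
  by apply: gmulI; exact: lc.
- move=> h [hl [hlx rgE Gc]].
  exists (gmul (ginv (gmul (ginv h) l)) g) => //.
  have hg : composable h g by rewrite /composable -rgE rg_Vmul.
  rewrite ginv_Vmul// -gmul_assoc ?gmulVl// ?gmulKr//.
    by rewrite /composable rg_Vmul.
  by rewrite /composable sc_Vmul.
Qed.

(** The matrix coefficients: $h^{-1}l$ lies in the coset of $g$ exactly when $h = l c g^{-1}$ with
    $c$ in [Gam]. *)
Lemma gind_dl f g v l : sc g = x -> sc l = x ->
  gind f (dl g v) l =
  \sum_(c \in Gam) f (gmul (gmul l c) (ginv g)) *: u c v.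
Proof.
move=> gx lx; have bij := gind_dl_reindex gx lx.
pose A : set G := [set h | rg h = rg l /\ orb g (gmul (ginv h) l)].
rewrite /gind -(fsbig_widen A); last 2 first.
- by move=> h [].
- move=> h [hl nA] /=; rewrite dl_out ?scaler0// => ok; apply: nA; split=> //.
rewrite (reindex_fsbig _ _ _ _ bij); apply: eq_fsbigr => c; rewrite inE => Gc.
have [hmem _ _] := bij; have [hl ok] := hmem c Gc; congr (_ *: _).
rewrite dlE//; congr (u _ v).
have lc : composable l c by rewrite /composable lx gam_rg.
have lcg : sc (gmul l c) = sc g by rewrite sc_mul// gam_sc.
have [_ hg _] := ok.
rewrite ginv_Vmul// -gmul_assoc; last 2 first.
- by apply: composable_inv_l; rewrite rg_mul.
- exact: composable_inv_r.
by rewrite gmulKl// gmulVr// gam_sc.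
Qed.

Lemma coef_finite f g l : fiber_finite f -> sc g = x -> sc l = x ->
  finite_set (Gam `&` [set c | f (gmul (gmul l c) (ginv g)) != 0]).
Proof.
move=> Ff gx lx; have [fin _] := Ff (rg l).
apply: sub_finite_set (finite_image (fun h => gmul (ginv l) (gmul h g)) fin).
move=> c [Gc /= nz]; have lc : composable l c by rewrite /composable lx gam_rg.
have lcg : sc (gmul l c) = sc g by rewrite sc_mul// gam_sc.
exists (gmul (gmul l c) (ginv g)); last by rewrite gmulVr// gmulKl.
by split=> //; rewrite rg_mulV// rg_mul.
Qed.

Lemma gind_equiv f xi : fiber_finite f -> equivariant xi -> equivariant (gind f xi).
Proof.
move=> Ff [xi0 xiG]; split.
  move=> g gx; apply: fsbig1 => h hg; rewrite xi0 ?scaler0//.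
  by rewrite sc_Vmul.
move=> g c gx Gc; have gc : composable g c by rewrite /composable gx gam_rg.
pose A := supp_r f (rg g); have fA : finite_set A by case: (Ff (rg g)).
rewrite !(@gind_widen _ _ _ _ _ _ A); try by move=> h [].
- rewrite !fsbig_finite// u_sum; last exact: (id_inv ID).
  apply: eq_big_seq => h; rewrite in_fset_set// inE => -[hg _].
  congr (_ *: _); rewrite -gmul_assoc//; last exact: composable_inv_l.
  by rewrite xiG// sc_Vmul.
- by move=> h []; rewrite /A rg_mul.
- by move=> h []; rewrite /fiber_r /= rg_mul.
Qed.

Lemma gind_dl_dom f g v : fiber_finite f -> sc g = x -> ind_dom (gind f (dl g v)).
Proof.
move=> Ff gx; split; first by apply: gind_equiv => //; exact: dl_equiv.
have [_ fin] := Ff (rg g).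
apply: sub_finite_set (finite_image (fun h => orb_rep (gmul h g)) fin).
move=> l [Sl] /= nz; have lx := id_sub ID Sl.
have [h hl nz'] : exists2 h, rg h = rg l & f h *: dl g v (gmul (ginv h) l) != 0.
  apply: contrapT => n; move/eqP: nz; apply; apply: fsbig1 => h hl.
  by apply/eqP/negPn/negP => nz; apply: n; exists h.
have fh : f h != 0 by apply: contraNneq nz' => ->; rewrite scale0r.
have ok : orb g (gmul (ginv h) l).
  by apply: contrapT => nok; move: nz'; rewrite dl_out// scaler0 eqxx.
have [kx kg Gc] := ok.
have hg : sc h = rg g by rewrite -kg rg_Vmul.
exists h => //; apply: orb_rep_eq => //.
split=> //; first by rewrite rg_mul.
rewrite -gmul_assoc//; last exact: composable_inv_l.
by rewrite -ginv_Vmul.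
Qed.

Lemma gind_dom f xi : fiber_finite f -> ind_dom xi -> ind_dom (gind f xi).
Proof.
move=> Ff /ind_dom_dl[s sS ->].
have sc_s g : g \in s -> sc g = x by move=> /sS/(id_sub ID).
elim: s {sS} sc_s => [|g s IHs] sc_s.
  rewrite big_nil (_ : gind f 0 = 0); first exact: ind_dom0.
  by apply/funext => k; apply: fsbig1 => h _; rewrite scaler0.
rewrite big_cons -[dl _ _]scale1r gind_lin// scale1r -[gind f (dl _ _)]scale1r.
apply: ind_dom_lin; last by apply: IHs => k ks; apply: sc_s; rewrite inE ks orbT.
by apply: gind_dl_dom => //; apply: sc_s; rewrite inE eqxx.
Qed.

(** By [ind_form_dl] and [gind_dl] both sides are sums over [Gam], and $c \mapsto c^{-1}$ exchanges
    the coefficients of [f] with those of its adjoint. *)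
Lemma gind_adj_dl f g l v w : fiber_finite f -> fiber_finite (invol f) ->
  sc g = x -> sc l = x ->
  ind_form (gind f (dl g v)) (dl l w) = ind_form (dl g v) (gind (invol f) (dl l w)).
Proof.
move=> Ff Ff' gx lx.
have D1 := dl_dom g v; have D2 := dl_dom l w.
have D3 := gind_dom Ff' D2; have D4 := gind_dom Ff D1.
rewrite (si_conj ind_form_si D3 D1) !ind_form_dl//; last 2 first.
- by case: D3.
- by case: D4.
rewrite !gind_dl//.
pose A := Gam `&` [set c | f (gmul (gmul l c) (ginv g)) != 0].
have Af : finite_set A by exact: coef_finite.
have AG : A `<=` Gam by move=> c [].
have -> : \sum_(c \in Gam) invol f (gmul (gmul g c) (ginv l)) *: u c w =
    \sum_(c \in A) Num.conj (f (gmul (gmul l c) (ginv g))) *: u (ginv c) w.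
  rewrite (reindex_fsbig (@ginv G) Gam Gam); last first.
    split; first by move=> c; exact: (id_inv ID).
      by move=> c d _ _ /(congr1 (@ginv G)); rewrite !ginvK.
    by move=> c Gc; exists (ginv c); [exact: (id_inv ID)|rewrite ginvK].
  have E c : Gam c -> invol f (gmul (gmul g (ginv c)) (ginv l)) =
      Num.conj (f (gmul (gmul l c) (ginv g))).
    move=> Gc; rewrite /invol; congr (Num.conj (f _)).
    have c1 : sc g = sc c by rewrite gx gam_sc.
    rewrite ginv_mulV; last by rewrite sc_mulV ?gam_rg.
    rewrite ginv_mulV// gmul_assoc//; last exact: composable_inv_r.
    by rewrite /composable lx gam_rg.
  rewrite -(fsbig_widen A)//.
    by apply: eq_fsbigr => c; rewrite inE => /AG Gc; rewrite E.
  move=> c [Gc nA] /=; rewrite E//.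
  have [->|nz] := eqVneq (f (gmul (gmul l c) (ginv g))) 0.
    by rewrite rmorph0 scale0r.
  by case: nA.
rewrite -(fsbig_widen A)//; last first.
  move=> c [Gc nA] /=.
  have [->|nz] := eqVneq (f (gmul (gmul l c) (ginv g))) 0.
    by rewrite scale0r.
  by case: nA.
rewrite !fsbig_finite// !(si_suml bP)// rmorph_sum; apply: eq_big_seq => c.
rewrite in_fset_set// inE => /AG Gc; rewrite !(siZl bP)// rmorphM /= conjCK.
by rewrite -(si_conj bP)// (id_adj ID).
Qed.

Lemma gind_adj f xi eta : fiber_finite f -> fiber_finite (invol f) ->
  ind_dom xi -> ind_dom eta ->
  ind_form (gind f xi) eta = ind_form xi (gind (invol f) eta).
Proof.
move=> Ff Ff' /ind_dom_dl[s sS ->] Deta.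
have sP := ind_form_si.
have sc_s g : g \in s -> sc g = x by move=> /sS/(id_sub ID).
elim: s {sS} sc_s => [|g s IHs] sc_s.
  rewrite big_nil (_ : gind f 0 = 0); last first.
    by apply/funext => k; apply: fsbig1 => h _; rewrite scaler0.
  by rewrite !(si0l sP)//; exact: gind_dom.
have gx : sc g = x by apply: sc_s; rewrite inE eqxx.
have Ds : ind_dom (\sum_(k <- s) dl k (xi k)).
  by apply: (si_dom_sum sP) => k _; exact: dl_dom.
have Dg := dl_dom g (xi g).
rewrite big_cons -[dl _ _]scale1r gind_lin// !(si_linear sP)//; try exact: gind_dom.
rewrite IHs; last by move=> k ks; apply: sc_s; rewrite inE ks orbT.
congr (_ * _ + _).
move: Deta => /ind_dom_dl[t tS ->].
have sc_t k : k \in t -> sc k = x by move=> /tS/(id_sub ID).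
elim: t {tS} sc_t => [|k t IHt] sc_t.
  rewrite big_nil (_ : gind (invol f) 0 = 0); last first.
    by apply/funext => k; apply: fsbig1 => h _; rewrite scaler0.
  by rewrite !(si0r sP)//; exact: gind_dom.
have Dt : ind_dom (\sum_(k <- t) dl k (eta k)).
  by apply: (si_dom_sum sP) => j _; exact: dl_dom.
have Dk := dl_dom k (eta k).
rewrite big_cons -[dl k _]scale1r gind_lin// !scale1r.
rewrite !(siDr sP)//; try exact: gind_dom.
rewrite IHt; last by move=> j jt; apply: sc_t; rewrite inE jt orbT.
by rewrite gind_adj_dl//; apply: sc_t; rewrite inE eqxx.
Qed.

Lemma ind_prerep : lc_etale G ->
  prerep ind_dom ind_form (fun f xi => gind f xi).
Proof.
move=> GE; have FF f : Cc f -> fiber_finite f by exact: (Cc_fiber_finite GE).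
split.
- exact: ind_form_si.
- by move=> f xi /FF Ff; exact: gind_dom.
- by move=> c f f' xi /FF Ff /FF Ff' _; exact: gind_linf.
- by move=> f c xi eta /FF Ff _ _; exact: gind_lin.
- by move=> f f' xi /FF Ff /FF Ff' _; exact: gind_mul.
- move=> f xi eta Cf; apply: gind_adj; first exact: FF.
  by apply: FF; exact: invol_Cc.
Qed.

End induced_module.

Lemma rnorm_ge0 (R : realType) (V : normedZmodType R[i]) (v : V) : 0 <= rnorm v.
Proof. by apply: Re_ge0; exact: normr_ge0. Qed.

(** * Operator norms on square-summable equivariant functions *)

Section induced_norm.
Variables (R : realType) (G : groupoid) (x : G) (V : lmodType R[i]).
Variables (b : V -> V -> R[i]) (Gam S : set G) (u : G -> V -> V).
Hypothesis ID : ind_data x b Gam S u.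
Implicit Types (g h k l : G) (v w : V) (xi eta : G -> V) (f : G -> R[i]).
Local Notation equiv := (equivariant x Gam u).
Local Notation dom := (ind_dom x Gam S u).
Local Notation form := (ind_form b S).
Let bP := id_si ID.
Let sP := ind_form_si ID.

Let q_ge0 v : 0 <= complex.Re (b v v).
Proof. exact: (sqn_ge0 bP). Qed.

Definition ind_sqn xi : \bar R := \esum_(g in S) (complex.Re (b (xi g) (xi g)))%:E.

Definition ind_full : set (G -> V) :=
  [set xi | equiv xi /\ (sqrte (ind_sqn xi) < +oo)%E].

Lemma sqn_ind_form xi (A : set G) : finite_set A -> A `<=` S ->
  (forall g, S g -> xi g != 0 -> A g) ->
  sqn form xi = \sum_(g \in A) complex.Re (b (xi g) (xi g)).
Proof.
move=> fA AS xA; rewrite /sqn (ind_form_widen ID _ AS xA) !fsbig_finite//.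
by rewrite raddf_sum.
Qed.

Lemma sqn_ind_form_ge xi (A : set G) : dom xi -> finite_set A -> A `<=` S ->
  \sum_(g \in A) complex.Re (b (xi g) (xi g)) <= sqn form xi.
Proof.
move=> [_ fxi] fA AS; pose B := A `|` (S `&` [set g | xi g != 0]).
have fB : finite_set B by rewrite finite_setU.
rewrite (@sqn_ind_form xi B)//; last 2 first.
- by move=> g [/AS|[]].
- by move=> g Sg nz; right.
rewrite [leRHS](fsbigID A)// (_ : B `&` A = A).
  by rewrite lerDl; apply: fsumr_ge0.
by apply/seteqP; split=> [g []//|g Ag]; split=> //; left.
Qed.

Lemma ind_sqn_dom xi : dom xi -> ind_sqn xi = (sqn form xi)%:E.
Proof.
move=> Dxi; have [_ fxi] := Dxi; apply/eqP; rewrite eq_le; apply/andP; split.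
  apply: ub_ereal_sup => _ [A [fA AS] <-].
  rewrite fsbig_finite// sumEFin lee_fin -fsbig_finite//.
  exact: sqn_ind_form_ge.
apply: esum_ge; exists (S `&` [set g | xi g != 0]); first by split=> // g [].
have -> := @sqn_ind_form xi _ fxi (@subIsetl _ S _) (fun g Sg nz => conj Sg nz).
by rewrite !fsbig_finite// sumEFin.
Qed.

Lemma dom_full xi : dom xi -> ind_full xi.
Proof.
move=> Dxi; split; first by case: Dxi.
rewrite (ind_sqn_dom Dxi); rewrite ltey_eq; apply/orP; left.
by rewrite sqrte_fin_num// lee_fin; exact: (sqn_ge0 sP).
Qed.

(** On finitely many cosets, [gind f xi] depends on only finitely many values of [xi] up to
    equivariance. Cutting [xi] down to those cosets gives a vector of [dom] to which the hypothesis
    applies. *)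
Lemma gind_sqn_le f (c : R) xi : fiber_finite f -> 0 <= c -> equiv xi ->
  (forall eta, dom eta -> sqn form (gind f eta) <= c * sqn form eta) ->
  (ind_sqn (gind f xi) <= c%:E * ind_sqn xi)%E.
Proof.
move=> Ff c0 xiE bnd; apply: ub_ereal_sup => _ [F [fF FS] <-].
(* Representatives of all cosets at which [xi] is read in the evaluation of [gind f xi] on [F]. *)
pose E := \bigcup_(g in F) ((fun h => orb_rep x Gam S (gmul (ginv h) g)) @` supp_r f (rg g)).
have fE : finite_set E.
  by apply: bigcup_finite => // g Fg; apply: finite_image; case: (Ff (rg g)).
have ES : E `<=` S.
  move=> _ [g Fg [h [hg _] <-]]; apply: (orb_repP ID _).1.
  by rewrite sc_Vmul//; exact: (id_sub ID (FS _ Fg)).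
pose eta k := if pselect (sc k = x /\ E (orb_rep x Gam S k)) then xi k else 0.
have etaT k : sc k = x -> E (orb_rep x Gam S k) -> eta k = xi k.
  by move=> kx Ek; rewrite /eta; case: pselect => // -[].
have etaN k : ~ E (orb_rep x Gam S k) -> eta k = 0.
  by move=> nE; rewrite /eta; case: pselect => // -[].
have etaE : equiv eta.
  split=> [k kx|k c' kx Gc]; first by rewrite /eta; case: pselect => // -[].
  have ok := orb_mul ID kx Gc; have kcx : sc (gmul k c') = x by case: ok.
  have [Sr or] := orb_repP ID kx.
  have rE : orb_rep x Gam S (gmul k c') = orb_rep x Gam S k.
    by apply: (orb_rep_eq ID Sr); apply: (orb_trans ID) or; exact: (orb_sym ID ok).
  have [Er|nE] := pselect (E (orb_rep x Gam S k)).
    by rewrite !etaT ?rE//; exact: xiE.2.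
  by rewrite !etaN ?rE// (u0 ID)//; exact: (id_inv ID).
have Deta : dom eta.
  split=> //; apply: sub_finite_set fE => k [Sk] /= nz.
  by apply: contrapT => nE; move: nz; rewrite etaN ?(orb_rep_S ID Sk)// eqxx.
have gE g : F g -> gind f eta g = gind f xi g.
  move=> Fg; rewrite !(@gind_widen _ _ _ _ _ _ (supp_r f (rg g)))//; try by move=> h [].
  apply: eq_fsbigr => h; rewrite inE => -[hg fh]; congr (_ *: _).
  rewrite etaT//; last by exists g => //; exists h.
  by rewrite sc_Vmul//; exact: (id_sub ID (FS _ Fg)).
rewrite fsbig_finite// sumEFin -fsbig_finite//.
apply: (@le_trans _ _ (c * sqn form eta)%:E).
  rewrite lee_fin; apply: le_trans (bnd _ Deta).
  rewrite (eq_fsbigr (fun g => complex.Re (b (gind f eta g) (gind f eta g)))).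
    by apply: sqn_ind_form_ge => //; exact: (gind_dom ID).
  by move=> g; rewrite inE => Fg; rewrite gE.
rewrite EFinM; apply: lee_wpmul2l => //.
rewrite (sqn_ind_form fE ES); last first.
  move=> g Sg nz; apply: contrapT => nE; move: nz.
  by rewrite etaN ?(orb_rep_S ID Sg)// eqxx.
apply: esum_ge; exists E => //.
rewrite !fsbig_finite// sumEFin lee_fin; apply: ler_sum => g _.
have [kx|kx] := pselect (sc g = x /\ E (orb_rep x Gam S g)).
  by rewrite etaT//; case: kx.
rewrite /eta; case: pselect => // ?.
by rewrite (si0l bP).
Qed.

Lemma op_norm_le f (c : R) : fiber_finite f -> 0 <= c ->
  (forall eta, dom eta -> sqn form (gind f eta) <= c ^+ 2 * sqn form eta) ->
  (op_norm ind_full (fun xi => sqrte (ind_sqn xi)) (gind f) <= c%:E)%E.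
Proof.
move=> Ff c0 bnd; apply: ub_ereal_sup => _ [xi [[xiE _] xi1] <-].
have c1 : (sqrte (c ^+ 2)%:E = c%:E)%E by rewrite /sqrte /= sqrtr_sqr ger0_norm.
rewrite -[leRHS]c1 lee_sqrt ?lee_fin ?sqr_ge0//.
apply: le_trans (gind_sqn_le Ff (sqr_ge0 c) xiE bnd) _.
rewrite -[leRHS]mule1; apply: lee_wpmul2l; first by rewrite lee_fin sqr_ge0.
have : (sqrte (ind_sqn xi) <= sqrte 1)%E by rewrite {2}/sqrte /= sqrtr1.
by rewrite lee_sqrt.
Qed.

Lemma op_norm_ge f (e : R) : fiber_finite f ->
  (op_norm ind_full (fun xi => sqrte (ind_sqn xi)) (gind f) <= e%:E)%E ->
  forall eta, dom eta -> sqn form (gind f eta) <= e ^+ 2 * sqn form eta.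
Proof.
move=> Ff opn eta De.
have Dfe := gind_dom ID Ff De.
have sq1 : sqrte 1%E = 1%E :> \bar R by rewrite /sqrte /= sqrtr1.
have key (t : R) : t ^+ 2 * sqn form eta <= 1 ->
    t ^+ 2 * sqn form (gind f eta) <= e ^+ 2.
  move=> t1; have Dt := si_domZ sP t%:C%C De.
  have sqt zeta : dom zeta -> sqn form (t%:C%C *: zeta) = t ^+ 2 * sqn form zeta.
    by move=> Dz; rewrite (sqnZ sP)// rnormR real_normK ?num_real.
  have ft : gind f (t%:C%C *: eta) = t%:C%C *: gind f eta.
    rewrite -[in LHS](addr0 (t%:C%C *: eta)) gind_lin//.
    rewrite (_ : gind f 0 = 0) ?addr0//.
    by apply/funext => k; apply: fsbig1 => h _; rewrite scaler0.
  have : (sqrte (ind_sqn (gind f (t%:C%C *: eta))) <= e%:E)%E.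
    apply: le_trans opn; apply: ereal_sup_ubound; exists (t%:C%C *: eta) => //.
    split; first exact: dom_full.
    by rewrite (ind_sqn_dom Dt) sqt// -[leRHS]sq1 lee_sqrt ?lee_fin.
  rewrite ft (ind_sqn_dom (si_domZ sP _ Dfe)) sqt// /sqrte lee_fin => H.
  have sq0 : 0 <= t ^+ 2 * sqn form (gind f eta).
    by rewrite mulr_ge0 ?sqr_ge0//; exact: (sqn_ge0 sP).
  rewrite -[leLHS]sqr_sqrtr// ler_pXn2r ?nnegrE ?sqrtr_ge0//.
  exact: le_trans (sqrtr_ge0 _) H.
have q0 := sqn_ge0 sP De; have s0 := sqn_ge0 sP Dfe.
have [qE|qn0] := eqVneq (sqn form eta) 0.
  rewrite qE mulr0 leNgt; apply/negP => sp.
  (* Every multiple of a null vector is in the unit ball; this multiple would give $e^2 + 1 \le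
     e^2$. *)
  have := key (Num.sqrt ((e ^+ 2 + 1) / sqn form (gind f eta))).
  rewrite qE mulr0 ler01 => /(_ isT); rewrite sqr_sqrtr ?divfK ?gt_eqF//.
    by rewrite gerDl ler10.
  by rewrite divr_ge0// addr_ge0// sqr_ge0.
have qp : 0 < sqn form eta by rewrite lt_neqAle eq_sym qn0.
have := key (Num.sqrt (sqn form eta)^-1); rewrite sqr_sqrtr ?invr_ge0//.
by rewrite mulVf// lexx => /(_ isT); rewrite mulrC ler_pdivrMr.
Qed.

End induced_norm.

Lemma eq_op_norm (R : realType) (X : Type) (D D' : set X) (N N' : X -> \bar R)
    (T T' : X -> X) : D = D' -> (forall v, N v = N' v) ->
  (forall v, D v -> T v = T' v) -> op_norm D N T = op_norm D' N' T'.
Proof.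
move=> <- NE TE; have -> : N = N' by apply/funext.
rewrite /op_norm; congr ereal_sup; apply/seteqP; split=> _ [v [Dv Nv] <-].
  by exists v => //; rewrite TE.
by exists v => //; rewrite TE.
Qed.

(** * Regular representations, induced from the trivial subgroup *)

Section regular.
Variables (R : realType) (G : groupoid).
Implicit Types (g h k x y : G) (f xi : G -> R[i]).

Definition reg_ip (v w : R[i]^o) : R[i] := v * Num.conj w.
Definition reg_act (g : G) (v : R[i]^o) : R[i]^o := v.
Definition reg_dom y : set (G -> R[i]^o) :=
  ind_dom y [set y] (fiber_s y) reg_act.
Definition reg_form y : (G -> R[i]^o) -> (G -> R[i]^o) -> R[i] :=
  ind_form reg_ip (fiber_s y).

Lemma reg_ip_si : semi_inner setT reg_ip.
Proof.
split=> //.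
- by move=> c a b d _ _ _; rewrite /reg_ip mulrDl -mulrA.
- by move=> a b _ _; rewrite /reg_ip rmorphM /= conjCK mulrC.
- by move=> a _; rewrite /reg_ip mul_conjC_ge0.
Qed.

Lemma reg_ipE v : complex.Re (reg_ip v v) = rnorm (v : R[i]) ^+ 2.
Proof. by rewrite /reg_ip mulrC conj_mul_rnorm. Qed.

Lemma reg_data y : units G y ->
  ind_data y reg_ip [set y] (fiber_s y) reg_act.
Proof.
move=> uy; have ry := unit_rg uy; have sy := unit_sc uy; split=> //.
- exact: reg_ip_si.
- by move=> _ ->.
- by move=> _ _ -> -> /=; rewrite -{2}sy scK.
- by move=> _ -> /=; rewrite unit_inv.
- move=> k ky; exists k => //; split=> //.
- move=> g k gy ky gk /= E; rewrite -(gmulVl gk) E.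
  by have -> : y = sc g by []; rewrite scK.
Qed.

Lemma l2E y : units G y ->
  l2 y = ind_full (R := R) y reg_ip [set y] (fiber_s y) reg_act.
Proof.
move=> uy; have NE xi : l2norm y xi = sqrte (ind_sqn reg_ip (fiber_s y) xi).
  by congr sqrte; apply: eq_esum => g _; rewrite reg_ipE.
apply/seteqP; split=> xi.
  move=> [xi0 xiN]; split; last by rewrite -NE.
  by split=> [g|g _ gy ->]; [exact: xi0|rewrite -gy scK].
by move=> [[xi0 _] xiN]; split; [exact: xi0|rewrite NE].
Qed.

Lemma reg_deltaE f g k : fiber_finite f ->
  reg_delta f g k = if pselect (sc k = sc g) then f (gmul k (ginv g)) else 0.
Proof.
move=> Ff; rewrite /reg_delta.
pose A := supp_s f (rg g); have fA : finite_set A by case: (Ff (rg g)).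
rewrite -(fsbig_widen A); last 2 first.
- by move=> h [].
- move=> h [hg nA] /=; have [->|fh] := eqVneq (f h) 0; first by rewrite scale0r.
  by case: nA.
rewrite fsbig_finite// fct_sumE -fsbig_finite//.
rewrite (fsbig_widen A (fiber_s (rg g))); last 2 first.
- by move=> h [].
- move=> h [hg nA]; rewrite /= -[LHS]/(f h * (k == _)%:R).
  by have [->|fh] := eqVneq (f h) 0; [rewrite mul0r|case: nA].
case: pselect => [kg|kg] /=; last first.
  apply: fsbig1 => h hg; rewrite -[LHS]/(f h * (k == _)%:R).
  have [ke|_] := eqVneq k (gmul h g); last by rewrite mulr0.
  by case: kg; rewrite ke sc_mul.
rewrite -(fsbig_widen [set gmul k (ginv g)]) ?fsbig_set1.
- by rewrite -[LHS]/(f _ * (k == _)%:R) gmulVr// eqxx mulr1.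
- by move=> _ ->; rewrite /fiber_s /= sc_mulV.
- move=> h [hg /= hn]; rewrite -[LHS]/(f h * (k == _)%:R).
  have [ke|_] := eqVneq k (gmul h g); last by rewrite mulr0.
  by case: hn; rewrite ke gmulKr.
Qed.

(** The substitution $g = h^{-1}k$ turns the sum over the source fibre at [y] into one over the
    range fibre of [k]. *)
Lemma regE y f xi : fiber_finite f -> (forall g, ~ fiber_s y g -> xi g = 0) ->
  reg y f xi = gind f (xi : G -> R[i]^o).
Proof.
move=> Ff xi0; apply/funext => k; rewrite /reg /gind.
have [ky|ky] := pselect (sc k = y); last first.
  rewrite [RHS]fsbig1; last first.
    move=> h hk; rewrite xi0 ?scaler0// /fiber_s /= => E; apply: ky.
    by rewrite -E sc_Vmul.
  apply: fsbig1 => g gy; rewrite reg_deltaE//; case: pselect => [e|_] /=.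
    by case: ky; rewrite e gy.
  by rewrite mulr0.
rewrite (reindex_fsbig (fun h => gmul (ginv h) k) (fiber_r (rg k)) (fiber_s y)).
  apply: eq_fsbigr => h; rewrite inE => hk; rewrite reg_deltaE//.
  case: pselect => [_|[]] /=; last by rewrite sc_Vmul.
  rewrite ginv_Vmul// gmulVl// mulrC//.
split.
- by move=> h hk; rewrite /fiber_s /= sc_Vmul.
- move=> h h'; rewrite !inE => hk h'k /gmulIr.
  move=> /(_ (composable_inv_l hk) (composable_inv_l h'k)).
  by move=> /(congr1 (@ginv G)); rewrite !ginvK.
- move=> g gy; have kg : sc k = sc g by rewrite ky gy.
  exists (gmul k (ginv g)); first by rewrite /fiber_r /= rg_mulV.
  by rewrite ginv_mulV// gmulVr.
Qed.

Lemma reg_op_normE y f : units G y -> fiber_finite f ->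
  op_norm (l2 y) (l2norm y) (reg y f) =
  op_norm (ind_full (R := R) y reg_ip [set y] (fiber_s y) reg_act)
    (fun xi => sqrte (ind_sqn reg_ip (fiber_s y) xi)) (gind f).
Proof.
move=> uy Ff; apply: eq_op_norm; first exact: l2E.
  by move=> xi; congr sqrte; apply: eq_esum => g _; rewrite reg_ipE.
by move=> xi [xi0 _]; exact: regE.
Qed.

(** For nonnegative [c], a form of $|f|_r \le c$ that mentions finitely supported vectors only. *)
Definition reg_bounded f (c : R) : Prop := forall y, units G y ->
  forall eta, reg_dom y eta ->
  sqn (reg_form y) (gind f eta) <= c ^+ 2 * sqn (reg_form y) eta.

Lemma red_norm_le f (c : R) : fiber_finite f -> 0 <= c -> reg_bounded f c ->
  (red_norm f <= c%:E)%E.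
Proof.
move=> Ff c0 fc; apply: ub_ereal_sup => _ [y uy <-]; rewrite reg_op_normE//.
by apply: (op_norm_le (reg_data uy)) => //; exact: fc.
Qed.

Lemma red_norm_bounded f (c : R) : fiber_finite f -> (red_norm f <= c%:E)%E ->
  reg_bounded f c.
Proof.
move=> Ff fc y uy; apply: (op_norm_ge (reg_data uy)) => //.
apply: le_trans fc; rewrite -reg_op_normE//.
by apply: ereal_sup_ubound; exists y.
Qed.

End regular.

(** * Hilbert spaces, isotropy groups and their induced modules *)

Section hilbert.
Variables (R : realType) (V : hilbert R).
Implicit Types v w : V.

Lemma ip_si : semi_inner setT (fun v w : V => ip V v w).
Proof.
split=> //.
- by move=> c a b d _ _ _; rewrite linearDl linearZl_LR.
- by move=> a b _ _; rewrite hermC expr0 mul1r.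
Qed.

Lemma Re_ip v : complex.Re (ip V v v) = rnorm v ^+ 2.
Proof.
by rewrite ip_norm -[`|v|]ReK_ge0// -rmorphXn.
Qed.

Lemma hnorm_le (T : V -> V) (c : R) : 0 <= c ->
  (forall v, rnorm (T v) ^+ 2 <= c ^+ 2 * rnorm v ^+ 2) ->
  (hnorm T <= c%:E)%E.
Proof.
move=> c0 Tc; apply: ub_ereal_sup => _ [v [_ v1] <-]; rewrite lee_fin.
rewrite -(@ler_pXn2r _ 2)// ?nnegrE ?rnorm_ge0//.
apply: le_trans (Tc v) _; rewrite ler_piMr ?sqr_ge0//.
by rewrite expr_le1// rnorm_ge0.
Qed.

End hilbert.

Section isotropy_groups.
Variables (R : realType) (G : groupoid) (x : G).
Hypothesis ux : units G x.
Local Notation I := (isotropy x).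
Implicit Types (h k : I) (f : I -> R[i]).

Lemma val_rg h : rg (val h) = x.
Proof. by have := valP h; rewrite inE => -[]. Qed.

Lemma val_sc h : sc (val h) = x.
Proof. by have := valP h; rewrite inE => -[]. Qed.

Lemma iso_rg h : val (rg h) = x.
Proof. by rewrite /rg val_red_rg val_rg. Qed.

Lemma iso_sc h : val (sc h) = x.
Proof. by rewrite /sc val_red_sc val_sc. Qed.

Lemma iso_composable h k : composable h k.
Proof. by apply: val_inj; rewrite iso_rg iso_sc. Qed.

Lemma iso_composable_val h k : composable (val h) (val k).
Proof. by rewrite /composable val_rg val_sc. Qed.

Lemma val_gmul h k : val (gmul h k) = gmul (val h) (val k).
Proof. by apply: val_red_mul; exact: iso_composable_val. Qed.

Lemma val_ginv h : val (ginv h) = ginv (val h).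
Proof. by []. Qed.

Lemma iso_fiber_r h k : fiber_r (rg h) k.
Proof. by apply: val_inj; rewrite !iso_rg. Qed.

Definition iso_lift (c : G) (p : red_arrows [set x] c) : I := SigSub (mem_set p).

Lemma convol_delta h k : convol (delta R h) (delta R k) = delta R (gmul h k).
Proof.
apply/funext => g; rewrite convolE (@gind_single _ _ _ _ _ _ h).
- rewrite {1}/delta eqxx scale1r /delta; congr ((nat_of_bool _)%:R).
  have hg : rg h = rg g by exact: iso_fiber_r.
  by apply/eqP/eqP => [<-|->]; [rewrite gmulVl|rewrite gmulKl//; exact: iso_composable].
- exact: iso_fiber_r.
- by move=> g' _ /eqP g'h; rewrite /delta (negbTE g'h).
Qed.

Lemma invol_delta h : invol (delta R h) = delta R (ginv h).
Proof.
apply/funext => g; rewrite /invol /delta rmorph_nat; congr ((nat_of_bool _)%:R).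
by apply/eqP/eqP => [<-|->]; rewrite ginvK.
Qed.

(** All elements of the isotropy group have range [x], so a bisection around one of them contains no
    other. *)
Lemma iso_open1 h : lc_etale G -> open [set h].
Proof.
move=> GE; have [U [[oU ir _] Uh _]] := bisection_nbhs GE (@filterT _ (nbhs (val h)) _).
rewrite (_ : [set h] = set_val @^-1` U); last first.
  apply/seteqP; split=> [_ -> //|k /= Uk]; apply: val_inj; apply: ir => //.
  by rewrite !val_rg.
by exists U.
Qed.

Lemma Cc_on_delta h : lc_etale G -> Cc_on [set h] (delta R h).
Proof.
move=> GE; have o1 := iso_open1 h GE; apply/(Cc_onP _ o1); split.
  move=> p /= ->; apply: (@cont_at_near R I (delta R h) (fun=> 1) h); last first.
    exact: (@cvg_cst (R[i]^o) (1 : R[i]^o) I (nbhs h) _).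
  have : nbhs h [set h] by exact: open_nbhs_nbhs.
  by apply: filterS => _ ->; rewrite /delta eqxx.
exists [set h]; split=> //; first exact: compact_set1.
by move=> g /eqP gh; rewrite /delta (negbTE gh).
Qed.

Lemma Cc_delta h : lc_etale G -> Cc (delta R h).
Proof.
move=> GE; apply: (Cc_of_on (iso_open1 h GE)); last exact: Cc_on_delta.
by move=> p q -> ->.
Qed.

Lemma full_norm0 (H : groupoid) : (full_norm (0%R : H -> R[i]) <= 0)%E.
Proof.
apply: ub_ereal_sup => _ [V [pi [P ->]]].
apply: ub_ereal_sup => _ [v _ <-]; rewrite (_ : pi 0 v = 0).
  by rewrite /rnorm normr0.
have C0 := @Cc0 R H; have := repP P (-1) v C0 C0.
by rewrite scaler0 addr0 => ->; rewrite scaleN1r addNr.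
Qed.

Lemma in_Cstar_dom (H : groupoid) (f : H -> R[i]) : Cc f ->
  sa_dom (in_Cstar f).
Proof.
move=> Cf; split=> // e e0; exists 0%N => m n _ _; rewrite subrr.
by apply: le_lt_trans (full_norm0 H) _; rewrite lte_fin.
Qed.

End isotropy_groups.

Section induced_instance.
Variables (R : realType) (G : groupoid).
Hypothesis GE : lc_etale G.
Variables (x : G) (ux : units G x) (V : hilbert R).
Variable rho : Cstar R (isotropy x) -> V -> V.
Hypothesis P : representation rho.
Implicit Types (g h k : G) (v w : V) (xi : G -> V) (f : G -> R[i]).

Definition iso_set : set G := red_arrows [set x].

(** Extended by 0 off the isotropy group, so that the group can be treated as a subset of [G] rather
    than as a subtype. *)
Definition iso_act (c : G) (v : V) : V :=
  match pselect (red_arrows [set x] c) with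
  | left p => rho (in_Cstar (delta R (iso_lift p))) v
  | right _ => 0
  end.

(** The very representatives selected in [ind_norm], so that both norms sum over the same points. *)
Definition iso_reps : set G := xget x @` @cosets G x.

Lemma iso_set_val (h : isotropy x) : iso_set (val h).
Proof. by split; rewrite /= ?val_rg ?val_sc. Qed.

Lemma iso_actE (h : isotropy x) v :
  iso_act (val h) v = rho (in_Cstar (delta R h)) v.
Proof.
rewrite /iso_act; case: pselect => [p|[]].
  by congr (rho (in_Cstar (delta R _)) v); exact: val_inj.
by split; rewrite /= ?val_rg ?val_sc.
Qed.

Lemma iso_valP c : iso_set c -> exists h : isotropy x, c = val h.
Proof. by move=> p; exists (iso_lift p). Qed.

Lemma delta_dom (h : isotropy x) : sa_dom (in_Cstar (delta R h)).
Proof. by apply: in_Cstar_dom; exact: Cc_delta. Qed.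

Lemma unitary_starE (h : isotropy x) v :
  rho (unitary_star R h) v = iso_act (ginv (val h)) v.
Proof.
rewrite -[ginv (val h)]/(val (ginv h)) iso_actE; congr (rho _ v).
by apply/funext => n; exact: invol_delta.
Qed.

Lemma xget_coset c : cosets x c -> c (xget x c).
Proof.
move=> [g gx <-]; apply: xgetPex.
exists (gmul g (val (iso_lift (c := x) (conj (unit_rg ux) (unit_sc ux))))).
by eexists.
Qed.

Lemma coset_mem g (gx : fiber_s x g) k :
  [set gmul g (incl_isotropy h) | h in [set: isotropy x]] k <->
  [/\ sc k = x, rg k = rg g & iso_set (gmul (ginv g) k)].
Proof.
split=> [[h _ <-]|[kx kg p]].
  have gh : composable g (val h) by rewrite /composable val_rg.
  rewrite /incl_isotropy; split.
  - by rewrite sc_mul// val_sc.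
  - by rewrite rg_mul.
  - by rewrite gmulKl//; split; rewrite /= ?val_rg ?val_sc.
exists (iso_lift p) => //; rewrite /incl_isotropy.
by rewrite -[set_val _]/(gmul (ginv g) k) gmulVl.
Qed.

Lemma iso_data :
  ind_data x (fun v w : V => ip V v w) iso_set iso_reps iso_act.
Proof.
split.
- exact: ip_si.
- by move=> c [].
- by split; [exact: unit_rg|exact: unit_sc].
- move=> _ _ /iso_valP[h ->] /iso_valP[k ->].
  by rewrite -val_gmul; exact: iso_set_val.
- move=> _ /iso_valP[h ->].
  by rewrite -val_ginv; exact: iso_set_val.
- move=> _ t v w /iso_valP[h ->]; rewrite !iso_actE.
  exact: (rep_linear P (delta_dom h)).
- move=> _ _ v /iso_valP[h ->] /iso_valP[k ->].
  rewrite -val_gmul !iso_actE -(repM P)//; try exact: delta_dom.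
  congr (rho _ v); apply/funext => n; exact/esym/convol_delta.
- move=> _ v w /iso_valP[h ->]; rewrite -val_ginv !iso_actE.
  rewrite (repS P)//; last exact: delta_dom.
  congr (ip V v (rho _ w)); apply/funext => n; exact: invol_delta.
- move=> _ [c cc <-]; have [g gx cE] := cc; have := xget_coset cc.
  by rewrite -{1}cE => /(coset_mem gx)[].
- move=> k kx; pose c := [set gmul k (incl_isotropy h) | h in [set: isotropy x]].
  have cc : cosets x c by exists k.
  have /(coset_mem kx)[cx ck p] := xget_coset cc.
  exists (xget x c); first by exists c.
  split=> //; have kc : rg k = rg (xget x c) by [].
  rewrite -ginv_Vmul//; case: p => p1 p2; split.
    by rewrite /= rg_inv.
  by rewrite /= sc_inv.
- move=> _ _ [c cc <-] [d dd <-] gk p.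
  have [g gx cE] := cc; have [k kx dE] := dd.
  have := xget_coset cc; rewrite -{1}cE => /(coset_mem gx)[cx cg p1].
  have := xget_coset dd; rewrite -{1}dE => /(coset_mem kx)[dx dk p2].
  suff -> : c = d by [].
  have mem_rg j l : sc j = x -> sc l = x -> rg j = rg l ->
      iso_set (gmul (ginv j) l).
    by move=> jx lx jl; split; rewrite /= ?rg_Vmul ?sc_Vmul.
  rewrite -cE -dE; apply/seteqP; split=> j.
    move=> /(coset_mem gx)[jx jg _]; apply/(coset_mem kx); split=> //.
      by rewrite jg -cg gk dk.
    by apply: mem_rg => //; rewrite jg -cg gk dk.
  move=> /(coset_mem kx)[jx jk _]; apply/(coset_mem gx); split=> //.
    by rewrite jk -dk -gk cg.
  by apply: mem_rg => //; rewrite jk -dk -gk cg.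
Qed.

Lemma xget_coset_inj : set_inj (@cosets G x) (xget x).
Proof.
move=> c d; rewrite !inE => cc dd E.
have [g gx cE] := cc; have [k kx dE] := dd.
have := xget_coset cc; rewrite -{1}cE => /(coset_mem gx)[cx cg p1].
have := xget_coset dd; rewrite -{1}dE -E => /(coset_mem kx)[dx dk p2].
have mem_rg j l : sc j = x -> sc l = x -> rg j = rg l ->
    iso_set (gmul (ginv j) l).
  by move=> jx lx jl; split; rewrite /= ?rg_Vmul ?sc_Vmul.
rewrite -cE -dE; apply/seteqP; split=> j.
  move=> /(coset_mem gx)[jx jg _]; apply/(coset_mem kx); split=> //.
    by rewrite jg -cg dk.
  by apply: mem_rg => //; rewrite jg -cg dk.
move=> /(coset_mem kx)[jx jk _]; apply/(coset_mem gx); split=> //.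
  by rewrite jk -dk cg.
by apply: mem_rg => //; rewrite jk -dk cg.
Qed.

Local Notation hip := (fun v w : V => ip V v w).
Definition iso_dom : set (G -> V) := ind_dom x iso_set iso_reps iso_act.
Definition iso_form : (G -> V) -> (G -> V) -> R[i] := ind_form hip iso_reps.

Lemma ind_normE xi : ind_norm x xi = sqrte (ind_sqn hip iso_reps xi).
Proof.
congr sqrte; rewrite /ind_sqn (reindex_esum (@cosets G x) _ (xget x)).
  by apply: eq_esum => c _; rewrite /= Re_ip.
by split; [move=> c cc; exists c|exact: xget_coset_inj|].
Qed.

Lemma ind_spaceE :
  ind_space rho = ind_full (R := R) x hip iso_set iso_reps iso_act.
Proof.
apply/seteqP; split=> xi.
  move=> [xi0 xiG xiN]; split; last by rewrite -ind_normE.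
  split=> [g gx|g _ gx /iso_valP[h ->]]; first exact: xi0.
  by rewrite -unitary_starE; exact: xiG.
move=> [[xi0 xiG] xiN]; split; last by rewrite ind_normE.
  by move=> g gx; exact: xi0.
move=> g h gx; rewrite unitary_starE /incl_isotropy.
rewrite -[LHS]/(xi (gmul g (val h))) xiG//.
by split; rewrite /= ?val_rg ?val_sc.
Qed.

Lemma ind_op_normE f :
  op_norm (ind_space rho) (@ind_norm R G x V) (@ind R G V f) =
  op_norm (ind_full (R := R) x hip iso_set iso_reps iso_act)
    (fun xi => sqrte (ind_sqn hip iso_reps xi)) (gind f).
Proof.
by apply: eq_op_norm => //; [exact: ind_spaceE|exact: ind_normE].
Qed.

Lemma iso_prerep : prerep iso_dom iso_form (fun f xi => gind f xi).
Proof. exact: (ind_prerep iso_data GE). Qed.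

Definition ind_bounded f (c : R) : Prop := forall eta, iso_dom eta ->
  sqn iso_form (gind f eta) <= c ^+ 2 * sqn iso_form eta.

Lemma op_norm_ind_le f (c : R) : Cc f -> 0 <= c -> ind_bounded f c ->
  (op_norm (ind_space rho) (@ind_norm R G x V) (@ind R G V f) <= c%:E)%E.
Proof.
move=> Cf c0 fc; rewrite ind_op_normE; apply: (op_norm_le iso_data) => //.
exact: (Cc_fiber_finite GE).
Qed.

Lemma op_norm_ind_bounded f (c : R) : Cc f ->
  (op_norm (ind_space rho) (@ind_norm R G x V) (@ind R G V f) <= c%:E)%E ->
  ind_bounded f c.
Proof.
move=> Cf; rewrite ind_op_normE; apply: (op_norm_ge iso_data).
exact: (Cc_fiber_finite GE).
Qed.

Lemma op_norm_ind_ge0 f :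
  (0 <= op_norm (ind_space rho) (@ind_norm R G x V) (@ind R G V f))%E.
Proof.
apply: (@le_trans _ _ (ind_norm x (ind f (0 : G -> V)))); first exact: sqrte_ge0.
apply: ereal_sup_ubound; exists 0 => //; split.
  rewrite ind_spaceE; apply: (dom_full iso_data); exact: (ind_dom0 iso_data).
rewrite ind_normE (ind_sqn_dom iso_data); last exact: (ind_dom0 iso_data).
by rewrite (sqn0 (ind_form_si iso_data)) sqrte0.
Qed.

End induced_instance.

Lemma cvge0_le (R : realType) (N : nat -> \bar R) (e : R) : 0 < e ->
  N n @[n --> \oo] --> 0%E -> exists m, forall n, (m <= n)%N -> (N n <= e%:E)%E.
Proof.
move=> e0 N0; have : nbhs (0%E : \bar R) [set z | (z <= e%:E)%E].
  exists e => //= r; rewrite /ball /= sub0r normrN => re.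
  by rewrite lee_fin ltW// (le_lt_trans (ler_norm r)).
by move=> /N0[m _ mP]; exists m => n mn; exact: mP.
Qed.

Lemma le_cvge0 (R : realType) (N : nat -> \bar R) : (forall n, (0 <= N n)%E) ->
  (forall e : R, 0 < e -> exists m, forall n, (m <= n)%N -> (N n <= e%:E)%E) ->
  N n @[n --> \oo] --> 0%E.
Proof.
move=> N0 Ne A [e /= e0 eA]; have e20 : 0 < e / 2 by rewrite divr_gt0.
have [m mP] := Ne _ e20; exists m => // n /mP Nn; have := N0 n.
move: Nn; rewrite /=; case: (N n) => [r| |] //; rewrite !lee_fin => re r0.
apply: eA; rewrite /ball /= sub0r normrN ger0_norm//.
by apply: le_lt_trans re _; lra.
Qed.

(** * Factoring through the reduced algebra as a norm estimate *)

Section factors.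
Variables (R : realType) (G : groupoid).
Hypothesis GE : lc_etale G.
Implicit Types (f : G -> R[i]) (y : G).

Lemma rep_prerep (V : hilbert R) (pi : Cc_alg R G -> V -> V) :
  representation pi -> prerep setT (fun v w : V => ip V v w) pi.
Proof.
move=> P; split.
- exact: ip_si.
- by [].
- by move=> c f f' v Cf Cf' _; exact: (repP P).
- by move=> f c v w Cf _ _; exact: (rep_linear P Cf).
- by move=> f f' v Cf Cf' _; exact: (repM P).
- by move=> f v w Cf _ _; exact: (repS P).
Qed.

Lemma reg_prerep y : units G y ->
  prerep (reg_dom y) (reg_form y) (fun f (xi : G -> R[i]^o) => gind f xi).
Proof. by move=> uy; exact: (ind_prerep (reg_data R uy) GE). Qed.

Lemma full_norm_bpoly_le f (p : {poly R}) (M e : R) : Cc f -> 0 < M -> 0 <= e ->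
  (forall (E : lmodType R[i]) (D : set E) s (pi : (G -> R[i]) -> E -> E),
    prerep D s pi -> forall a, D a -> sqn s (pi f a) <= M * sqn s a) ->
  (forall t, 0 <= t <= M -> `|t * p.[t]| <= e) ->
  (full_norm (bpoly f p) <= e%:E)%E.
Proof.
move=> Cf M0 e0 fM pe; apply: ub_ereal_sup => _ [V [pi [P ->]]].
have PP := rep_prerep P.
apply: hnorm_le => // v; rewrite -!Re_ip.
exact: (bpoly_le GE PP Cf M0 (fM _ _ _ _ PP) I pe).
Qed.

Lemma red_norm_bpoly_le f (p : {poly R}) (c M e : R) : Cc f -> 0 < M -> 0 <= e ->
  c ^+ 2 <= M -> reg_bounded f c ->
  (forall t, 0 <= t <= M -> `|t * p.[t]| <= e) ->
  (red_norm (bpoly f p) <= e%:E)%E.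
Proof.
move=> Cf M0 e0 cM fc pe.
apply: red_norm_le => //; first by apply: (Cc_fiber_finite GE); exact: bpoly_Cc.
move=> y uy eta De; have PP := reg_prerep uy.
apply: (bpoly_le GE PP Cf M0 _ De pe) => a Da.
apply: le_trans (fc y uy a Da) _; rewrite ler_wpM2r//.
exact: (sqn_ge0 (pr_si PP)).
Qed.

Section one_rep.
Variables (x : G) (ux : units G x) (V : hilbert R).
Variable rho : Cstar R (isotropy x) -> V -> V.
Hypothesis P : representation rho.

(** The easy direction: the estimate is applied to each term of a sequence representing an element
    of the kernel. *)
Lemma bounded_factors :
  (forall f c, Cc f -> 0 <= c -> reg_bounded f c -> ind_bounded rho f c) ->
  ind_factors_through_reduced rho.
Proof.
move=> H v [[Cv _] v0]; apply: le_cvge0 => [n|e e0].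
  exact: (op_norm_ind_ge0 GE ux P).
have [m mP] := cvge0_le e0 v0; exists m => n mn.
apply: (op_norm_ind_le GE ux P) => //; first exact: ltW.
apply: H => //; first exact: ltW.
by apply: red_norm_bounded; [exact: (Cc_fiber_finite GE)|exact: mP].
Qed.

(* Apply polynomials in f^* f converging uniformly to t |-> t (t - c^2)_+ : they
   form a Cauchy sequence in the full norm which tends to 0 in the reduced norm. *)
Lemma factors_bounded f c : Cc f -> 0 <= c -> reg_bounded f c ->
  ind_factors_through_reduced rho -> ind_bounded rho f c.
Proof.
move=> Cf c0 fc Hfac.
have [M' M'0 fM'] := prerep_bounded GE Cf.
(* [M'] bounds [f] in every action at once. The added terms make [M] positive and put $[0, c^2 + 1]$
   inside $[0, M]$, where the approximants are controlled. *)
pose M := M' + c ^+ 2 + 1.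
have c20 : 0 <= c ^+ 2 by rewrite sqr_ge0.
have M0 : 0 < M by rewrite /M; lra.
have fM (E : lmodType R[i]) (D : set E) s (pi : (G -> R[i]) -> E -> E) :
    prerep D s pi -> forall a, D a -> sqn s (pi f a) <= M * sqn s a.
  move=> PP a Da; apply: le_trans (fM' _ _ _ _ PP a Da) _.
  by rewrite ler_wpM2r ?(sqn_ge0 (pr_si PP))// /M; lra.
pose e (n : nat) : R := n.+1%:R^-1.
have e_gt0 n : 0 < e n by rewrite invr_gt0 ltr0n.
have e_small d : 0 < d -> exists m, forall n, (m <= n)%N -> e n <= d.
  move=> d0; exists (Num.truncn d^-1) => n mn.
  rewrite /e -[d]invrK lef_pV2 ?posrE ?invr_gt0 ?ltr0n//.
  apply: ltW; apply: lt_le_trans (truncnS_gt _) _.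
  by rewrite ler_nat ltnS.
have /choice[q qP] : forall n, exists p : {poly R},
    forall t, 0 <= t <= M -> `|p.[t] - Num.max 0 (t - c ^+ 2)| <= e n.
  by move=> n; apply: pos_part_poly => //; exact: ltW.
have tq n t : 0 <= t <= M ->
    `|t * (q n).[t] - t * Num.max 0 (t - c ^+ 2)| <= M * e n.
  move=> tM; rewrite -mulrBr normrM; case/andP: (tM) => t0 tM'.
  by rewrite ger0_norm// ler_pM ?normr_ge0//; exact: qP.
pose v n := bpoly f (q n).
have Cv n : Cc (v n) by exact: bpoly_Cc.
have kerv : ker_red (v : Cstar R G).
  split; first split=> // d d0.
    (* Each of two approximants is within $Me \le d/4$ of $t(t - c^2)_+$, so they differ by at most
       $d/2$, strictly less than [d]. *)
    have d0' : 0 < d / (4 * M) by rewrite divr_gt0// mulr_gt0.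
    have [m mP] := e_small _ d0'; exists m => k n mk mn.
    rewrite /v bpolyB; apply: le_lt_trans (_ : ((d / 2)%:E < d%:E)%E); last first.
      by rewrite lte_fin; lra.
    apply: (full_norm_bpoly_le Cf M0 _ fM); first lra.
    move=> t tM; rewrite hornerD hornerN mulrBr.
    have -> : t * (q k).[t] - t * (q n).[t] =
        (t * (q k).[t] - t * Num.max 0 (t - c ^+ 2)) -
        (t * (q n).[t] - t * Num.max 0 (t - c ^+ 2)) by lra.
    apply: le_trans (ler_normB _ _) _.
    have := tq k t tM; have := tq n t tM.
    have em j : (m <= j)%N -> M * e j <= d / 4.
      move=> /mP; rewrite ler_pdivlMr ?mulr_gt0//; lra.
    have := em k mk; have := em n mn; lra.
  apply: le_cvge0 => [n|d d0].
    have Fv := Cc_fiber_finite GE (Cv n).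
    apply: le_trans (_ : (op_norm (l2 x) (l2norm x) (reg x (v n)) <= _)%E).
      rewrite (reg_op_normE ux Fv).
      have D0 := ind_dom0 (reg_data R ux).
      apply: (@le_trans _ _ (sqrte (ind_sqn (@reg_ip R) (fiber_s x)
         (gind (v n) (0 : G -> R[i]^o))))); first exact: sqrte_ge0.
      apply: ereal_sup_ubound; exists 0 => //.
      split; first exact: (dom_full (reg_data R ux)).
      rewrite (ind_sqn_dom (reg_data R ux) D0).
      by rewrite (sqn0 (ind_form_si (reg_data R ux))) sqrte0.
    by apply: ereal_sup_ubound; exists x.
  have d0' : 0 < d / (2 * (c ^+ 2 + 1)) by rewrite divr_gt0//; lra.
  have [m mP] := e_small _ d0'; exists m => n mn.
  have en1 : e n <= 1 by rewrite /e invf_le1 ?ltr0n// ler1n.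
  have en0 := e_gt0 n.
  (* In the reduced norm only $[0, c^2]$ matters; adding [e n] keeps the interval nondegenerate when
     [c = 0]. On it the positive part is at most [e n], so the approximant is at most [2 * e n]. *)
  have M1 : 0 < c ^+ 2 + e n by lra.
  apply: (red_norm_bpoly_le Cf M1 (ltW d0) _ fc); first lra.
  move=> t /andP[t0 tc]; have tM : 0 <= t <= M by rewrite t0 /M; lra.
  rewrite normrM (ger0_norm t0).
  have q1 : `|(q n).[t]| <= 2 * e n.
    have mx : `|Num.max 0 (t - c ^+ 2)| <= e n.
      rewrite ger0_norm; last by rewrite le_max lexx.
      by rewrite ge_max ltW//=; lra.
    rewrite -[(q n).[t]](subrK (Num.max 0 (t - c ^+ 2))).
    apply: le_trans (ler_normD _ _) _; have := qP n t tM; lra.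
  apply: le_trans (_ : (c ^+ 2 + 1) * (2 * e n) <= _).
    by apply: ler_pM => //; lra.
  have := mP n mn; rewrite ler_pdivlMr; lra.
have van := Hfac v kerv.
move=> xi Dxi; pose s := @iso_form R G x V; rewrite -/s.
have PP : prerep (iso_dom rho) s (fun f xi => gind f xi) := iso_prerep GE ux P.
have sP : semi_inner (iso_dom rho) s := pr_si PP.
pose B := convol (invol f) f.
have CB : Cc B by exact: starsq_Cc.
have DB : iso_dom rho (gind B xi) by exact: (pr_dom PP).
have Df : iso_dom rho (gind f xi) by exact: (pr_dom PP).
have x0 := sqn_ge0 sP Dxi; have f0 := sqn_ge0 sP Df; have B0 := sqn_ge0 sP DB.
(* Since the operators of [v n] tend to 0 in norm, the lower bound of [bpoly_ge] leaves only an
   arbitrarily small error; what remains is the scalar argument that ends [prerep_bounded]. *)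
have key (d : R) : 0 < d -> sqn s (gind B xi) - c ^+ 2 * sqn s (gind f xi) <=
    d * sqn s xi.
  move=> d0; have d1 : 0 < d / 2 by lra.
  have d2 : 0 < d / (2 * M) by rewrite divr_gt0// mulr_gt0.
  have [m1 m1P] := cvge0_le d1 van; have [m2 m2P] := e_small _ d2.
  pose n := maxn m1 m2.
  have bnd := op_norm_ind_bounded GE ux P (Cv n) (m1P n (leq_maxl _ _)).
  have {}m2P := m2P n (leq_maxr _ _).
  have := bpoly_ge GE PP Cf M0 (fM _ _ _ _ PP) (p := q n) (c := c ^+ 2) (e := M * e n) Dxi.
  have Hq t : 0 <= t <= M -> t * (t - c ^+ 2) - M * e n <= t * (q n).[t].
    move=> tM; have := tq n t tM; rewrite ler_norml => /andP[H _].
    have t0 : 0 <= t by case/andP: tM.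
    have : t * (t - c ^+ 2) <= t * Num.max 0 (t - c ^+ 2).
      by rewrite ler_wpM2l// le_max lexx orbT.
    lra.
  move=> /(_ Hq); rewrite -/B -/(v n) => H.
  have Dv : iso_dom rho (gind (v n) xi) by exact: (pr_dom PP).
  have cs := cauchy_schwarz_Re sP Dv Dxi.
  have vb := bnd xi Dxi.
  have re : complex.Re (s (gind (v n) xi) xi) <= d / 2 * sqn s xi.
    apply: le_trans (ler_norm _) _.
    rewrite -(@ler_pXn2r _ 2)// ?nnegrE ?normr_ge0 ?mulr_ge0//; last lra.
    rewrite real_normK ?num_real//; apply: le_trans cs _.
    by rewrite exprMn [leRHS](_ : _ = (d / 2) ^+ 2 * sqn s xi * sqn s xi) ?ler_wpM2r//; ring.
  have Me : M * e n * sqn s xi <= d / 2 * sqn s xi.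
    rewrite ler_wpM2r//; move: m2P; rewrite ler_pdivlMr ?mulr_gt0//; lra.
  lra.
have Bf : sqn s (gind B xi) <= c ^+ 2 * sqn s (gind f xi).
  rewrite -subr_le0 leNgt; apply/negP => pos.
  set z := _ - _ in pos key; set X := sqn s xi in x0 key.
  (* Chosen so that $z = 2w(X + 1)$ is larger than the bound $wX$ given by [key]. *)
  pose w := z / (2 * (X + 1)); have X1 : 0 < 2 * (X + 1) by lra.
  have w0 : 0 < w by rewrite divr_gt0.
  have zE : z = w * (2 * (X + 1)) by rewrite /w divfK ?gt_eqF.
  have := key w w0; rewrite zE; have : 0 <= w * X by rewrite mulr_ge0// ltW.
  lra.
have f2 : sqn s (gind f xi) ^+ 2 <= sqn s (gind B xi) * sqn s xi.
  have -> : sqn s (gind f xi) = complex.Re (s (gind B xi) xi).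
    by rewrite (prerep_sqn GE PP).
  exact: (cauchy_schwarz_Re sP).
have [->|fn0] := eqVneq (sqn s (gind f xi)) 0; first exact: mulr_ge0.
have fp : 0 < sqn s (gind f xi) by rewrite lt_neqAle eq_sym fn0.
rewrite -(ler_pM2l fp) -expr2; apply: (le_trans f2).
by rewrite mulrA (mulrC (sqn s (gind f xi))) ler_wpM2r.
Qed.

End one_rep.

End factors.

(** * The linking groupoid *)

(** An open embedding of [G] onto the reduction of [T] to [X], stated without the subtype. An
    isomorphism is the case [X = setT], so the lemmas on corners also serve to transport along
    isomorphisms. *)
Record embedding (G T : groupoid) (e : G -> T) (X : set T) : Prop := Embedding {
  em_inj : injective e;
  em_dom : forall g, X (rg (e g)) /\ X (sc (e g));
  em_surj : forall t, X (rg t) -> X (sc t) -> exists g, e g = t;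
  em_composable : forall g h, composable g h <-> composable (e g) (e h);
  em_mul : forall g h, composable g h -> e (gmul g h) = gmul (e g) (e h);
  em_cont : continuous e;
  em_open : forall A, open A -> open (e @` A) }.

Lemma open_units_sub (T : groupoid) (X : set T) : lc_etale T ->
  open (set_val @^-1` X : set (units T)) -> X `<=` units T -> open X.
Proof.
move=> TE [B oB BE] XT; rewrite (_ : X = B `&` units T).
  by apply: openI => //; exact: units_open.
apply/seteqP; split=> t.
  move=> Xt; have ut := XT t Xt; split=> //.
  by have : (set_val @^-1` X) (SigSub (mem_set ut) : units T) by []; rewrite -BE.
move=> [Bt ut].
by have : (set_val @^-1` B) (SigSub (mem_set ut) : units T) by []; rewrite BE.
Qed.

Lemma iso_embedding (G T : groupoid) (X : set T) : lc_etale T ->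
  open (set_val @^-1` X : set (units T)) -> X `<=` units T ->
  groupoid_iso G (reduction X) -> exists e : G -> T, embedding e X.
Proof.
move=> TE oX XT [phi [psi [phiK psiK cphi cpsi hom]]].
have oX' := open_units_sub TE oX XT.
have oR : open (red_arrows X).
  apply: openI; first by apply: open_comp oX' => t _; exact: rg_cvg.
  by apply: open_comp oX' => t _; exact: sc_cvg.
exists (fun g => val (phi g)); split.
- by move=> g h /val_inj /(can_inj phiK).
- by move=> g; have := valP (phi g); rewrite inE.
- move=> t Xr Xs; have Rt : red_arrows X t by [].
  by exists (psi (SigSub (mem_set Rt) : reduction X)); rewrite psiK.
- move=> g h; have [-> _] := hom g h; split.
    exact: red_composable.
  by move=> c; apply: val_inj; rewrite /sc /rg val_red_sc val_red_rg.
- move=> g h c; have [cphi' /(_ c) ->] := hom g h.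
  by rewrite val_red_mul//; apply: red_composable; exact: cphi'.1.
- move=> g; apply: (cvg_comp _ _ (cphi g)).
  exact: (@initial_continuous (red_arrows X) T set_val).
- move=> A oA; have : open (psi @^-1` A) by apply: open_comp oA => t _; exact: cpsi.
  move=> [B oB BE]; rewrite (_ : _ @` A = B `&` red_arrows X).
    exact: openI.
  apply/seteqP; split=> t.
    move=> [g Ag <-]; split; last by have := valP (phi g); rewrite inE.
    have H : (psi @^-1` A) (phi g) by rewrite /= phiK.
    by move: H; rewrite -BE.
  move=> [Bt Rt]; have : (set_val @^-1` B) (SigSub (mem_set Rt) : red_arrows X) by [].
  by rewrite BE => At; eexists; [exact: At|rewrite psiK].
Qed.

Section embedding_theory.
Variables (R : realType) (G T : groupoid) (e : G -> T) (X : set T).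
Hypotheses (GE : lc_etale G) (TE : lc_etale T) (em : embedding e X).
Implicit Types (g h : G) (t k : T) (f : G -> R[i]).

Lemma em_rg g : e (rg g) = rg (e g).
Proof.
have c1 : composable (rg g) (rg g) by rewrite /composable sc_rg rg_rg.
have c2 := (em_composable em _ _).1 c1.
have rr : gmul (rg g) (rg g) = rg g by rewrite -{1}(rg_rg g) rgK.
have eu : gmul (e (rg g)) (e (rg g)) = e (rg g) by rewrite -(em_mul em c1) rr.
have su : sc (e (rg g)) = e (rg g) by have := gmulKl c2; rewrite eu.
have c3 : composable (rg g) g by rewrite /composable sc_rg.
by have := (em_composable em _ _).1 c3; rewrite /composable su.
Qed.

Lemma em_inv g : e (ginv g) = ginv (e g).
Proof.
have c : composable g (ginv g) by exact: composable_inv_r.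
apply: (gmulI ((em_composable em _ _).1 c)); first exact: composable_inv_r.
by rewrite -(em_mul em c) -/(rg g) em_rg.
Qed.

Lemma em_sc g : e (sc g) = sc (e g).
Proof. by rewrite -!rg_inv em_rg em_inv. Qed.

Lemma em_units x : units G x -> units T (e x).
Proof. by move=> [g ->]; rewrite em_rg; exact: rg_unit. Qed.

Lemma em_units_ex t : units T t -> X t -> exists2 x, units G x & e x = t.
Proof.
move=> ut Xt; have [||g gt] := em_surj em (t := t).
- by rewrite (unit_rg ut).
- by rewrite (unit_sc ut).
exists g => //; rewrite -(em_inj em (_ : e (rg g) = e g)); first exact: rg_unit.
by rewrite em_rg gt unit_rg.
Qed.

Definition ext f : T -> R[i] := fun t =>
  match pselect (exists g, e g = t) with
  | left p => f (projT1 (cid p))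
  | right _ => 0
  end.

Lemma extE f g : ext f (e g) = f g.
Proof.
rewrite /ext; case: pselect => [p|[]]; last by exists g.
by case: cid => h /= /(em_inj em) ->.
Qed.

Lemma ext_out f t : (forall g, e g <> t) -> ext f t = 0.
Proof.
by move=> n; rewrite /ext; case: pselect => [[g gt]|] //; case: (n g gt).
Qed.

Lemma em_bisection U : bisection U -> bisection (e @` U).
Proof.
move=> [oU ir is_]; split; first exact: (em_open em).
- move=> _ _ [a Ua <-] [b Ub <-]; rewrite -!em_rg => /(em_inj em) ab.
  by rewrite (ir a b).
- move=> _ _ [a Ua <-] [b Ub <-]; rewrite -!em_sc => /(em_inj em) ab.
  by rewrite (is_ a b).
Qed.

Lemma Cc_ext f : Cc f -> Cc (ext f).
Proof.
move: f; apply: (Cc_ind GE).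
- rewrite (_ : ext 0 = 0); first exact: Cc0.
  apply/funext => t; have [[g <-]|n] := pselect (exists g, e g = t).
    by rewrite extE.
  by rewrite ext_out// => g gt; apply: n; exists g.
- move=> c f f' _ _ Cf Cf'; rewrite (_ : ext _ = c *: ext f + ext f').
    exact: Cc_lin.
  apply/funext => t; rewrite -[RHS]/(c * ext f t + ext f' t).
  have [[g <-]|n] := pselect (exists g, e g = t); first by rewrite !extE.
  by rewrite !ext_out ?mulr0 ?addr0// => g gt; apply: n; exists g.
move=> U f bU fU; have bV := em_bisection bU.
have [oU _ _] := bU; have [oV _ _] := bV.
apply: (Cc_bisection TE bV); apply/(Cc_onP _ oV).
have [cf [K [cK KU K0]]] := (Cc_onP _ oU).1 fU; split.
  move=> _ [p Up <-] A; rewrite extE => fA.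
  have := cf p Up A fA; rewrite /= nbhs_simpl nbhsE => -[W [oW Wp] WA].
  have : nbhs (e p) (e @` W).
    by apply: open_nbhs_nbhs; split; [exact: (em_open em)|exists p].
  by apply: filterS => _ [w /WA Aw <-] /=; rewrite extE.
exists (e @` K); split.
- apply: continuous_compact cK; apply: continuous_subspaceT.
  exact: (em_cont em).
- by move=> _ [g /KU Ug <-]; exists g.
- move=> t nK; have [[g gt]|n] := pselect (exists g, e g = t).
    by rewrite -gt extE K0// => Kg; apply: nK; rewrite -gt; exists g.
  by rewrite ext_out// => g gt; apply: n; exists g.
Qed.

(** Closedness of the image makes its intersection with [K] compact, and openness of [e] carries
    cluster points back. *)
Lemma compact_em_preimage K : closed (red_arrows X) -> compact K ->
  compact (e @^-1` K).
Proof.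
move=> clR cK F FF FK.
have cKR : compact (K `&` red_arrows X) by exact: compact_closedI.
have FKR : (e @ F) (K `&` red_arrows X).
  have sub : e @^-1` K `<=` e @^-1` (K `&` red_arrows X).
    by move=> g Kg; split=> //; exact: (em_dom em g).
  exact: filterS sub FK.
have [t [[Kt [Xr Xs]] clt]] := cKR (e @ F) _ FKR.
have [g gt] := em_surj em Xr Xs; exists g; split; first by rewrite /= gt.
move=> A B FA; rewrite nbhsE => -[W [oW Wg] WB].
have tW : nbhs t (e @` W).
  by rewrite -gt; apply: open_nbhs_nbhs; split; [exact: (em_open em)|exists g].
have FeA : (e @ F) (e @` A).
  have sub : A `<=` e @^-1` (e @` A) by move=> a Aa; exists a.
  exact: filterS sub FA.
have [_ [[a Aa <-] [b Wb /(em_inj em) ab]]] := clt _ _ FeA tW.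
by exists a; split=> //; apply: WB; rewrite -ab.
Qed.

(** This is where the disjoint union being topological enters: restriction to a reduction keeps
    supports compact because the reduction is closed. *)
Lemma Cc_restr (F : T -> R[i]) : closed (red_arrows X) -> Cc F -> Cc (F \o e).
Proof.
move=> clR; move: F; apply: (Cc_ind TE).
- by rewrite (_ : _ \o _ = 0)//; exact: Cc0.
- by move=> c f f' _ _ Cf Cf'; exact: (Cc_lin c Cf Cf').
move=> U F [oU ir is_] FU.
have oV : open (e @^-1` U) by apply: open_comp oU => g _; exact: (em_cont em).
have bV : bisection (e @^-1` U).
  split=> //.
  - move=> a b Ua Ub ab; apply: (em_inj em); apply: ir => //.
    by rewrite -!em_rg ab.
  - move=> a b Ua Ub ab; apply: (em_inj em); apply: is_ => //.
    by rewrite -!em_sc ab.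
apply: (Cc_bisection GE bV); apply/(Cc_onP _ oV).
have [cf [K [cK KU K0]]] := (Cc_onP _ oU).1 FU; split.
  move=> p Up; apply: (cvg_comp _ _ (em_cont em (x := p))).
  exact: (cf (e p) Up).
exists (e @^-1` K); split; first exact: compact_em_preimage.
- by move=> g /KU.
- by move=> g /K0.
Qed.

Section corner.
Variables (x : G) (t : T).
Hypotheses (ux : units G x) (tx : sc t = e x).

(* Right translation by t identifies the arrows of T from rg t to X with G_x. *)
Definition tr (V : lmodType R[i]) (zeta : T -> V) : G -> V := fun g =>
  if pselect (sc g = x) then zeta (gmul (e g) (ginv t)) else 0.

Lemma trE (V : lmodType R[i]) (zeta : T -> V) g : sc g = x ->
  tr zeta g = zeta (gmul (e g) (ginv t)).
Proof. by rewrite /tr; case: pselect. Qed.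

Lemma tr_composable g : sc g = x -> sc (e g) = sc t.
Proof. by move=> gx; rewrite -em_sc gx tx. Qed.

Lemma gind_tr (V : lmodType R[i]) (phi : T -> R[i]) (zeta : T -> V) g :
  (forall k, ~ X (rg k) -> zeta k = 0) -> sc g = x ->
  gind phi zeta (gmul (e g) (ginv t)) = gind (phi \o e) (tr zeta) g.
Proof.
move=> zX gx; have ct := tr_composable gx; rewrite /gind rg_mulV//.
pose A : set T := [set h | rg h = rg (e g) /\ X (sc h)].
rewrite -(fsbig_widen A); last 2 first.
- by move=> h [].
- move=> h [hg nA] /=; rewrite zX ?scaler0// rg_Vmul; last by rewrite rg_mulV.
  by move=> Xh; apply: nA.
rewrite (reindex_fsbig e (fiber_r (rg g)) A).
  apply: eq_fsbigr => h; rewrite inE => hg; congr (_ *: _).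
  have hgV : composable (ginv h) g by exact: composable_inv_l.
  rewrite trE ?sc_Vmul// (em_mul em hgV) em_inv gmul_assoc//.
    by rewrite /composable sc_inv -!em_rg hg.
  exact: composable_inv_r.
split.
- move=> h hg; split; first by rewrite -!em_rg hg.
  by case: (em_dom em h).
- by move=> h k _ _ /(em_inj em).
- move=> h [hg Xh]; have [|g' g'h] := em_surj em _ Xh.
    by rewrite hg; case: (em_dom em g).
  exists g' => //; apply: (em_inj em).
  by rewrite !em_rg g'h.
Qed.

(** Right translation by [t] is a bijection from the arrows of [G] with source [x] to the arrows of
    [T] from [rg t] into [X]. *)
Lemma sqn_tr (zeta : T -> R[i]^o) :
  (forall k, ~ X (rg k) -> zeta k = 0) ->
  sqn (reg_form (rg t)) zeta = sqn (reg_form x) (tr zeta).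
Proof.
move=> zX; congr complex.Re; rewrite /reg_form /ind_form.
pose A : set T := [set k | sc k = rg t /\ X (rg k)].
rewrite -(fsbig_widen A); last 2 first.
- by move=> k [].
- move=> k [kt nA] /=; rewrite zX ?/reg_ip ?mul0r// => Xk.
  by apply: nA.
rewrite (reindex_fsbig (fun g => gmul (e g) (ginv t)) (fiber_s x) A).
  by apply: eq_fsbigr => g; rewrite inE => gx; rewrite trE.
split.
- move=> g gx; have ct := tr_composable gx; split; first by rewrite sc_mulV.
  by rewrite rg_mulV//; case: (em_dom em g).
- move=> g h; rewrite !inE => gx hx /gmulIr H; apply: (em_inj em); apply: H.
    by apply: composable_inv_r; exact: tr_composable.
  by apply: composable_inv_r; exact: tr_composable.
- move=> k [kt Xk]; have c : composable k t by [].
  have [||g gk] := em_surj em (t := gmul k t).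
  + by rewrite rg_mul.
  + rewrite sc_mul// tx -(unit_sc ux) em_sc.
    by case: (em_dom em x).
  exists g; last by rewrite gk gmulKr.
  by apply: (em_inj em); rewrite em_sc gk sc_mul.
Qed.

Lemma tr_dom (zeta : T -> R[i]^o) : reg_dom (rg t) zeta -> reg_dom x (tr zeta).
Proof.
move=> [_ fin]; split.
  split=> [g gx|g _ gx ->]; first by rewrite /tr; case: pselect.
  by rewrite /reg_act -gx scK.
apply: sub_finite_set (finite_image (fun k => xget x [set g | e g = gmul k t]) fin).
move=> g [/= gx]; rewrite trE// => nz; have ct := tr_composable gx.
exists (gmul (e g) (ginv t)).
  by split=> //; rewrite /fiber_s /= sc_mulV.
rewrite gmulVr//; apply: xget_subset1 => // a b /= <- /(em_inj em).
exact: esym.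
Qed.

End corner.

End embedding_theory.

Lemma gind_rg0 (R : realType) (G : groupoid) (V : lmodType R[i])
    (A : set G) (f : G -> R[i]) (xi : G -> V) k :
  (forall h, f h != 0 -> A (rg h)) -> ~ A (rg k) -> gind f xi k = 0.
Proof.
move=> fA nA; apply: gind_none => h hk; apply/eqP/negP => /negP/fA.
by rewrite hk.
Qed.

Lemma gind_sc0 (R : realType) (G : groupoid) (V : lmodType R[i])
    x (f : G -> R[i]) (xi : G -> V) k :
  (forall h, sc h <> x -> xi h = 0) -> sc k <> x -> gind f xi k = 0.
Proof.
move=> xi0 kx; rewrite /gind fsbig1// => h hk; rewrite xi0 ?scaler0//.
by rewrite sc_Vmul.
Qed.

Lemma tr_gind (R : realType) (G T : groupoid) (e : G -> T) (X : set T)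
    (em : embedding e X) x t (f : T -> R[i]) (zeta : T -> R[i]^o) :
  sc t = e x -> (forall k, ~ X (rg k) -> zeta k = 0) ->
  tr e x t (gind f zeta) = gind (f \o e) (tr e x t zeta).
Proof.
move=> tx zX; apply/funext => g; have [gx|gx] := pselect (sc g = x).
  by rewrite trE// (gind_tr em tx).
rewrite (gind_sc0 (x := x))//; first by rewrite /tr; case: pselect.
by move=> h hx; rewrite /tr; case: pselect.
Qed.

(** * Reduced norms of corners *)

Section corner_bound.
Variables (R : realType) (G H T : groupoid) (e : G -> T) (e' : H -> T).
Variables (X Y : set T).
Hypotheses (GE : lc_etale G) (HE : lc_etale H) (TE : lc_etale T).
Hypotheses (em : embedding e X) (em' : embedding e' Y) (XT : X `<=` units T).
Hypothesis meet : forall z, units T z -> exists t, rg t = z /\ X (sc t).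

Lemma ext_supp (f : G -> R[i]) h : ext e f h != 0 -> X (rg h).
Proof.
have [[g <-] _|n] := pselect (exists g, e g = h); first by case: (em_dom em g).
by rewrite ext_out ?eqxx// => g gh; apply: n; exists g.
Qed.

(** Every orbit of [T] meets [X], so some arrow links [z] to a unit of [G]; translation by it turns
    the regular representation at [z], over [X], into the one at that unit. *)
Lemma sqn_gind_ext (f : G -> R[i]) c z (zeta : T -> R[i]^o) :
  reg_bounded f c -> units T z -> (forall k, ~ X (rg k) -> zeta k = 0) ->
  reg_dom z zeta ->
  sqn (reg_form z) (gind (ext e f) zeta) <= c ^+ 2 * sqn (reg_form z) zeta.
Proof.
move=> fc uz zX; have [t [<- Xt]] := meet uz => Dz.
have [x ux /esym tx] := em_units_ex em (XT Xt) Xt.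
rewrite !(sqn_tr em ux tx)//; last first.
  by move=> k; apply: gind_rg0; exact: ext_supp.
rewrite (tr_gind em)// (_ : ext e f \o e = f).
  exact: (fc _ ux _ (tr_dom em tx Dz)).
by apply/funext => g; rewrite /= (extE em).
Qed.

Definition corner (a : T -> R[i]) (w : G -> R[i]) : H -> R[i] :=
  convol (invol a) (convol (ext e w) a) \o e'.

Lemma Cc_corner a w : closed (red_arrows Y) -> Cc a -> Cc w -> Cc (corner a w).
Proof.
move=> clY Ca Cw; apply: (Cc_restr HE TE em' clY).
apply: (convol_Cc TE); first exact: invol_Cc.
by apply: (convol_Cc TE) => //; exact: (Cc_ext GE TE em).
Qed.

Lemma tr_ext y (eta : H -> R[i]^o) : units H y ->
  (forall h, sc h <> y -> eta h = 0) -> tr e' y (e' y) (ext e' eta) = eta.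
Proof.
move=> uy eta0; apply/funext => h; have [hy|hy] := pselect (sc h = y).
  rewrite trE// unit_inv; last exact: (em_units em').
  rewrite -[in e' y]hy (em_sc em') scK; exact: (extE em').
by rewrite eta0// /tr; case: pselect.
Qed.

Lemma reg_dom_ext y (eta : H -> R[i]^o) : units H y -> reg_dom y eta ->
  reg_dom (e' y) (ext e' eta : T -> R[i]^o).
Proof.
move=> uy [[eta0 _] fin]; split.
  split=> [k ky|g _ gy ->]; last by rewrite /reg_act -gy scK.
  have [[h hk]|n] := pselect (exists h, e' h = k).
    rewrite -hk (extE em') eta0// => hy; apply: ky.
    by rewrite -hk -(em_sc em') hy.
  by rewrite ext_out// => h hk; apply: n; exists h.
apply: sub_finite_set (finite_image e' fin) => k [ky].
have [[h hk]|n] := pselect (exists h, e' h = k).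
  move=> /=; rewrite -hk (extE em') => nz; exists h => //; split=> //.
  by apply: (em_inj em'); rewrite (em_sc em') hk.
by rewrite /= ext_out ?eqxx// => h hk; apply: n; exists h.
Qed.

(** The constant combines the squared bounds of [a] and of its adjoint from [prerep_bounded]. It
    does not involve [w], so one [K] serves all powers later. *)
Lemma corner_bounded a : Cc a -> (forall t, a t != 0 -> X (rg t) /\ Y (sc t)) ->
  exists2 K, 0 <= K & forall w c, Cc w -> 0 <= c -> reg_bounded w c ->
    reg_bounded (corner a w) (K * c).
Proof.
move=> Ca aXY; have CaV := invol_Cc TE Ca.
have [M M0 aM] := prerep_bounded TE Ca; have [N N0 aN] := prerep_bounded TE CaV.
exists (Num.sqrt (N * M)); first exact: sqrtr_ge0.
move=> w c Cw c0 wc y uy eta De.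
have Ce := Cc_ext GE TE em Cw.
have ut := em_units em' uy.
have PP := reg_prerep R TE ut.
pose zeta : T -> R[i]^o := ext e' eta.
have Dz : reg_dom (e' y) zeta by exact: reg_dom_ext.
have ty : sc (e' y) = e' y by exact: unit_sc.
have ry : rg (e' y) = e' y by exact: unit_rg.
have eta0 h : sc h <> y -> eta h = 0 by move: h; exact: De.1.1.
have zY k : ~ Y (rg k) -> zeta k = 0.
  move=> nY; rewrite /zeta ext_out// => h hk; apply: nY; rewrite -hk.
  by case: (em_dom em' h).
pose F := convol (invol a) (convol (ext e w) a).
have FE : gind F zeta = gind (invol a) (gind (ext e w) (gind a zeta)).
  rewrite /F (pr_mul PP CaV _ Dz); last exact: convol_Cc.
  by rewrite (pr_mul PP Ce Ca Dz).
have FY k : ~ Y (rg k) -> gind F zeta k = 0.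
  rewrite FE; apply: gind_rg0 => h; rewrite /invol conjC_eq0 => /aXY[_].
  by rewrite sc_inv.
(* Translation by the unit [e' y] identifies a vector over [H] with its extension by zero, so the
   estimate can be made in [T]. *)
have S := @sqn_tr R _ _ _ _ em' _ _ uy ty.
have := S _ FY; have := S _ zY; rewrite ry.
rewrite (tr_gind em' _ ty zY).
rewrite tr_ext// => <- <-; rewrite FE exprMn sqr_sqrtr ?mulr_ge0//.
have D1 : reg_dom (e' y) (gind a zeta) by exact: (pr_dom PP).
have D2 : reg_dom (e' y) (gind (ext e w) (gind a zeta)) by exact: (pr_dom PP).
apply: le_trans (aN _ _ _ _ PP _ D2) _.
rewrite -[leRHS]mulrA -[leRHS]mulrA ler_wpM2l//.
have aX k : ~ X (rg k) -> gind a zeta k = 0.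
  by apply: gind_rg0 => h /aXY[].
apply: le_trans (sqn_gind_ext wc ut aX D1) _.
rewrite [leRHS]mulrCA ler_wpM2l ?sqr_ge0//.
exact: (aM _ _ _ _ PP _ Dz).
Qed.

End corner_bound.

Lemma iter_convol_Cc (R : realType) (G : groupoid) (GE : lc_etale G)
    (w : G -> R[i]) n : Cc w -> Cc (iter n (convol w) w).
Proof. by move=> Cw; elim: n => //= n IH; exact: convol_Cc. Qed.

Section prerep_powers.
Variables (R : realType) (G : groupoid) (E : lmodType R[i]) (D : set E).
Variables (s : E -> E -> R[i]) (pi : (G -> R[i]) -> E -> E).
Hypotheses (GE : lc_etale G) (P : prerep D s pi).
Let sP := pr_si P.

(** With $b = f^*a$ one has $|b|^4 = \langle fb, a\rangle^2 \le C|b|^2|a|^2$. *)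
Lemma prerep_invol_le f (C : R) : Cc f -> 0 <= C ->
  (forall a, D a -> sqn s (pi f a) <= C * sqn s a) ->
  forall a, D a -> sqn s (pi (invol f) a) <= C * sqn s a.
Proof.
move=> Cf C0 fC a Da; have CfV := invol_Cc GE Cf.
have Db := pr_dom P CfV Da; set b := pi (invol f) a in Db *.
have Dfb := pr_dom P Cf Db.
have Eb : s (pi f b) a = s b b by rewrite (pr_adj P Cf Db Da).
have := cauchy_schwarz_Re sP Dfb Da; rewrite Eb -/(sqn s b) => H.
have [b0|b0] := leP (sqn s b) 0.
  by apply: le_trans b0 _; rewrite mulr_ge0// (sqn_ge0 sP).
rewrite -(ler_pM2l b0) -expr2; apply: le_trans H _.
by rewrite mulrCA mulrA ler_wpM2r ?(sqn_ge0 sP)//; exact: fC.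
Qed.

(** The element [iter n (convol w) w] is $w^{n+1}$: powers start at 1 because $C_c(G)$ may have no
    unit. *)
Lemma prerep_iter w n a : Cc w -> D a ->
  pi (iter n (convol w) w) a = iter n.+1 (pi w) a.
Proof.
move=> Cw Da; elim: n => //= n IH.
by rewrite (pr_mul P Cw _ Da) ?IH//; exact: iter_convol_Cc.
Qed.

Lemma prerep_sum f (I : Type) (r : seq I) (F : I -> E) : Cc f ->
  (forall i, D (F i)) ->
  D (\sum_(i <- r) F i) /\ pi f (\sum_(i <- r) F i) = \sum_(i <- r) pi f (F i).
Proof.
move=> Cf DF; have D0 := si_dom0 sP.
have pi0 : pi f 0 = 0.
  have := pr_lin P (-1) Cf D0 D0.
  by rewrite scaler0 addr0 scaleN1r => ->; rewrite addNr.
elim: r => [|i r [Dr IH]]; first by rewrite !big_nil.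
rewrite !big_cons; split.
  by rewrite -[F i]scale1r; exact: (si_dom sP).
by rewrite -[F i in LHS]scale1r (pr_lin P)// scale1r IH.
Qed.

Lemma sqn_iter_sym (T : E -> E) n a : (forall b, D b -> D (T b)) ->
  (forall b d, D b -> D d -> s (T b) d = s b (T d)) -> D a ->
  sqn s (iter n T a) = complex.Re (s (iter (n + n) T a) a).
Proof.
move=> TD Ts Da; congr complex.Re; rewrite iterD.
have DT m : D (iter m T a) by exact: iter_dom.
have iter_sym m b d : D b -> D d -> s (iter m T b) d = s b (iter m T d).
  elim: m d => //= m IH d Db Dd; rewrite Ts//; last exact: iter_dom.
  by rewrite IH//; [rewrite -iterSr|exact: TD].
by rewrite -iter_sym.
Qed.

End prerep_powers.

Lemma reg_bounded_convol (R : realType) (G : groupoid) (f g : G -> R[i]) c d :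
  lc_etale G -> Cc f -> Cc g -> reg_bounded f c -> reg_bounded g d ->
  reg_bounded (convol f g) (c * d).
Proof.
move=> GE Cf Cg fc gd y uy eta De; have P := reg_prerep R GE uy.
have Dg := pr_dom P Cg De; rewrite (pr_mul P Cf Cg De).
apply: le_trans (fc y uy _ Dg) _.
by rewrite exprMn -[leRHS]mulrA ler_wpM2l ?sqr_ge0//; exact: gd.
Qed.

Lemma reg_bounded_invol (R : realType) (G : groupoid) (f : G -> R[i]) c :
  lc_etale G -> Cc f -> reg_bounded f c -> reg_bounded (invol f) c.
Proof.
move=> GE Cf fc y uy; apply: (prerep_invol_le GE (reg_prerep R GE uy)) => //.
  exact: sqr_ge0.
exact: fc.
Qed.

Lemma reg_bounded_iter (R : realType) (G : groupoid) (w : G -> R[i]) c n :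
  lc_etale G -> Cc w -> reg_bounded w c ->
  reg_bounded (iter n (convol w) w) (c ^+ n.+1).
Proof.
move=> GE Cw wc; elim: n => [|n IH]; first by rewrite expr1.
rewrite /= exprS; apply: reg_bounded_convol => //.
exact: iter_convol_Cc.
Qed.

(** * Transfer of the norm estimate along an arrow *)

Section transfer.
Variables (R : realType) (G H T : groupoid) (e : G -> T) (e' : H -> T).
Variables (X Y : set T).
Hypotheses (GE : lc_etale G) (HE : lc_etale H) (TE : lc_etale T).
Hypotheses (em : embedding e X) (em' : embedding e' Y) (XT : X `<=` units T).
Hypotheses (oX : open X) (oY : open Y) (clY : closed (red_arrows Y)).
Hypothesis meet : forall z, units T z -> exists t, rg t = z /\ X (sc t).
Variables (x : G) (y : H) (t : T).
Hypotheses (ux : units G x) (uy : units H y) (tx : sc t = e x) (ty : rg t = e' y).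
Variables (V : lmodType R[i]) (b : V -> V -> R[i]).
Variables (Gam S : set G) (u : G -> V -> V) (Gam' S' : set H) (u' : H -> V -> V).
Hypotheses (ID : ind_data x b Gam S u) (ID' : ind_data y b Gam' S' u').
Variable theta : G -> H.
Hypothesis theta_bij : set_bij Gam Gam' theta.
Hypothesis thetaE : forall c, Gam c ->
  e' (theta c) = gmul (gmul t (e c)) (ginv t).
Hypothesis theta_u : forall c v, Gam c -> u c v = u' (theta c) v.

Let dlG := dl x Gam u.
Let dlH := dl y Gam' u'.

(* [a] is a bump function at e(g) t^-1. Its support is a bisection, so each of the
   two convolutions in a^* w a has a single term. *)
Lemma corner_coeff g : sc g = x -> exists a : T -> R[i],
  [/\ Cc a, forall k, a k != 0 -> X (rg k) /\ Y (sc k) &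
    forall w v, gind w (dlG g v) g = gind (corner e e' a w) (dlH y v) y].
Proof.
move=> gx; have ct : sc (e g) = sc t by rewrite -(em_sc em) gx tx.
pose tau := gmul (e g) (ginv t).
have tau_sc : sc tau = e' y by rewrite /tau sc_mulV.
have tau_rg : rg tau = rg (e g) by rewrite /tau rg_mulV.
have tauW : nbhs tau [set k | X (rg k) /\ Y (sc k)].
  have n1 : nbhs tau (@rg T @^-1` X).
    apply: rg_cvg => //; rewrite tau_rg; apply: open_nbhs_nbhs; split=> //.
    by case: (em_dom em g).
  have n2 : nbhs tau (@sc T @^-1` Y).
    apply: sc_cvg => //; rewrite tau_sc; apply: open_nbhs_nbhs; split=> //.
    by rewrite -(unit_rg uy) (em_rg em'); case: (em_dom em' y).
  exact: filterI n1 n2.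
have [U [a [bU Utau UW aU [atau _]]]] := bump_exists R TE tauW.
have a0 k : a k != 0 -> U k.
  by move=> nz; apply: contrapT => nU; move: nz; rewrite (Cc_on_out aU nU) eqxx.
exists a; split; [exact: Cc_bisection bU aU|by move=> k /a0/UW|move=> w v].
have [_ _ scU] := bU.
have yy : sc y = y by exact: unit_sc.
(* Both sides become sums over the two groups, matched by [theta]. It remains to compare [w] at
   $gcg^{-1}$ with the corner at the conjugate of $c$ by $t$. *)
rewrite (gind_dl ID w v gx gx) (gind_dl ID' _ v yy yy).
rewrite (reindex_fsbig theta Gam Gam')//; apply: eq_fsbigr => c; rewrite inE => Gc.
rewrite theta_u//; congr (_ *: _).
have [cx1 cx2] := id_iso ID Gc.
have Gc' : Gam' (theta c) by have [+ _ _] := theta_bij; exact.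
have [cy1 cy2] := id_iso ID' Gc'.
set k := e' (theta c).
have kr : rg k = e' y by rewrite /k -(em_rg em') cy1.
have ks : sc k = e' y by rewrite /k -(em_sc em') cy2.
have -> : gmul (gmul y (theta c)) (ginv y) = theta c.
  by rewrite (unit_inv uy) -{1}cy1 rgK -cy2 scK.
have tk : composable tau k by rewrite /composable tau_sc kr.
rewrite /corner /= -/k [convol (invol a) _]convolE.
rewrite (@gind_single _ _ R[i]^o _ _ k (ginv tau)); last 2 first.
- by rewrite /fiber_r /= rg_inv tau_sc kr.
- move=> h hk ht; rewrite /invol; have [->|/a0 Uh] := eqVneq (a (ginv h)) 0.
    by rewrite conjC0.
  exfalso; apply: ht; rewrite -[h]ginvK; congr ginv; apply: scU => //.
  by rewrite sc_inv hk kr tau_sc.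
rewrite ginvK /invol ginvK atau conjC1 scale1r convolE.
(* The only argument of [ext e w] that survives in the inner convolution; it is the image of
   $gcg^{-1}$ in [T]. *)
pose l := gmul (gmul tau k) (ginv tau).
have ctau : composable (gmul tau k) (ginv tau).
  by rewrite /composable sc_mul// rg_inv tau_sc.
have rl : rg l = rg (gmul tau k) by rewrite /l rg_mul.
have lVE : gmul (ginv l) (gmul tau k) = tau.
  have stk : sc (gmul tau k) = sc tau by rewrite sc_mul// ks.
  by rewrite /l (ginv_mulV stk) gmulVr.
have lE : l = e (gmul (gmul g c) (ginv g)).
  have gc : composable g c by rewrite /composable gx cx1.
  have cgV : composable (gmul g c) (ginv g).
    by apply: composable_inv_r; rewrite sc_mul// cx2.
  have tc : composable t (e c) by rewrite /composable tx -cx1 -(em_rg em).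
  have tauk : gmul tau k = gmul (gmul (e g) (e c)) (ginv t).
    rewrite /k thetaE// -gmul_assoc; last 2 first.
    - by rewrite /composable tau_sc rg_mul.
    - by apply: composable_inv_r; rewrite sc_mul// -(em_sc em) cx2.
    by rewrite -(gmul_assoc _ tc) ?/composable ?tau_sc// gmulVr.
  have ecT : sc (gmul (e g) (e c)) = sc t.
    by rewrite (sc_mul ((em_composable em _ _).1 gc)) -(em_sc em) cx2 tx.
  rewrite /l tauk ginv_mulV// -gmul_assoc ?gmulVr//.
  - by rewrite (em_mul em cgV) (em_mul em gc) (em_inv em).
  - by rewrite /composable sc_mulV.
  - by apply: composable_inv_r.
rewrite /gind -(fsbig_widen [set l]); last 2 first.
- by move=> _ ->.
- move=> h [hk hl]; apply/eqP; rewrite mulf_eq0; apply/orP; right.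
  apply/eqP; apply: contrapT => /eqP/a0 Uh; apply: hl => /=.
  have hE : gmul (ginv h) (gmul tau k) = tau.
    by apply: scU => //; rewrite sc_Vmul// sc_mul// ks tau_sc.
  rewrite /l -{2}hE ginv_Vmul// gmulVl//.
by rewrite fsbig_set1 lVE atau lE (extE em) /GRing.scale /= mulr1.
Qed.

Hypothesis bounded : forall F c, Cc F -> 0 <= c -> reg_bounded F c ->
  forall eta, ind_dom y Gam' S' u' eta ->
  sqn (ind_form b S') (gind F eta) <= c ^+ 2 * sqn (ind_form b S') eta.

Let PG := ind_prerep ID GE.
Let PH := ind_prerep ID' HE.

Lemma iter_dl_growth (f : G -> R[i]) c g v : Cc f -> 0 <= c ->
  reg_bounded f c -> sc g = x -> exists2 C, 0 <= C & forall n,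
  sqn (ind_form b S) (iter n (gind (convol (invol f) f)) (dlG g v)) <=
    C * (c ^+ 4) ^+ n.
Proof.
move=> Cf c0 fc gx; pose w := convol (invol f) f.
have Cw : Cc w by apply: (convol_Cc GE) => //; exact: invol_Cc.
have wc : reg_bounded w (c ^+ 2).
  by rewrite expr2; apply: reg_bounded_convol => //;
    [exact: invol_Cc|exact: reg_bounded_invol].
have [a [Ca aXY aE]] := corner_coeff gx.
have [K K0 aK] := corner_bounded GE TE em em' XT meet Ca aXY.
have Dg : ind_dom x Gam S u (dlG g v) by exact: (dl_dom ID).
have Dy : ind_dom y Gam' S' u' (dlH y v) by exact: (dl_dom ID').
have sG0 := sqn_ge0 (pr_si PG) Dg; have sH0 := sqn_ge0 (pr_si PH) Dy.
(* The first summand covers [n = 0], where no power of [w] is available in $C_c(G)$; the second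
   covers the corner estimate for positive [n]. *)
exists (sqn (ind_form b S) (dlG g v) + K * sqn (ind_form b S') (dlH y v)).
  by rewrite addr_ge0// mulr_ge0.
have WD d : ind_dom x Gam S u d -> ind_dom x Gam S u (gind w d).
  by move=> Dd; exact: (pr_dom PG Cw Dd).
have Wsym d d' : ind_dom x Gam S u d -> ind_dom x Gam S u d' ->
    ind_form b S (gind w d) d' = ind_form b S d (gind w d').
  by move=> Dd Dd'; exact: (prerep_starsq_sym GE PG).
move=> n; rewrite (sqn_iter_sym n WD Wsym Dg).
case: n => [|n]; first by rewrite expr0 mulr1 -/(sqn _ _) lerDl mulr_ge0.
rewrite addSn -(prerep_iter GE PG _ Cw Dg).
(* Here [k.+1] is twice [n.+1], so [wk] is $w^{2(n+1)}$ and its reduced norm is at most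
   $c^{4(n+1)}$. *)
pose k := (n + n.+1)%N; rewrite -/k; pose wk := iter k (convol w) w.
have Cwk : Cc wk by exact: iter_convol_Cc.
have Dw : ind_dom x Gam S u (gind wk (dlG g v)) by exact: (pr_dom PG).
have CF := Cc_corner GE HE TE em em' clY Ca Cwk.
have DF := pr_dom PH CF Dy.
rewrite (ind_form_dl ID _ Dw.1 gx) aE.
have yy : sc y = y by exact: unit_sc.
rewrite -(ind_form_dl ID' _ DF.1 yy).
have wkc : reg_bounded wk ((c ^+ 2) ^+ k.+1) by exact: reg_bounded_iter.
have ck0 : 0 <= (c ^+ 2) ^+ k.+1 by rewrite !exprn_ge0.
have Fb := bounded CF (mulr_ge0 K0 ck0) (aK _ _ Cwk ck0 wkc) Dy.
have := cauchy_schwarz_Re (pr_si PH) DF Dy.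
set r := complex.Re _ => rle.
have : r ^+ 2 <= (K * (c ^+ 2) ^+ k.+1 * sqn (ind_form b S') (dlH y v)) ^+ 2.
  apply: le_trans rle _; rewrite exprMn [X in _ <= _ * X]expr2 mulrA.
  by rewrite ler_wpM2r.
have B0 : 0 <= K * (c ^+ 2) ^+ k.+1 * sqn (ind_form b S') (dlH y v).
  by rewrite !mulr_ge0.
move=> rB; have : r <= K * (c ^+ 2) ^+ k.+1 * sqn (ind_form b S') (dlH y v).
  apply: le_trans (ler_norm _) _.
  by rewrite -(ger0_norm B0) -ler_sqr ?nnegrE// !real_normK ?num_real.
move=> /le_trans; apply.
have -> : (c ^+ 2) ^+ k.+1 = (c ^+ 4) ^+ n.+1.
  by rewrite -!exprM; congr (_ ^+ _); rewrite /k -addSn addnn -mul2n mulnA.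
rewrite mulrDl mulrAC lerDr mulr_ge0// !exprn_ge0//.
Qed.

(** Growth is summed over the cosets before it becomes a norm bound, since norm bounds on separate
    vectors would not give the same bound on their sum. Then $|f\xi|^4 = \langle W\xi, \xi\rangle^2
    \le c^4|\xi|^4$. *)
Lemma transfer_bounded f c xi : Cc f -> 0 <= c -> reg_bounded f c ->
  ind_dom x Gam S u xi ->
  sqn (ind_form b S) (gind f xi) <= c ^+ 2 * sqn (ind_form b S) xi.
Proof.
move=> Cf c0 fc Dxi; pose w := convol (invol f) f.
have Cw : Cc w by apply: (convol_Cc GE) => //; exact: invol_Cc.
have sP := pr_si PG; pose W := gind w : (G -> V) -> (G -> V).
have WD a : ind_dom x Gam S u a -> ind_dom x Gam S u (W a).
  by move=> Da; exact: (pr_dom PG Cw Da).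
have Wsum n (r : seq G) (F : G -> G -> V) : (forall i, ind_dom x Gam S u (F i)) ->
    iter n W (\sum_(i <- r) F i) = \sum_(i <- r) iter n W (F i).
  move=> DF; elim: n => //= n ->; rewrite /W.
  by have [_ ->] := prerep_sum PG r Cw (fun i => iter_dom WD n (DF i)).
have [s sS xiE] := ind_dom_dl ID Dxi.
have [C Cn] : exists C, forall n,
    sqn (ind_form b S) (iter n W xi) <= C * (c ^+ 4) ^+ n.
  have DF i : ind_dom x Gam S u (dlG i (xi i)) by exact: (dl_dom ID).
  have [B [B0 Bn]] : exists B : G -> R, (forall g, 0 <= B g) /\ forall g n, g \in s ->
      sqn (ind_form b S) (iter n W (dlG g (xi g))) <= B g * (c ^+ 4) ^+ n.
    have /choice[B BP] : forall g, exists B, 0 <= B /\ forall n, g \in s ->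
        sqn (ind_form b S) (iter n W (dlG g (xi g))) <= B * (c ^+ 4) ^+ n.
      move=> g; have [gs|ngs] := boolP (g \in s); last by exists 0.
      have gx : sc g = x by apply: (id_sub ID); exact: sS.
      by have [B B0 Bn] := iter_dl_growth (xi g) Cf c0 fc gx; exists B.
    by exists B; split=> [g|g n gs]; have [B0 Bn] := BP g => //; exact: Bn.
  exists (2 ^+ size s * \sum_(g <- s) B g) => n.
  rewrite xiE Wsum//; apply: le_trans (sqn_sum sP _ (fun i => iter_dom WD n (DF i))) _.
  rewrite -mulrA ler_wpM2l ?exprn_ge0// mulr_suml.
  rewrite big_seq [leRHS]big_seq; apply: ler_sum => g gs; exact: Bn.
have c40 : 0 <= c ^+ 4 by rewrite exprn_ge0.
have Wsym d d' : ind_dom x Gam S u d -> ind_dom x Gam S u d' ->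
    ind_form b S (W d) d' = ind_form b S d (W d').
  by move=> Dd Dd'; exact: (prerep_starsq_sym GE PG).
have Wb := bounded_by_growth sP WD Wsym Dxi c40 Cn.
have := cauchy_schwarz_Re sP (WD _ Dxi) Dxi.
have Dfx := pr_dom PG Cf Dxi.
rewrite (prerep_sqn GE PG Cf Dxi) /= => H2.
have x0 := sqn_ge0 sP Dxi; have fx0 := sqn_ge0 sP Dfx.
have B0 : 0 <= c ^+ 2 * sqn (ind_form b S) xi by rewrite mulr_ge0// sqr_ge0.
rewrite -ler_sqr ?nnegrE//; apply: le_trans H2 _.
rewrite exprMn -exprM [X in _ <= _ * X]expr2 mulrA.
by rewrite ler_wpM2r.
Qed.

End transfer.

(** * Transport along isomorphisms *)

Record isomorphism (A B : groupoid) (phi : A -> B) (psi : B -> A) : Prop :=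
  Isomorphism {
    is_K : cancel phi psi;
    is_VK : cancel psi phi;
    is_cont : continuous phi;
    is_contV : continuous psi;
    is_composable : forall g h, composable g h <-> composable (phi g) (phi h);
    is_mul : forall g h, composable g h -> phi (gmul g h) = gmul (phi g) (phi h) }.

Lemma isomorphismV (A B : groupoid) (phi : A -> B) (psi : B -> A) :
  isomorphism phi psi -> isomorphism psi phi.
Proof.
move=> I; split.
- exact: (is_VK I).
- exact: (is_K I).
- exact: (is_contV I).
- exact: (is_cont I).
- by move=> g h; rewrite (is_composable I) !(is_VK I).
- move=> g h c; apply: (can_inj (is_K I)).
  by rewrite (is_VK I) (is_mul I) ?(is_VK I)//; apply/(is_composable I); rewrite !(is_VK I).
Qed.

Lemma isomorphism_embedding (A B : groupoid) (phi : A -> B) (psi : B -> A) :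
  isomorphism phi psi -> embedding phi setT.
Proof.
move=> I; split.
- exact: (can_inj (is_K I)).
- by [].
- by move=> t _ _; exists (psi t); rewrite (is_VK I).
- exact: (is_composable I).
- exact: (is_mul I).
- exact: (is_cont I).
- move=> U oU; rewrite (_ : phi @` U = psi @^-1` U).
    by apply: open_comp oU => g _; exact: (is_contV I).
  apply/seteqP; split=> [_ [g Ug <-]|b Ub]; first by rewrite /= (is_K I).
  by exists (psi b) => //; rewrite (is_VK I).
Qed.

Section transport.
Variables (R : realType) (A B : groupoid) (phi : A -> B) (psi : B -> A).
Hypothesis I : isomorphism phi psi.
Let em := isomorphism_embedding I.
Implicit Types (f : B -> R[i]).

Lemma comp_isoVK f : f \o phi \o psi = f.
Proof. by apply/funext => g; rewrite /= (is_VK I). Qed.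

(** The groupoids in question will be isotropy groups, for which [lc_etale] is not established here;
    so the spanning functions are transported directly instead of through [Cc_ind]. *)
Lemma Cc_comp f : Cc f -> Cc (f \o phi).
Proof.
move=> [n [c [F [HF ->]]]].
rewrite (_ : _ \o phi = \sum_(k < n) c k *: (F k \o phi)); last first.
  by apply/funext => g; rewrite /= !fct_sumE.
apply: Cc_sum => k _; apply: Cc_scale.
have [U [oU /(hausdorff_openP oU) sU]] := HF k.
move=> /(Cc_onP _ oU)[cF [K [cK KU K0]]].
have oV : open (phi @^-1` U) by apply: open_comp oU => g _; exact: (is_cont I).
apply: (Cc_of_on oV).
  move=> p q Up Uq cl; apply: (can_inj (is_K I)); apply: sU => // M N Mp Nq.
  have Mp' : nbhs p (phi @^-1` M) by exact: (is_cont I).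
  have Nq' : nbhs q (phi @^-1` N) by exact: (is_cont I).
  by have [r [Mr Nr]] := cl _ _ Mp' Nq'; exists (phi r).
apply/(Cc_onP _ oV); split.
  by move=> p Up; apply: (cvg_comp _ _ (is_cont I (x := p))); exact: (cF (phi p) Up).
exists (psi @` K); split.
- apply: continuous_compact cK; apply: continuous_subspaceT.
  exact: (is_contV I).
- by move=> _ [b Kb <-]; rewrite /= (is_VK I); exact: KU.
- move=> g nK; apply: K0 => Kg; apply: nK; exists (phi g) => //.
  by rewrite (is_K I).
Qed.

Lemma convol_comp f f' : convol (f \o phi) (f' \o phi) = convol f f' \o phi.
Proof.
apply/funext => g; rewrite /convol /=.
rewrite (reindex_fsbig phi (fiber_r (rg g)) (fiber_r (rg (phi g)))).
  apply: eq_fsbigr => h; rewrite inE => hg; congr (_ * f' _).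
  by rewrite (em_mul em (composable_inv_l hg)) (em_inv em).
split.
- by move=> h hg; rewrite /fiber_r /= -!(em_rg em) hg.
- by move=> h k _ _; exact: (em_inj em).
- move=> b bg; exists (psi b); rewrite ?(is_VK I)//.
  by apply: (em_inj em); rewrite !(em_rg em) (is_VK I).
Qed.

Lemma invol_comp f : invol (f \o phi) = invol f \o phi.
Proof. by apply/funext => g; rewrite /invol /= (em_inv em). Qed.

Lemma delta_comp b : delta R b \o phi = delta R (psi b).
Proof.
apply/funext => g; rewrite /delta /=; congr ((nat_of_bool _)%:R).
by apply/eqP/eqP => [<-|->]; rewrite ?(is_K I)// (is_VK I).
Qed.

Lemma full_norm_comp_le f : (full_norm (f \o phi) <= full_norm f)%E.
Proof.
apply: ub_ereal_sup => _ [V [pi [P ->]]]; apply: ereal_sup_ubound.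
exists V, (fun f => pi (f \o phi)); split=> //; split.
- by move=> f1 f2 _ _ ->.
- by move=> f1 /Cc_comp C1; exact: (rep_linear P C1).
- by move=> f1 /Cc_comp C1; exact: (rep_bounded P C1).
- by move=> c f1 f2 v /Cc_comp C1 /Cc_comp C2; exact: (repP P c v C1 C2).
- by move=> f1 f2 v /Cc_comp C1 /Cc_comp C2; rewrite -(repM P v C1 C2) /= convol_comp.
- by move=> f1 v w /Cc_comp C1; rewrite (repS P v w C1) /= invol_comp.
Qed.

(** An isomorphism is an embedding onto the reduction to all of [B], and translation by the unit
    [phi y] is then an isometry. *)
Lemma reg_bounded_comp f c : reg_bounded f c -> reg_bounded (f \o phi) c.
Proof.
move=> fc y uy eta De; have eta0 h : sc h <> y -> eta h = 0 by move: h; exact: De.1.1.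
have up := em_units em uy; have ty : sc (phi y) = phi y by exact: unit_sc.
have S := @sqn_tr R _ _ _ _ em _ _ uy ty; rewrite (unit_rg up) in S.
pose zeta : B -> R[i]^o := ext phi eta.
have T (F : B -> R[i]^o) k : ~ [set: B] (rg k) -> F k = 0 by move=> /(_ Logic.I).
rewrite -(tr_ext em uy eta0) -(tr_gind em f ty (@T zeta)).
rewrite -(S _ (@T (gind f zeta))) -(S _ (@T zeta)).
exact: (fc _ up _ (reg_dom_ext em uy De)).
Qed.

End transport.

Section transport_rep.
Variables (R : realType) (A B : groupoid) (phi : A -> B) (psi : B -> A).
Hypothesis I : isomorphism phi psi.
Let IV := isomorphismV I.

Lemma full_norm_comp (f : B -> R[i]) : full_norm (f \o phi) = full_norm f.
Proof.
apply/eqP; rewrite eq_le (full_norm_comp_le I)/=.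
by rewrite -{1}(comp_isoVK I f); exact: (full_norm_comp_le IV).
Qed.

Lemma Cstar_dom_comp (u : Cstar R B) : sa_dom u ->
  sa_dom ((fun n => u n \o phi) : Cstar R A).
Proof.
move=> [Cu uC]; split=> [n|e e0]; first exact: (Cc_comp I).
have [M HM] := uC e e0; exists M => m n Mm Mn.
by rewrite -[_ - _]/((u m - u n) \o phi) full_norm_comp; exact: HM.
Qed.

Lemma rep_comp (V : hilbert R) (rho : Cstar R A -> V -> V) :
  representation rho ->
  representation (fun u : Cstar R B => rho (fun n => u n \o phi)).
Proof.
move=> P; split.
- move=> u v /Cstar_dom_comp Du /Cstar_dom_comp Dv uv; apply: (rep_wd P Du Dv).
  have E : (fun n => full_norm ((u n \o phi : A -> R[i]) - (v n \o phi))) =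
      (fun n => full_norm ((u n : B -> R[i]) - v n)).
    by apply/funext => n; rewrite -(full_norm_comp (u n - v n)).
  rewrite /= /null_seq; move: uv; rewrite /= /null_seq -E; exact.
- by move=> u /Cstar_dom_comp Du; exact: (rep_linear P Du).
- by move=> u /Cstar_dom_comp Du; exact: (rep_bounded P Du).
- by move=> c u v w /Cstar_dom_comp Du /Cstar_dom_comp Dv; exact: (repP P c w Du Dv).
- move=> u v w /Cstar_dom_comp Du /Cstar_dom_comp Dv.
  rewrite -(repM P w Du Dv); congr (rho _ w); apply/funext => n.
  by rewrite /= (convol_comp I).
- move=> u v w /Cstar_dom_comp Du; rewrite (repS P v w Du).
  congr (ip V v (rho _ w)); apply/funext => n.
  by rewrite /= (invol_comp I).
Qed.

End transport_rep.

Lemma red_norm_ge0 (R : realType) (G : groupoid) (x : G) (f : G -> R[i]) :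
  units G x -> fiber_finite f -> (0 <= red_norm f)%E.
Proof.
move=> ux Ff.
apply: le_trans (_ : (op_norm (l2 x) (l2norm x) (reg x f) <= _)%E); last first.
  by apply: ereal_sup_ubound; exists x.
rewrite (reg_op_normE ux Ff); have D0 := ind_dom0 (reg_data R ux).
apply: (@le_trans _ _ (sqrte (ind_sqn (@reg_ip R) (fiber_s x)
   (gind f (0 : G -> R[i]^o))))); first exact: sqrte_ge0.
apply: ereal_sup_ubound; exists 0 => //.
split; first exact: (dom_full (reg_data R ux)).
rewrite (ind_sqn_dom (reg_data R ux) D0).
by rewrite (sqn0 (ind_form_si (reg_data R ux))) sqrte0.
Qed.

Lemma red_norm_comp_le (R : realType) (A B : groupoid) (phi : A -> B)
    (psi : B -> A) (f : B -> R[i]) (y : B) : isomorphism phi psi -> units B y ->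
  fiber_finite f -> fiber_finite (f \o phi) -> (red_norm (f \o phi) <= red_norm f)%E.
Proof.
move=> I uy Ff Ffp; have f0 := red_norm_ge0 uy Ff.
case E : (red_norm f) f0 => [c| |]// c0; last by rewrite leey.
apply: red_norm_le => //.
by apply: (reg_bounded_comp I); apply: red_norm_bounded => //; rewrite E.
Qed.

Section isotropy_finite.
Variables (R : realType) (G : groupoid) (x : G).
Hypothesis GE : lc_etale G.

Lemma iso_compact_finite (K : set (isotropy x)) : compact K -> finite_set K.
Proof.
move=> cK; have [|s _ Ks] := compact_finite_subcover (f := set1) cK.
  by move=> h _; apply: open_nbhs_nbhs; split=> //; exact: iso_open1.
apply: sub_finite_set (finite_seq s) => h /Ks[k ks] /= ->.
exact: ks.
Qed.

(** The isotropy group is discrete, so compact supports are finite. *)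
Lemma iso_fiber_finite (f : isotropy x -> R[i]) : Cc f -> fiber_finite f.
Proof.
move=> [n [c [F [HF ->]]]].
have fin : finite_set [set h | (\sum_(k < n) c k *: F k) h != 0].
  apply: sub_finite_set (_ : finite_set (\bigcup_(k in [set: 'I_n]) [set h | F k h != 0])).
    move=> h /=; rewrite fct_sumE => nz; apply: contrapT => no.
    move: nz; rewrite big1 ?eqxx// => k _.
    rewrite -[LHS]/(c k * F k h).
    apply/eqP; rewrite mulf_eq0; apply/orP; right; apply: contrapT => nz.
    by apply: no; exists k => //; apply/negP.
  apply: bigcup_finite => [|k _]; first exact: finite_finset.
  have [U [oU _ [_ [K [cK _ K0]]]]] := HF k.
  apply: sub_finite_set (iso_compact_finite cK) => h /= nz.
  by apply: contrapT => /K0 h0; move: nz; rewrite h0 eqxx.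
by move=> z; split; apply: sub_finite_set fin => h [].
Qed.

End isotropy_finite.

(** * Conjugation of isotropy groups and the exotic norm *)

Section conjugation.
Variables (G H T : groupoid) (e : G -> T) (e' : H -> T) (X Y : set T).
Hypotheses (GE : lc_etale G) (HE : lc_etale H).
Hypotheses (em : embedding e X) (em' : embedding e' Y).
Variables (x : G) (y : H) (t : T).
Hypotheses (ux : units G x) (uy : units H y) (tx : sc t = e x) (ty : rg t = e' y).

Lemma conj_ex (h : isotropy x) : exists k : isotropy y,
  e' (val k) = gmul (gmul t (e (val h))) (ginv t).
Proof.
have th : composable t (e (val h)) by rewrite /composable tx -(em_rg em) val_rg.
have st : sc (gmul t (e (val h))) = sc t.
  by rewrite sc_mul// -(em_sc em) val_sc tx.
have rgE : rg (gmul (gmul t (e (val h))) (ginv t)) = e' y.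
  by rewrite rg_mulV// rg_mul.
have scE : sc (gmul (gmul t (e (val h))) (ginv t)) = e' y by rewrite sc_mulV.
have [Yr Ys] := em_dom em' y.
have Y0 : Y (e' y) by rewrite -(unit_rg uy) (em_rg em').
have [||k kE] := em_surj em' (t := gmul (gmul t (e (val h))) (ginv t)).
- by rewrite rgE.
- by rewrite scE.
have p : red_arrows [set y] k.
  by split; apply: (em_inj em'); rewrite ?(em_rg em') ?(em_sc em') kE.
by exists (iso_lift p).
Qed.

Lemma conj_mul (h k : isotropy x) :
  gmul (gmul (gmul t (e (val h))) (ginv t)) (gmul (gmul t (e (val k))) (ginv t)) =
  gmul (gmul t (e (val (gmul h k)))) (ginv t).
Proof.
have th j : composable t (e (val (j : isotropy x))).
  by rewrite /composable tx -(em_rg em) val_rg.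
have st j : sc (gmul t (e (val (j : isotropy x)))) = sc t.
  by rewrite sc_mul// -(em_sc em) val_sc tx.
have hk := iso_composable_val h k.
rewrite val_gmul (em_mul em hk) -(gmul_assoc (th h) ((em_composable em _ _).1 hk)).
rewrite -gmul_assoc; last 2 first.
- by rewrite /composable sc_mulV// rg_mul.
- exact: composable_inv_r.
congr (gmul _ _); rewrite -gmul_assoc ?gmulVr//.
by rewrite /composable sc_mulV.
Qed.

Lemma conjK (g : T) : rg g = sc t -> sc g = sc t ->
  gmul (gmul (ginv t) (gmul (gmul t g) (ginv t))) (ginv (ginv t)) = g.
Proof.
move=> gr gs; have tg : composable t g by [].
rewrite ginvK -gmul_assoc; last 2 first.
- by rewrite /composable sc_inv rg_mul.
- by apply: composable_inv_r; rewrite sc_mul.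
by rewrite gmulKl// gmulVr.
Qed.

End conjugation.

Lemma iso_continuous (G : groupoid) (x : G) (Z : topologicalType)
  (f : isotropy x -> Z) : lc_etale G -> continuous f.
Proof.
move=> GE h A /nbhs_singleton fA.
have : nbhs h [set h] by apply: open_nbhs_nbhs; split=> //; exact: iso_open1.
by apply: filterS => _ ->.
Qed.

Lemma conj_isomorphism (G H T : groupoid) (e : G -> T) (e' : H -> T)
    (X Y : set T) (x : G) (y : H) (t : T) :
  lc_etale G -> lc_etale H -> embedding e X -> embedding e' Y ->
  units G x -> units H y -> sc t = e x -> rg t = e' y ->
  exists (phi : isotropy x -> isotropy y) (psi : isotropy y -> isotropy x),
  [/\ isomorphism phi psi,
      forall h, e' (val (phi h)) = gmul (gmul t (e (val h))) (ginv t) &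
      forall k, e (val (psi k)) =
        gmul (gmul (ginv t) (e' (val k))) (ginv (ginv t))].
Proof.
move=> GE HE em em' ux uy tx ty.
have tx' : sc (ginv t) = e' y by rewrite sc_inv.
have ty' : rg (ginv t) = e x by rewrite rg_inv.
have /choice[phi phiE] := conj_ex em em' uy tx ty.
have /choice[psi psiE] := conj_ex em' em ux tx' ty'.
exists phi, psi; split=> //; split.
- move=> h; apply/val_inj/(em_inj em); rewrite psiE phiE conjK//.
    by rewrite -(em_rg em) val_rg.
  by rewrite -(em_sc em) val_sc.
- move=> k; apply/val_inj/(em_inj em'); rewrite phiE psiE.
  have := @conjK T (ginv t) (e' (val k)); rewrite !ginvK sc_inv; apply.
    by rewrite -(em_rg em') val_rg.
  by rewrite -(em_sc em') val_sc.
- exact: iso_continuous.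
- exact: iso_continuous.
- by move=> g h; split=> _; exact: iso_composable.
- move=> g h _; apply/val_inj/(em_inj em').
  rewrite val_gmul (em_mul em' (iso_composable_val _ _)) !phiE.
  by rewrite (conj_mul em tx).
Qed.

(** A representation admissible at [y] is pulled back along [psi] to one at [x] with the same value
    on [f]. Admissibility is carried over by passing to the norm estimate, transferring it along
    [t], and returning. *)
Lemma exotic_norm_le (R : realType) (G H T : groupoid) (e : G -> T) (e' : H -> T)
    (X Y : set T) (x : G) (y : H) (t : T)
    (phi : isotropy x -> isotropy y) (psi : isotropy y -> isotropy x)
    (f : isotropy y -> R[i]) :
  lc_etale G -> lc_etale H -> lc_etale T -> embedding e X -> embedding e' Y ->
  X `<=` units T -> open X -> open Y -> closed (red_arrows Y) ->
  (forall z, units T z -> exists t, rg t = z /\ X (sc t)) ->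
  units G x -> units H y -> sc t = e x -> rg t = e' y -> isomorphism phi psi ->
  (forall h, e' (val (phi h)) = gmul (gmul t (e (val h))) (ginv t)) ->
  (exotic_norm f <= exotic_norm (f \o phi))%E.
Proof.
move=> GE HE TE em em' XT oX oY clY meet ux uy tx ty I phiE.
apply: ub_ereal_sup => _ [V [rho [P fac ->]]]; apply: ereal_sup_ubound.
pose rho' : Cstar R (isotropy x) -> V -> V :=
  fun u => rho (fun n => u n \o psi).
have P' : representation rho' by exact: (rep_comp (isomorphismV I)).
exists V, rho'; split=> //; last first.
  congr (hnorm (rho _)); apply/funext => n.
  by rewrite /in_Cstar (comp_isoVK I).
apply: (bounded_factors GE ux P') => F c CF c0 Fc xi Dxi.
(* The default value [y] is immaterial: [theta] is evaluated on the isotropy group only. *)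
pose theta (c : G) : H :=
  if pselect (red_arrows [set x] c) is left p then val (phi (iso_lift p)) else y.
have thetaE h : theta (val h) = val (phi h).
  rewrite /theta; case: pselect => [p|[]]; last exact: iso_set_val.
  by congr (val (phi _)); exact: val_inj.
apply: (transfer_bounded GE HE TE em em' XT oX oY clY meet uy tx ty
  (iso_data GE ux P') (iso_data HE uy P) (theta := theta)) => //.
- split.
  + by move=> _ /iso_valP[h ->]; rewrite thetaE; exact: iso_set_val.
  + move=> a b; rewrite !inE => /iso_valP[h ->] /iso_valP[k ->].
    by rewrite !thetaE => /val_inj/(can_inj (is_K I)) ->.
  + move=> _ /iso_valP[k ->]; exists (val (psi k)); first exact: iso_set_val.
    by rewrite thetaE (is_VK I).
- by move=> _ /iso_valP[h ->]; rewrite thetaE phiE.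
- move=> _ v /iso_valP[h ->]; rewrite thetaE !iso_actE.
  congr (rho _ v); apply/funext => n.
  by rewrite /in_Cstar (delta_comp R (isomorphismV I)).
- move=> F' c' CF' c'0 F'c' eta De.
  exact: (factors_bounded HE uy P CF' c'0 F'c' fac De).
Qed.

(** The complement consists of the arrows with an end in [X], which is an open condition. *)
Lemma closed_red_arrows (T : groupoid) (X Y : set T) : lc_etale T ->
  X `|` Y = units T -> X `&` Y = set0 -> open X -> closed (red_arrows Y).
Proof.
move=> TE XY XY0 oX.
rewrite -[red_arrows Y]setCK closedC.
rewrite (_ : ~` _ = @rg T @^-1` X `|` @sc T @^-1` X).
  apply: openU; first by apply: open_comp oX => t _; exact: rg_cvg.
  by apply: open_comp oX => t _; exact: sc_cvg.
have ur t : (X `|` Y) (rg t) by rewrite XY; exact: rg_unit.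
have us t : (X `|` Y) (sc t) by rewrite XY -rg_inv; exact: rg_unit.
have XYF z : X z -> Y z -> False.
  by move=> Xz Yz; have : (X `&` Y) z by []; rewrite XY0.
apply/seteqP; split=> t.
  move=> nR; have [Xr|Yr] := ur t; first by left.
  by have [Xs|Ys] := us t; [right|case: nR].
by move=> [Xr|Xs] [Yr Ys]; [exact: XYF Xr Yr|exact: XYF Xs Ys].
Qed.

Theorem corollary4p17 (R : realType) (G H : groupoid)
    (G_etale : lc_etale G) (H_etale : lc_etale H)
    (GH : morita_equivalent G H)
    (G_eq : exotic_eq_reduced R G) :
  exotic_eq_reduced R H.
Proof.
have [T [X [Y [TE [XY XY0 oX' oY'] GX HY meet]]]] := GH.
have XT : X `<=` units T by move=> z Xz; rewrite -XY; left.
have YT : Y `<=` units T by move=> z Yz; rewrite -XY; right.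
have oX := open_units_sub TE oX' XT; have oY := open_units_sub TE oY' YT.
have clY := closed_red_arrows TE XY XY0 oX.
have clX : closed (red_arrows X).
  by apply: (closed_red_arrows TE _ _ oY); rewrite (setUC, setIC).
have [e em] := iso_embedding TE oX' XT GX.
have [e' em'] := iso_embedding TE oY' YT HY.
have meetX z : units T z -> exists t, rg t = z /\ X (sc t).
  by move=> /meet[].
have meetY z : units T z -> exists t, rg t = z /\ Y (sc t).
  by move=> /meet[].
move=> y uy f Cf; have [t [ty Xt]] := meetX _ (em_units em' uy).
have [x ux /esym tx] := em_units_ex em (XT _ Xt) Xt.
have [phi [psi [I phiE psiE]]] :=
  conj_isomorphism G_etale H_etale em em' ux uy tx ty.
have Cfp := Cc_comp I Cf; have IV := isomorphismV I.
have fin := iso_fiber_finite H_etale Cf.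
have finp := iso_fiber_finite G_etale Cfp.
(* These provide units of the isotropy groups: over an empty unit space the supremum [red_norm]
   would be $-\infty$. *)
have py : red_arrows [set y] y by split; [exact: unit_rg|exact: unit_sc].
have px : red_arrows [set x] x by split; [exact: unit_rg|exact: unit_sc].
have fE : f = f \o phi \o psi by rewrite (comp_isoVK I).
transitivity (exotic_norm (f \o phi)).
  apply/eqP; rewrite eq_le; apply/andP; split.
    exact: (exotic_norm_le f G_etale H_etale TE em em' XT oX oY clY meetX ux uy tx ty I).
  (* The opposite inequality is the same lemma with [G] and [H] exchanged and the inverse arrow. *)
  rewrite {2}fE.
  apply: (exotic_norm_le (f \o phi) H_etale G_etale TE em' em YT oY oX clX meetY
    uy ux (t := ginv t) _ _ IV) => //; by rewrite ?sc_inv ?rg_inv.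
rewrite (G_eq x ux _ Cfp); apply/eqP; rewrite eq_le; apply/andP; split.
  exact: (red_norm_comp_le I (rg_unit (iso_lift py)) fin finp).
rewrite {1}fE; apply: (red_norm_comp_le IV (rg_unit (iso_lift px)) finp).
by rewrite -fE.
Qed.
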